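(* Let $(M,\mathcal{J})$ be a generalized complex manifold. The following properties are equivalent: (1) $M$ satisfies the $dd^{\mathcal{J}}$-lemma; (2) the inclusion $i:(\Omega_{d^{\mathcal{J}}},d)\hookrightarrow(\Omega,d)$ of the complex of $d^{\mathcal{J}}$-closed forms into the complex of differential forms induces an isomorphism in cohomology, $i^*:H^\bullet(\Omega_{d^{\mathcal{J}}})\cong H^\bullet(\Omega)$. Moreover, both imply that every cohomology class $a\in H^\bullet(M)$ can be represented by a form $\alpha=\sum_k\alpha_k$ with $\alpha_k\in\mathcal{U}^k$ and $d\alpha_k=0$ for every $k$, and that, if $a=0$ is the trivial cohomology class, then for any such $\alpha$ each $\alpha_k$ is exact. In particular, each cohomology class can be represented by a form which is both $d$-closed and $d^{\mathcal{J}}$-closed.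
   Context: A generalized complex structure on $M^{2n}$ is an endomorphism $\mathcal{J}$ of $TM\oplus T^*M$, orthogonal for $\langle X+\xi,Y+\eta\rangle=\frac12(\xi(Y)+\eta(X))$, with $\mathcal{J}^2=-\mathrm{Id}$ and $+i$-eigenbundle $L\subset (TM\oplus T^*M)\otimes\mathbb{C}$ closed under the Courant bracket $[X+\xi,Y+\eta]=[X,Y]+X\lfloor d\eta-Y\lfloor d\xi+\frac12d(X\lfloor\eta-Y\lfloor\xi)$. Let $TM\oplus T^*M$ act on forms by $(X+\xi)\cdot\rho=X\lfloor\rho+\xi\wedge\rho$ (extended to the Clifford algebra). Let $U^n\subset\wedge^\bullet T^*M\otimes\mathbb{C}$ be the line bundle of forms annihilated by $L$ and $U^{k}=\wedge^{n-k}\overline{L}\cdot U^n$ for $-n\le k\le n$, so that $\wedge^\bullet T^*M\otimes\mathbb{C}=\bigoplus_{k=-n}^nU^k$. Let $\mathcal{U}^k$ be the space of sections of $U^k$. Then $d:\mathcal{U}^k\to\mathcal{U}^{k+1}\oplus\mathcal{U}^{k-1}$; write $d=\partial+\overline{\partial}$ with $\partial:\mathcal{U}^k\to\mathcal{U}^{k+1}$, $\overline{\partial}:\mathcal{U}^k\to\mathcal{U}^{k-1}$, and set $d^{\mathcal{J}}=-i(\partial-\overline{\partial})$. $M$ satisfies the $dd^{\mathcal{J}}$-lemma if $$\operatorname{im}d\cap\ker d^{\mathcal{J}}=\operatorname{im}d^{\mathcal{J}}\cap\ker d=\operatorname{im}dd^{\mathcal{J}}.$$ *)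

(* Defs.v *)
From HB Require Import structures.
From mathcomp Require Import all_boot all_order all_algebra.
From mathcomp Require Import all_classical all_reals all_analysis.
From mathcomp Require Import complex.

Set Implicit Arguments.
Unset Strict Implicit.
Unset Printing Implicit Defensive.

Import Order.TTheory GRing.Theory Num.Theory.
Import numFieldNormedType.Exports.

Local Open Scope classical_set_scope.
Local Open Scope ring_scope.

(** * Smooth functions on open subsets of R^m *)

Section SmoothFunctions.
Variables (R : realType) (m : nat).
Implicit Types (f : 'rV[R]_m -> R) (W : set 'rV[R]_m).

Definition iterD (vs : seq 'rV[R]_m) f : 'rV[R]_m -> R :=
  foldr (fun v g p => 'D_v g p) f vs.

(* Every iterated directional derivative exists and is continuous on [W].
   Only used for open [W]. *)
Definition smooth_on W f : Prop :=
  forall (vs : seq 'rV[R]_m) (p : 'rV[R]_m), W p ->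
    {for p, continuous (iterD vs f)} /\
    (forall v : 'rV[R]_m, derivable (iterD vs f) p v).

Definition csmooth_on W (f : 'rV[R]_m -> R[i]) : Prop :=
  smooth_on W (fun p => complex.Re (f p)) /\
  smooth_on W (fun p => complex.Im (f p)).

Definition cderive (v : 'rV[R]_m) (f : 'rV[R]_m -> R[i]) (p : 'rV[R]_m) : R[i] :=
  ('D_v (fun q => complex.Re (f q)) p +i* 'D_v (fun q => complex.Im (f q)) p)%C.

End SmoothFunctions.

(** * Smooth manifolds *)

(* A smooth atlas.  The functions [chart i] and [chart_inv i] are total, but
   only their restrictions to [dom i] and to its image are meaningful.
   [chart_at] records, for every point, one chart of the atlas around it. *)
Record smooth_manifold (R : realType) (m : nat) : Type := SmoothManifold {
  carrier :> topologicalType;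
  carrier_hausdorff : hausdorff_space carrier;
  carrier_second_countable : @second_countable carrier;
  chart_index : Type;
  dom : chart_index -> set carrier;
  chart : chart_index -> carrier -> 'rV[R]_m;
  chart_inv : chart_index -> 'rV[R]_m -> carrier;
  dom_open : forall i, open (dom i);
  image_open : forall i, open (chart i @` dom i);
  chartK : forall i x, dom i x -> chart_inv i (chart i x) = x;
  chart_continuous : forall i, {within dom i, continuous (chart i)};
  chart_inv_continuous :
    forall i, {within chart i @` dom i, continuous (chart_inv i)};
  transition_smooth : forall i j (a : 'I_m),
    smooth_on (chart i @` (dom i `&` dom j))
              (fun p => chart j (chart_inv i p) 0 a);
  chart_at : carrier -> chart_index;
  mem_chart_at : forall x, dom (chart_at x) x
}.

(** * Tangent vectors and differential forms *)

Section Forms.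
Variables (R : realType) (m : nat) (M : smooth_manifold R m).
Local Notation C := (R[i]).
Local Notation V := ('rV[R]_m).

(* The tangent space at [x] is R^m, identified with T_x M through the chart
   [chart_at x].  Tangent coordinates at [x] are changed to those of the chart
   [i] by [v |-> v *m to_chart i x], and back by [of_chart i x]. *)
Definition to_chart (i : chart_index M) (x : M) : 'M[R]_m :=
  jacobian (chart i \o chart_inv (chart_at x)) (chart (chart_at x) x).

Definition of_chart (i : chart_index M) (x : M) : 'M[R]_m :=
  jacobian (chart (chart_at x) \o chart_inv i) (chart i x).

(* A complex-valued exterior form of mixed degree on R^m: its component of
   degree k is the restriction to sequences of k vectors. *)
Definition exform : Type := seq V -> C.

Definition multilinear (w : exform) : Prop :=
  forall (s1 s2 : seq V) (a : R) (u v : V),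
    w (s1 ++ (a *: u + v) :: s2) =
    (a%:C)%C * w (s1 ++ u :: s2) + w (s1 ++ v :: s2).

Definition alternating (w : exform) : Prop :=
  forall (s1 s2 s3 : seq V) (v : V), w (s1 ++ v :: s2 ++ v :: s3) = 0.

Definition is_exform (w : exform) : Prop := multilinear w /\ alternating w.

Definition del (j : nat) (s : seq V) : seq V := take j s ++ drop j.+1 s.

Definition rawform : Type := M -> exform.

Definition form_in_chart (i : chart_index M) (w : rawform) : V -> exform :=
  fun p s => let x := chart_inv i p in
    w x [seq v *m of_chart i x | v <- s].

Definition smooth_form (w : rawform) : Prop :=
  forall (i : chart_index M) (s : seq V),
    csmooth_on (chart i @` dom i) (fun p => form_in_chart i w p s).

(* Smooth sections of the complexified exterior algebra bundle, all degrees. *)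
Definition Omega : set rawform :=
  [set w | (forall x, is_exform (w x)) /\ smooth_form w].

(* The exterior derivative at [x], computed in the chart [chart_at x]:
   (dw)(v_0, .., v_k) = \sum_j (-1)^j D_(v_j) (w (.., v_j omitted, ..)). *)
Definition d (w : rawform) : rawform := fun x s =>
  let i := chart_at x in
  \sum_(j < size s)
    (-1) ^+ j * cderive (nth 0 s j)
                  (fun p => form_in_chart i w p (del j s)) (chart i x).

(** * The bundle TM + T^*M *)

(* An element X + xi of the fibre of TM + T^*M (or of its complexification)
   is the row vector [row_mx X xi], where xi(v) = \sum_a xi_a v_a. *)
Local Notation gen := ('rV[R]_(m + m)).
Local Notation cgen := ('rV[C]_(m + m)).

Definition pairing (u v : gen) : R :=
  2^-1 * ((rsubmx u *m (lsubmx v)^T) 0 0 + (rsubmx v *m (lsubmx u)^T) 0 0).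

Definition to_chart_gen (i : chart_index M) (x : M) : 'M[R]_(m + m) :=
  block_mx (to_chart i x) 0 0 (of_chart i x)^T.

Definition of_chart_gen (i : chart_index M) (x : M) : 'M[R]_(m + m) :=
  block_mx (of_chart i x) 0 0 (to_chart i x)^T.

Definition gen_in_chart (i : chart_index M) (u : M -> cgen) : V -> cgen :=
  fun p => let x := chart_inv i p in
    u x *m map_mx (real_complex R) (to_chart_gen i x).

Definition smooth_gen (W : set M) (u : M -> cgen) : Prop :=
  forall (i : chart_index M) (a : 'I_(m + m)),
    csmooth_on (chart i @` (dom i `&` W)) (fun p => gen_in_chart i u p 0 a).

(* The Courant bracket at [x], computed in the chart [chart_at x], with
   u = X + xi and v = Y + eta. *)
Definition courant (u v : M -> cgen) (x : M) : cgen :=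
  let i := chart_at x in
  let p := chart i x in
  let D (a : 'I_m) (f : V -> C) : C := cderive (delta_mx 0 a) f p in
  let X (a : 'I_m) (q : V) : C := gen_in_chart i u q 0 (lshift m a) in
  let xi (a : 'I_m) (q : V) : C := gen_in_chart i u q 0 (rshift m a) in
  let Y (a : 'I_m) (q : V) : C := gen_in_chart i v q 0 (lshift m a) in
  let eta (a : 'I_m) (q : V) : C := gen_in_chart i v q 0 (rshift m a) in
  row_mx
    (* [X, Y] *)
    (\row_a \sum_b (X b p * D b (Y a) - Y b p * D b (X a)))
    (* X _| d eta - Y _| d xi + 1/2 d (X _| eta - Y _| xi) *)
    (\row_a (\sum_b X b p * (D b (eta a) - D a (eta b))
             - \sum_b Y b p * (D b (xi a) - D a (xi b))
             + 2^-1 * D a (fun q => \sum_b (X b q * eta b q - Y b q * xi b q)))).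

(* The action (X + xi) . w = X _| w + xi /\ w, with X complex. *)
Definition contract (X : 'rV[C]_m) (w : exform) : exform := fun s =>
  w (map_mx (fun z => complex.Re z) X :: s) + 'i%C * w (map_mx (fun z => complex.Im z) X :: s).

Definition wedge1 (xi : 'rV[C]_m) (w : exform) : exform := fun s =>
  \sum_(j < size s)
    (-1) ^+ j * (map_mx (real_complex R) (nth 0 s j) *m xi^T) 0 0 * w (del j s).

Definition clifford (u : cgen) (w : exform) : exform := fun s =>
  contract (lsubmx u) w s + wedge1 (rsubmx u) w s.

(* Endomorphisms act on row vectors from the right. *)
Definition smooth_endo (J : M -> 'M[R]_(m + m)) : Prop :=
  forall (i : chart_index M) (a b : 'I_(m + m)),
    smooth_on (chart i @` dom i)
      (fun p => let x := chart_inv i p in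
                (of_chart_gen i x *m J x *m to_chart_gen i x) a b).

Definition in_L (J : M -> 'M[R]_(m + m)) (x : M) (u : cgen) : Prop :=
  u *m map_mx (real_complex R) (J x) = 'i%C *: u.

End Forms.

(** * Generalized complex structures *)

Record gen_complex (R : realType) (n : nat) (M : smooth_manifold R n.*2) : Type :=
  GenComplex {
  gc_endo :> M -> 'M[R]_(n.*2 + n.*2);
  gc_smooth : smooth_endo gc_endo;
  gc_orthogonal : forall x u v,
    pairing (u *m gc_endo x) (v *m gc_endo x) = pairing u v;
  gc_sqr : forall x, gc_endo x *m gc_endo x = - 1%:M;
  (* closedness for local sections of L over arbitrary open sets *)
  gc_integrable : forall (W : set M) (u v : M -> 'rV[R[i]]_(n.*2 + n.*2)),
    open W -> smooth_gen W u -> smooth_gen W v ->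
    (forall x, W x -> in_L gc_endo x (u x)) ->
    (forall x, W x -> in_L gc_endo x (v x)) ->
    forall x, W x -> in_L gc_endo x (courant u v x)
}.

Section GeneralizedComplex.
Variables (R : realType) (n : nat) (M : smooth_manifold R n.*2).
Variable J : gen_complex M.
Local Notation C := (R[i]).
Local Notation cgen := ('rV[C]_(n.*2 + n.*2)).
Local Notation exform := (exform R n.*2).
Local Notation rawform := (rawform M).
Local Notation Omega := (@Omega R n.*2 M).
Local Notation d := (@d R n.*2 M).

Definition in_Lbar (x : M) (u : cgen) : Prop := in_L J x (map_mx conjc u).

Definition canonical_fibre (x : M) (rho : exform) : Prop :=
  is_exform rho /\ forall l : cgen, in_L J x l -> clifford l rho = 0.

(* The fibre of U^k at [x]: the span of the l_1 . ( .. (l_(n-k) . rho)) with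
   the l_j in Lbar and rho in U^n; it is zero unless -n <= k <= n. *)
Definition U_fibre (x : M) (k : int) (w : exform) : Prop :=
  if - n%:Z <= k <= n%:Z then
    exists (N : nat) (l : 'I_N -> seq cgen) (rho : 'I_N -> exform),
      [/\ forall a, (size (l a))%:Z = n%:Z - k,
          forall a u, u \in l a -> in_Lbar x u,
          forall a, canonical_fibre x (rho a) &
          w = \sum_(a < N) foldr (@clifford R n.*2) (rho a) (l a)]
  else w = 0.

Definition U_sec (k : int) : set rawform :=
  [set w | Omega w /\ forall x, U_fibre x k (w x)].

(* The sum of the [f k] over -n <= k <= n. *)
Definition sum_deg (f : int -> rawform) : rawform :=
  \sum_(r < n.*2.+1) f (n%:Z - r%:Z).

(* [proj k w] is the component in U^k of a form w. *)
Definition proj (k : int) (w : rawform) : rawform :=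
  xget (fun=> 0) [set f : int -> rawform |
                   (forall j, U_sec j (f j)) /\ w = sum_deg f] k.

Definition del_op (w : rawform) : rawform :=
  sum_deg (fun k => proj (k + 1) (d (proj k w))).

Definition delbar_op (w : rawform) : rawform :=
  sum_deg (fun k => proj (k - 1) (d (proj k w))).

Definition dJ (w : rawform) : rawform :=
  fun x s => - 'i%C * (del_op w x s - delbar_op w x s).

Definition ddJ_lemma : Prop :=
  d @` Omega `&` [set w | Omega w /\ dJ w = 0] =
    dJ @` Omega `&` [set w | Omega w /\ d w = 0] /\
  dJ @` Omega `&` [set w | Omega w /\ d w = 0] =
    (fun w => d (dJ w)) @` Omega.

(** * Cohomology *)

Definition Omega_dJ : set rawform := [set w | Omega w /\ dJ w = 0].

(* For a space of forms K stable under d, the elements of H(K) = (ker d on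
   K) / d K are represented by cosets. *)
Definition coh_class (K : set rawform) (w : rawform) : set rawform :=
  [set w + d g | g in K].

Definition cohomology (K : set rawform) : set (set rawform) :=
  [set coh_class K w | w in [set w | K w /\ d w = 0]].

(* The (linear) map H(Omega_dJ) -> H(Omega) induced by the inclusion: the coset
   w + d Omega_dJ is sent to w + d Omega. *)
Definition incl_coh (a : set rawform) : set rawform :=
  \bigcup_(w in a) coh_class Omega w.

(* A closed form split into closed components of pure U-degree. *)
Definition closed_components (al : int -> rawform) : Prop :=
  forall k, U_sec k (al k) /\ d (al k) = 0.

End GeneralizedComplex.

(* Main.v *)
From HB Require Import structures.
From mathcomp Require Import all_boot all_order all_algebra.
From mathcomp Require Import all_classical all_reals all_analysis.
From mathcomp Require Import complex ring zify.
Require Import Defs.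

(** The theorem is homological algebra once one knows that smooth forms are the
    direct sum of the spaces U^k and that d maps U^k to U^(k+1) + U^(k-1).

    Write d = del + delbar.  The components of d^2 = 0 of degrees 2 and -2 are
    del^2 = 0 and delbar^2 = 0, so d and d^J anticommute and d d^J preserves the
    degree.  Let tau be multiplication by i^k on U^k; then d^J = tau^-1 d tau
    ([d_tau]), so each inclusion in the dd^J-lemma follows from the other one.  If the
    lemma holds and v is closed, then d^J v = d d^J z, and v + d z is closed for both
    operators; an exact d^J-closed form is d of the d^J-exact, hence d^J-closed, form
    d^J z.  Conversely, let d u be d^J-closed.  By injectivity d u = d g with
    d^J g = 0, so tau g is closed; by surjectivity tau g = w + d z with w closed for
    both operators, and conjugating back gives d g = d d^J (tau^-1 z)
    ([inclusion_ddJ]).  A form is closed for both operators exactly when all its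
    components are closed ([both_closedP]), and d d^J z has the components d d^J z_k
    ([P_ddJ]), which gives the statements on representatives.

    The decomposition of forms is pointwise.  A form is a multilinear function on lists
    of vectors, and a generator acts on it by the Clifford action.  The spin action
    of J_x is a quadratic expression in the generators; it acts on the fibre of U^k
    as the scalar ik.  Normal ordering with respect to a basis of L and the dual basis
    of its conjugate ([decomposes_vac]) shows that every form is a sum of elements of
    the fibres of the U^k, so these are the eigenspaces of the spin action
    ([U_fibreP]).  Interpolation polynomials in that action give the components,
    which are therefore smooth.

    For the degrees of d, differentiate the eigenvalue equation of w in U^k.  With F
    and D the values of w and d w at a point and l = ik, this yields
    ((spin J - l)^2 + 1) D = - 2 theta F, where theta is a cubic Clifford element
    built from the first derivatives of J; so it suffices that theta = 0
    ([spin_differential]).  The commutation rules with spin J show that theta only has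
    components of degrees 3 and -3.  Its iterated commutators with two generators are
    given by the vectors [xi_mx u v], which are 0 for u in L and v in the conjugate of
    L, and which for u and v in L are the components of their Courant bracket in
    the conjugate of L, hence 0 by involutivity; the third case is complex conjugate.
    Descending, theta anticommutes with all generators, so it commutes with spin J and
    has degree 0: it vanishes ([theta0]).  The Courant bracket is computed for local
    sections of L with prescribed values at a point ([courant_Lsec]).

    The remaining ingredients are calculus: smooth functions are stable under
    products and composition, second derivatives commute, and the coordinate formula
    for d is compatible with changes of charts ([dE_natural]), which gives the
    smoothness of d w and d^2 = 0. *)

Set Implicit Arguments.
Unset Strict Implicit.
Unset Printing Implicit Defensive.

Import Order.TTheory GRing.Theory Num.Theory.
Import numFieldNormedType.Exports.

Local Open Scope classical_set_scope.
Local Open Scope ring_scope.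

(** * Differential calculus on R^m *)

Section MeanValue.
Variables (R : realType) (m : nat).
Implicit Types (f g : 'rV[R]_m -> R) (p q v : 'rV[R]_m).

Lemma derive_along_line f p v (t : R) :
  derivable f (p + t *: v) v ->
  is_derive t 1 (fun s : R => f (p + s *: v)) ('D_v f (p + t *: v)).
Proof.
have E : (fun h : R => h^-1 *: (((fun s : R => f (p + s *: v)) \o shift t) (h *: 1)
                                - f (p + t *: v)))
       = (fun h => h^-1 *: ((f \o shift (p + t *: v)) (h *: v) - f (p + t *: v))).
  apply/funext => h /=; congr (_ *: (f _ - _)).
  by rewrite [h *: 1]mulr1 scalerDl addrCA.
by move=> df; split; rewrite /derivable /derive E.
Qed.

(** The bound on t involves |c| only, so that steps in both directions are
    covered. *)
Lemma mean_value_line f p v (c : R) :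
  (forall t : R, `|t| <= `|c| -> derivable f (p + t *: v) v) ->
  exists2 t : R, `|t| <= `|c| &
    f (p + c *: v) - f p = c * 'D_v f (p + t *: v).
Proof.
move=> df.
have key (a b : R) : a <= b -> (forall t, a <= t <= b -> `|t| <= `|c|) ->
    exists2 t : R, `|t| <= `|c| &
    f (p + b *: v) - f (p + a *: v) = (b - a) * 'D_v f (p + t *: v).
  move=> ab habc.
  have dl t : t \in `[a, b] ->
      is_derive t 1 (fun s : R => f (p + s *: v)) ('D_v f (p + t *: v)).
    by rewrite in_itv /= => /habc /df /derive_along_line.
  have [|t tab ->] := MVT_segment ab (fun t tab => dl t (subset_itv_oo_cc tab)).
    apply: derivable_within_continuous => t tab.
    by have [] := dl t tab.
  exists t; last exact: mulrC.
  by apply: habc; rewrite in_itv /= in tab.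
have [c0|c0] := leP 0 c.
  have [|t tc] := key 0 c c0.
    by move=> t /andP[t0 tc]; rewrite ger0_norm // ger0_norm.
  by rewrite scale0r addr0 subr0; exists t.
have [|t tc] := key c 0 (ltW c0).
  by move=> t /andP[t0 tc]; rewrite ler0_norm // ltr0_norm // lerN2.
rewrite scale0r addr0 => E; exists t => //.
by rewrite -opprB E sub0r mulNr opprK.
Qed.

(** The corners of the path from 0 to h that changes one coordinate at a time. *)
Definition first_coords (k : nat) (h : 'rV[R]_m) : 'rV[R]_m :=
  \row_(a < m) (if (a < k)%N then h 0 a else 0).

Lemma first_coordsS (h : 'rV[R]_m) (k : 'I_m) :
  first_coords k.+1 h = first_coords k h + h 0 k *: delta_mx 0 k.
Proof.
apply/rowP => a; rewrite !mxE eqxx andTb ltnS leq_eqVlt -(inj_eq val_inj) /=.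
case: eqP => [E|_] /=; last by rewrite mulr0 addr0.
by rewrite E ltnn mulr1 add0r; congr (h 0 _); apply: val_inj.
Qed.

Lemma coord_norm_le (h : 'rV[R]_m) (k : 'I_m) : `|h 0 k| <= `|h|.
Proof.
by rewrite [leRHS]/Num.Def.normr /= mx_normrE (le_bigmax _ _ (ord0, k)).
Qed.

Lemma first_coords_norm (h : 'rV[R]_m) (k : 'I_m) (t : R) : `|t| <= `|h 0 k| ->
  `|first_coords k h + t *: delta_mx 0 k| <= `|h|.
Proof.
move=> th; rewrite [leLHS]/Num.Def.normr /= mx_normrE; apply: bigmax_le => //.
move=> [i a] _ /=; rewrite !mxE ord1 eqxx /=.
case: (eqVneq a k) => [->|nak].
  by rewrite ltnn add0r mulr1 (le_trans th) ?coord_norm_le.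
by rewrite mulr0 addr0; case: ifP; rewrite ?normr0 ?coord_norm_le.
Qed.

(** Along a path that changes one coordinate at a time, each step is controlled
    by the mean value theorem and the continuity of one partial derivative. *)
Lemma C1_differentiable f p :
  (forall v, \forall q \near p, derivable f q v) ->
  (forall v, {for p, continuous ('D_v f)}) ->
  differentiable f p.
Proof.
move=> df cdf.
pose l (h : 'rV[R]_m) : R := \sum_k h 0 k * 'D_(delta_mx 0 k) f p.
have llin : linear l.
  move=> a u v; rewrite /l scaler_sumr -big_split /=; apply: eq_bigr => k _.
  by rewrite !mxE mulrDl -mulrA.
pose lM := GRing.isLinear.Build _ _ _ _ _ llin.
pose L : {linear 'rV[R]_m -> R} := HB.pack l lM.
have cL : continuous L.
  apply: continuous_big => [|k _ h]; first exact: add_continuous.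
  apply: (@continuousM _ _ (fun h : 'rV[R]_m => h 0 k)).
    exact: (@coord_continuous _ _ _ 0 k h).
  exact: cst_continuous.
suff E : (f : 'rV[R]_m -> R^o) \o shift p =
    cst (f p : R^o) + (L : 'rV[R]_m -> R^o) +o_ (0 : 'rV[R]_m) id.
  by apply/diff_locallyP; have -> : 'd f p = L :> (_ -> _) by apply: diff_unique.
apply/eqaddoP => _/posnumP[e].
have [m0|m0] := posnP m.
  apply: nearW => h; have h0 : h = 0.
    by apply/rowP => a; have := ltn_ord a; rewrite [X in (_ < X)%N]m0.
  have l0 : l 0 = 0 by exact: (linear0 L).
  by rewrite h0 !fctE /= l0 add0r addr0 subrr !normr0 mulr0.
pose d := e%:num / m%:R.
have d0 : 0 < d by rewrite divr_gt0 ?ltr0n.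
pose close (k : 'I_m) (q : 'rV[R]_m) := derivable f q (delta_mx 0 k) /\
    `|'D_(delta_mx 0 k) f q - 'D_(delta_mx 0 k) f p| <= d.
have : \forall q \near p, forall k, close k q.
  apply: (@filter_forall _ _ close (nbhs p)) => k.
  have /cvgrPdist_le /(_ d d0) := cdf (delta_mx 0 k).
  apply: filterS2 (df (delta_mx 0 k)) => q dq; rewrite distrC => eq.
  by split.
move=> /nbhs_ballP [r /= r0 hr].
have hr0 : \forall h \near nbhs (0 : 'rV[R]_m), `|h| < r.
  by apply/nbhs_ballP; exists r => // h; rewrite -ball_normE /= sub0r normrN.
apply: filterS hr0 => h hr'.
have ballh (k : 'I_m) (t : R) : `|t| <= `|h 0 k| ->
    ball p r (p + first_coords k h + t *: delta_mx 0 k).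
  move=> th; rewrite -ball_normE /= -addrA opprD addrA subrr add0r normrN.
  exact: le_lt_trans (first_coords_norm th) hr'.
have step (k : 'I_m) :
    `|f (p + first_coords k.+1 h) - f (p + first_coords k h)
      - h 0 k * 'D_(delta_mx 0 k) f p| <= `|h| * d.
  have [|t th] := @mean_value_line f (p + first_coords k h) (delta_mx 0 k) (h 0 k).
    by move=> t th; have [] := hr _ (ballh k t th) k.
  rewrite first_coordsS addrA => ->; rewrite -mulrBr normrM.
  apply: ler_pM => //; first exact: coord_norm_le.
  by have [] := hr _ (ballh k t th) k.
rewrite !fctE /= /l.
have -> : f (h + p) - (f p + \sum_k h 0 k * 'D_(delta_mx 0 k) f p) =
   \sum_(k < m) (f (p + first_coords k.+1 h) - f (p + first_coords k h)
      - h 0 k * 'D_(delta_mx 0 k) f p).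
  rewrite sumrB opprD addrA; congr (_ - _).
  have := @telescope_sumr _ 0 m (fun k => f (p + first_coords k h)) (leq0n m).
  rewrite big_mkord => ->; congr (f _ - f _).
    rewrite addrC; congr (_ + _); apply/rowP => a; rewrite mxE ltn_ord //.
  by rewrite -[LHS]addr0; congr (_ + _); apply/rowP => a; rewrite !mxE.
apply: (le_trans (ler_norm_sum _ _ _)).
apply: (le_trans (ler_sum _ (fun k _ => step k))).
rewrite sumr_const card_ord /d -[_ *+ m]mulr_natl mulrCA mulrA.
by rewrite -mulrA [m%:R * _]mulrC divfK ?pnatr_eq0 -?lt0n // mulrC.
Qed.

End MeanValue.

Section Smooth.
Variables (R : realType) (m : nat).
Implicit Types (f g h : 'rV[R]_m -> R) (p q v : 'rV[R]_m) (W : set 'rV[R]_m).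

Lemma near_eq_continuous f g p : (\forall q \near p, f q = g q) ->
  {for p, continuous f} -> {for p, continuous g}.
Proof.
move=> fg cf; have E : f p = g p by exact: nbhs_singleton fg.
rewrite /prop_for /continuous_at -E => A fA; have := cf A fA.
by apply: filterS2 fg => q /= ->.
Qed.

Lemma open_near_eq W f g p : open W -> W p -> (forall q, W q -> f q = g q) ->
  \forall q \near p, f q = g q.
Proof. by move=> oW Wp fg; apply: filterS (open_nbhs_nbhs (conj oW Wp)). Qed.

Lemma open_derive_eq W f g p v : open W -> W p ->
  (forall q, W q -> f q = g q) -> 'D_v f p = 'D_v g p.
Proof. by move=> oW Wp fg; apply: near_eq_derive; exact: open_near_eq fg. Qed.

(** Smoothness is coinductive: it is enough to exhibit a class of functions
    that is stable under directional derivatives. *)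
Lemma smooth_coind W (S : ('rV[R]_m -> R) -> Prop) : open W ->
  (forall f p, S f -> W p ->
     {for p, continuous f} /\ forall v, derivable f p v) ->
  (forall f v, S f -> exists2 g, S g & forall p, W p -> 'D_v f p = g p) ->
  forall f g, S f -> (forall p, W p -> g p = f p) -> smooth_on W g.
Proof.
move=> oW Sreg Sder f g Sf gf vs p Wp.
have [k Sk Ek] : exists2 k, S k & forall q, W q -> iterD vs g q = k q.
  elim: vs {p Wp} => [|v vs [k Sk Ek]]; first by exists f.
  have [k' Sk' Ek'] := Sder k v Sk; exists k' => // q Wq.
  by rewrite -Ek' //=; apply: open_derive_eq Wq _.
have nk : \forall q \near p, k q = iterD vs g q.
  by apply: open_near_eq Wp _ => // q Wq; rewrite Ek.
have [ck dk] := Sreg k p Sk Wp.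
split; first exact: near_eq_continuous ck.
by move=> v; apply: near_eq_derivable (dk v).
Qed.

Lemma smooth_derivable W f p v : smooth_on W f -> W p -> derivable f p v.
Proof. by move=> /(_ [::] p) sf /sf []. Qed.

Lemma smooth_continuous W f p : smooth_on W f -> W p -> {for p, continuous f}.
Proof. by move=> /(_ [::] p) sf /sf []. Qed.

Lemma smooth_derive W f v : smooth_on W f -> smooth_on W ('D_v f).
Proof. by move=> sf vs p Wp; have := sf (rcons vs v) p Wp; rewrite /iterD foldr_rcons. Qed.

Lemma smooth_ext W f g : open W -> (forall p, W p -> g p = f p) ->
  smooth_on W f -> smooth_on W g.
Proof.
move=> oW gf sf.
apply: (@smooth_coind W (smooth_on W)) sf gf => // [k p sk Wp|k v sk].
  by split=> [|v]; [exact: smooth_continuous Wp|exact: smooth_derivable Wp].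
by exists ('D_v k); [exact: smooth_derive v sk|].
Qed.

Lemma smooth_cst W (c : R) : open W -> smooth_on W (fun=> c).
Proof.
move=> oW; apply: (@smooth_coind W (fun f => exists c, f = cst c) oW _ _ (cst c)) => //.
- move=> _ p [a ->] _; split=> [|v]; [exact: cst_continuous|exact: derivable_cst].
- by move=> _ v [a ->]; exists (cst 0); [exists 0|move=> p _; rewrite derive_cst].
- by exists c.
Qed.

Lemma smooth_differentiable W f p : open W -> W p -> smooth_on W f ->
  differentiable f p.
Proof.
move=> oW Wp sf; apply: C1_differentiable => v.
  apply: filterS (open_nbhs_nbhs (conj oW Wp)) => q Wq.
  exact: smooth_derivable Wq.
exact: smooth_continuous (smooth_derive v sf) Wp.
Qed.

Lemma smooth_add W f g : open W -> smooth_on W f -> smooth_on W g ->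
  smooth_on W (fun p => f p + g p).
Proof.
move=> oW sf sg.
apply: (@smooth_coind W (fun h => exists f g, [/\ smooth_on W f, smooth_on W g & h = f + g])
  oW _ _ (f + g)) => //; last by exists f, g.
- move=> _ p [{sf sg}f [{}g [sf sg ->]]] Wp; split.
    by apply: continuousD; apply: smooth_continuous Wp.
  by move=> v; apply: derivableD; apply: smooth_derivable Wp.
- move=> _ v [{sf sg}f [{}g [sf sg ->]]].
  exists ('D_v f + 'D_v g).
    by exists ('D_v f), ('D_v g); split; [exact: smooth_derive v sf|exact: smooth_derive v sg|].
  by move=> p Wp; rewrite deriveD //; apply: smooth_derivable Wp.
Qed.

(** The derivative of a product is not a product: this class contains the
    products and is stable under derivation, as [smooth_coind] requires. *)
Inductive product_span W : ('rV[R]_m -> R) -> Prop :=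
| ProductSpanMul f g : smooth_on W f -> smooth_on W g -> product_span W (f * g)
| ProductSpanAdd f g : product_span W f -> product_span W g -> product_span W (f + g).

Lemma smooth_mul W f g : open W -> smooth_on W f -> smooth_on W g ->
  smooth_on W (fun p => f p * g p).
Proof.
move=> oW sf sg.
have reg h p : product_span W h -> W p -> {for p, continuous h} /\ forall v, derivable h p v.
  move=> + Wp; elim=> {sf sg}[{}f {}g sf sg|{}f {}g _ [cf df] _ [cg dg]]; split.
  - by apply: continuousM; apply: smooth_continuous Wp.
  - by move=> v; apply: derivableM; apply: smooth_derivable Wp.
  - exact: continuousD.
  - by move=> v; apply: derivableD.
apply: (@smooth_coind W (product_span W) oW reg _ (f * g)) => //; last exact: ProductSpanMul.
move=> h v; elim=> {sf sg}[{}f {}g sf sg|{}f {}g pf [f' pf' Ef] pg [g' pg' Eg]].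
- exists (f * 'D_v g + g * 'D_v f).
    exact: ProductSpanAdd (ProductSpanMul sf (smooth_derive v sg))
                          (ProductSpanMul sg (smooth_derive v sf)).
  by move=> p Wp; rewrite deriveM //; apply: smooth_derivable Wp.
- exists (f' + g'); first exact: ProductSpanAdd.
  by move=> p Wp; rewrite deriveD ?Ef ?Eg //; apply: (reg _ _ _ Wp).2.
Qed.

Lemma smooth_opp W f : open W -> smooth_on W f -> smooth_on W (fun p => - f p).
Proof.
move=> oW sf; apply: (smooth_ext oW _ (smooth_mul oW (smooth_cst (-1) oW) sf)) => p _.
by rewrite mulN1r.
Qed.

Lemma smooth_sub_fun W f g : open W -> smooth_on W f -> smooth_on W g ->
  smooth_on W (fun p => f p - g p).
Proof. by move=> oW sf sg; exact: smooth_add oW sf (smooth_opp oW sg). Qed.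

End Smooth.

Section ChainRule.
Variables (R : realType) (m n : nat).
Implicit Types (W : set 'rV[R]_m) (phi : 'rV[R]_m -> 'rV[R]_n).

Lemma differentiable_rV phi p :
  (forall c, differentiable (fun q => phi q 0 c) p) -> differentiable phi p.
Proof.
move=> dphi.
have -> : phi = \sum_(c < n) (fun q => phi q 0 c *: (delta_mx 0 c : 'rV[R]_n)).
  by apply/funext => q; rewrite fct_sumE [LHS]row_sum_delta.
by apply: differentiable_sum => c; apply: differentiableZl.
Qed.

Lemma derive_coord phi p v c : differentiable phi p ->
  'D_v (fun q => phi q 0 c) p = ('D_v phi p) 0 c.
Proof. by move=> /diff_derivable dphi; rewrite (derive_mx (dphi v)) mxE. Qed.

Lemma jacobian_entry phi p a c : differentiable phi p ->
  jacobian phi p a c = 'D_(delta_mx 0 a) (fun q => phi q 0 c) p.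
Proof.
by move=> dphi; rewrite derive_coord // deriveEjacobian // -rowE [RHS]mxE.
Qed.

Lemma derive_coordE (b : 'rV[R]_n -> R) q v : differentiable b q ->
  'D_v b q = \sum_c v 0 c * 'D_(delta_mx 0 c) b q.
Proof.
move=> db; rewrite deriveE // {1}[v]row_sum_delta linear_sum.
by apply: eq_bigr => c _; rewrite linearZ deriveE.
Qed.

Lemma derive_chain phi (b : 'rV[R]_n -> R) p v :
  differentiable phi p -> differentiable b (phi p) ->
  'D_v (b \o phi) p = 'D_('D_v phi p) b (phi p).
Proof.
move=> dphi db; rewrite deriveE; last exact: differentiable_comp.
by rewrite diff_comp //= -deriveE // -deriveE.
Qed.

(** The chain rule multiplies composites by derivatives of [phi]: hence the
    coefficients [a] in this class, which is stable under derivation. *)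
Inductive composite_span W (U : set 'rV[R]_n) phi : ('rV[R]_m -> R) -> Prop :=
| CompositeSpanMul a b : smooth_on W a -> smooth_on U b ->
    composite_span W U phi (a * (b \o phi))
| CompositeSpanAdd f g : composite_span W U phi f -> composite_span W U phi g ->
    composite_span W U phi (f + g).

Lemma smooth_comp W U phi (b : 'rV[R]_n -> R) : open W -> open U ->
  (forall p, W p -> U (phi p)) ->
  (forall c, smooth_on W (fun p => phi p 0 c)) -> smooth_on U b ->
  smooth_on W (b \o phi).
Proof.
move=> oW oU WU sphi sb.
have dphi p : W p -> differentiable phi p.
  by move=> Wp; apply: differentiable_rV => c; apply: smooth_differentiable Wp _.
have dcomp c p : smooth_on U c -> W p -> differentiable (c \o phi) p.
  move=> sc Wp; apply: differentiable_comp; first exact: dphi.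
  by apply: smooth_differentiable (WU _ Wp) _.
have reg h p : composite_span W U phi h -> W p ->
    {for p, continuous h} /\ forall v, derivable h p v.
  move=> + Wp; elim=> {sb}[a {}b sa sb|f g _ [cf df] _ [cg dg]]; split.
  - apply: continuousM; first exact: smooth_continuous Wp.
    by apply: differentiable_continuous; apply: dcomp.
  - move=> v; apply: derivableM; first exact: smooth_derivable Wp.
    by apply: diff_derivable; apply: dcomp.
  - exact: continuousD.
  - by move=> v; apply: derivableD.
have s0 : smooth_on W (fun=> 0 : R) by exact: smooth_cst.
have s1 : smooth_on W (fun=> 1 : R) by exact: smooth_cst.
apply: (@smooth_coind _ _ W (composite_span W U phi) oW reg _ ((fun=> 1) * (b \o phi))).
- move=> h v; elim=> {sb}[a {}b sa sb|f g pf [f' pf' Ef] pg [g' pg' Eg]]; last first.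
    exists (f' + g'); first exact: CompositeSpanAdd.
    by move=> p Wp; rewrite deriveD ?Ef ?Eg //; apply: (reg _ _ _ Wp).2.
  have [k pk Ek] : exists2 k, composite_span W U phi k & forall p, W p ->
      \sum_c a p * 'D_v (fun q => phi q 0 c) p * 'D_(delta_mx 0 c) b (phi p) = k p.
    elim: (index_enum _) => [|c r [k pk Ek]].
      exists ((fun=> 0) * (b \o phi)); first exact: CompositeSpanMul s0 sb.
      by move=> p _; rewrite big_nil fctE mul0r.
    exists (((fun p => a p * 'D_v (fun q => phi q 0 c) p) * ('D_(delta_mx 0 c) b \o phi)) + k).
      apply: CompositeSpanAdd pk; apply: CompositeSpanMul.
        exact: smooth_mul sa (smooth_derive v (sphi c)).
      exact: smooth_derive _ sb.
    by move=> p Wp; rewrite big_cons Ek.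
  exists (k + ('D_v a) * (b \o phi)).
    exact: CompositeSpanAdd pk (CompositeSpanMul _ (smooth_derive v sa) sb).
  move=> p Wp; rewrite deriveM; last 2 first.
  - exact: smooth_derivable Wp.
  - by apply: diff_derivable; apply: dcomp.
  rewrite derive_chain; last 2 first.
  - exact: dphi.
  - by apply: smooth_differentiable (WU _ Wp) _.
  rewrite derive_coordE; last by apply: smooth_differentiable (WU _ Wp) _.
  rewrite !fctE -Ek // [X in _ + X]mulrC; congr (_ + _).
  rewrite scaler_sumr; apply: eq_bigr => c _.
  by rewrite -derive_coord ?[LHS]mulrA //; exact: dphi.
- exact: CompositeSpanMul s1 sb.
- by move=> p _; rewrite !fctE mul1r.
Qed.

End ChainRule.

Section Schwarz.
Variables (R : realType) (m : nat).
Implicit Types (f : 'rV[R]_m -> R) (p u v : 'rV[R]_m) (W : set 'rV[R]_m).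

Lemma derivable_shift f p u w : derivable f (p + w) u ->
  derivable (fun q => f (q + w)) p u /\
  'D_u (fun q => f (q + w)) p = 'D_u f (p + w).
Proof.
have E : (fun h : R => h^-1 *: (((fun q => f (q + w)) \o shift p) (h *: u) - f (p + w)))
       = (fun h => h^-1 *: ((f \o shift (p + w)) (h *: u) - f (p + w))).
  by apply/funext => h /=; rewrite addrA.
by move=> df; split; rewrite /derivable /derive E.
Qed.

(** Two mean value theorems, in the direction u and then in the direction v. *)
Lemma double_difference f p u v (r h : R) : 0 < h -> h * (`|u| + `|v|) < r ->
  (forall q, ball p r q -> derivable f q u /\ derivable ('D_u f) q v) ->
  exists2 q, ball p r q &
    f (p + h *: u + h *: v) - f (p + h *: u) - (f (p + h *: v) - f p)
      = h * (h * 'D_v ('D_u f) q).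
Proof.
move=> h0 hr df.
have inball (s t : R) : `|s| <= `|h| -> `|t| <= `|h| -> ball p r (p + s *: u + t *: v).
  move=> sh th; rewrite -ball_normE /= -addrA opprD addrA subrr add0r normrN.
  apply: le_lt_trans hr; apply: (le_trans (ler_normD _ _)).
  rewrite !normrZ mulrDr -(gtr0_norm h0).
  by apply: lerD; apply: ler_wpM2r.
have dshift (s t : R) : `|s| <= `|h| -> `|t| <= `|h| ->
    derivable (fun q => f (q + t *: v)) (p + s *: u) u /\
    'D_u (fun q => f (q + t *: v)) (p + s *: u) = 'D_u f (p + s *: u + t *: v).
  by move=> sh th; apply: derivable_shift; apply: (df _ _).1; exact: inball.
have d0 (s : R) : `|s| <= `|h| -> derivable f (p + s *: u) u.
  by move=> sh; have := (df _ (inball s 0 sh _)).1; rewrite scale0r addr0 normr0; apply.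
have [|s sh E1] := @mean_value_line _ _ ((fun q => f (q + h *: v)) - f) p u h.
  by move=> s sh; apply: derivableB; [apply: (dshift _ _ sh _).1|exact: d0].
have [|t th E2] := @mean_value_line _ _ ('D_u f) (p + s *: u) v h.
  by move=> t th; apply: (df _ _).2; exact: inball.
exists (p + s *: u + t *: v); first exact: inball.
rewrite -E2; have := E1; rewrite deriveB; last 2 first.
- exact: (dshift _ _ sh _).1.
- exact: d0.
by rewrite (dshift _ _ sh _).2 // !fctE => <-; rewrite addrAC.
Qed.

Lemma eq_of_nearby_values (F G : 'rV[R]_m -> R) p :
  {for p, continuous F} -> {for p, continuous G} ->
  (forall r, 0 < r -> exists q1 q2, [/\ ball p r q1, ball p r q2 & F q1 = G q2]) ->
  F p = G p.
Proof.
move=> cF cG FG; apply/eqP; rewrite -subr_eq0 -normr_eq0; apply/eqP/le_anti.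
rewrite normr_ge0 andbT; apply/ler_addgt0Pl => e e0; rewrite addr0.
have e2 : 0 < e / 2 by rewrite divr_gt0.
move: cF cG => /cvgrPdist_le /(_ _ e2) hF /cvgrPdist_le /(_ _ e2) hG.
have : \forall q \near p, `|F p - F q| <= e / 2 /\ `|G p - G q| <= e / 2.
  by near=> q; split; near: q.
move=> /nbhs_ballP [r /= r0 hr].
have [q1 [q2 [/hr [b1 _] /hr [_ b2] E]]] := FG r r0.
rewrite [e]splitr; apply: le_trans (lerD b1 b2).
by rewrite [X in _ <= _ + X]distrC E; exact: ler_distD.
Unshelve. all: by end_near. Qed.

(** Both mixed derivatives are limits of the same double difference quotient. *)
Lemma schwarz W f p u v : open W -> W p -> smooth_on W f ->
  'D_v ('D_u f) p = 'D_u ('D_v f) p.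
Proof.
move=> oW Wp sf.
have cuv a b : {for p, continuous ('D_a ('D_b f))}.
  exact: smooth_continuous (smooth_derive a (smooth_derive b sf)) Wp.
apply: (eq_of_nearby_values (cuv v u) (cuv u v)) => r0 r00.
have : \forall q \near p, ball p r0 q /\ W q.
  have nW : \forall q \near p, W q by exact: open_nbhs_nbhs.
  have nB : \forall q \near p, ball p r0 q by exact: nbhsx_ballx.
  by near=> q; split; near: q.
move=> /nbhs_ballP [r /= r_gt0 hr].
(* small enough for the parallelogram on [h *: u] and [h *: v] to stay in the
   ball *)
pose h := r / (2 * (`|u| + `|v| + 1)).
have n0 : 0 < `|u| + `|v| + 1 by rewrite ltr_wpDl.
have h0 : 0 < h by rewrite divr_gt0 ?mulr_gt0.
have hlt : h * (`|u| + `|v|) < r.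
  apply: (@le_lt_trans _ _ (h * (`|u| + `|v| + 1))).
    by rewrite ler_pM2l // lerDl.
  rewrite /h invfM mulrA -mulrA mulVf ?gt_eqF // mulr1 ltr_pdivrMr //.
  by rewrite ltr_pMr // ltr1n.
have dd a b q : ball p r q -> derivable f q a /\ derivable ('D_a f) q b.
  move=> /hr [_ Wq]; split; first exact: smooth_derivable Wq.
  exact: smooth_derivable (smooth_derive _ sf) Wq.
have [q1 /hr [b1 _] E1] := double_difference h0 hlt (dd u v).
rewrite addrC in hlt.
have [q2 /hr [b2 _] E2] := double_difference h0 hlt (dd v u).
exists q1, q2; split; [exact: b1|exact: b2|].
apply: (mulfI (lt0r_neq0 h0)); apply: (mulfI (lt0r_neq0 h0)).
apply: (etrans (esym E1)); apply: etrans E2.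
have comb (a b c d : R) : a - b - (c - d) = a - c - (b - d) by ring.
by rewrite comb [p + _ + _]addrAC.
Unshelve. all: by end_near. Qed.

End Schwarz.

(** * Complex-valued functions *)

Section ComplexCalculus.
Variables (R : realType) (m : nat).
Local Notation C := R[i].
Implicit Types (f g : 'rV[R]_m -> C) (p q v : 'rV[R]_m) (W : set 'rV[R]_m).

Definition cdiff f p : Prop :=
  differentiable (fun q => complex.Re (f q)) p /\
  differentiable (fun q => complex.Im (f q)) p.

Lemma complex_ReD (x y : C) : complex.Re (x + y) = complex.Re x + complex.Re y.
Proof. by case: x y => [a b] [c d]. Qed.
Lemma complex_ImD (x y : C) : complex.Im (x + y) = complex.Im x + complex.Im y.
Proof. by case: x y => [a b] [c d]. Qed.
Lemma complex_ReM (x y : C) : complex.Re (x * y) =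
  complex.Re x * complex.Re y - complex.Im x * complex.Im y.
Proof. by case: x y => [a b] [c d]. Qed.
Lemma complex_ImM (x y : C) : complex.Im (x * y) =
  complex.Re x * complex.Im y + complex.Im x * complex.Re y.
Proof. by case: x y => [a b] [c d]. Qed.

Lemma cdiff_ext f g p : (forall q, f q = g q) -> cdiff f p -> cdiff g p.
Proof. by move=> /funext ->. Qed.

Lemma cdiff_cst (c : C) p : cdiff (fun=> c) p.
Proof. by split; exact: differentiable_cst. Qed.

Lemma cdiffD f g p : cdiff f p -> cdiff g p -> cdiff (fun q => f q + g q) p.
Proof.
move=> [df df'] [dg dg']; split.
  by under eq_fun do rewrite complex_ReD; exact: differentiableD.
by under eq_fun do rewrite complex_ImD; exact: differentiableD.
Qed.

Lemma cdiffM f g p : cdiff f p -> cdiff g p -> cdiff (fun q => f q * g q) p.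
Proof.
move=> [df df'] [dg dg']; split.
  by under eq_fun do rewrite complex_ReM; apply: differentiableB; exact: differentiableM.
by under eq_fun do rewrite complex_ImM; apply: differentiableD; exact: differentiableM.
Qed.

Lemma cdiff_sum (I : Type) (r : seq I) (P : pred I) (F : I -> 'rV[R]_m -> C) p :
  (forall i, P i -> cdiff (F i) p) -> cdiff (fun q => \sum_(i <- r | P i) F i q) p.
Proof.
move=> dF; elim: r => [|i r IH].
  by apply: cdiff_ext (cdiff_cst 0 p) => q; rewrite big_nil.
case Pi: (P i); last by apply: cdiff_ext IH => q; rewrite big_cons Pi.
by apply: cdiff_ext (cdiffD (dF i Pi) IH) => q; rewrite big_cons Pi.
Qed.

Lemma cderive_near f g p v : (\forall q \near p, f q = g q) ->
  cderive v f p = cderive v g p.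
Proof.
move=> fg; congr (Complex _ _); apply: near_eq_derive;
  by apply: filterS fg => q ->.
Qed.

Lemma cderive_cst (c : C) p v : cderive v (fun=> c) p = 0.
Proof. by rewrite /cderive !derive_cst. Qed.

Lemma cderiveD f g p v : cdiff f p -> cdiff g p ->
  cderive v (fun q => f q + g q) p = cderive v f p + cderive v g p.
Proof.
move=> [df df'] [dg dg']; rewrite /cderive.
under eq_fun do rewrite complex_ReD.
under [X in Complex _ ('D_v X p)]eq_fun do rewrite complex_ImD.
by rewrite !deriveD //; exact: diff_derivable.
Qed.

Lemma cderiveM f g p v : cdiff f p -> cdiff g p ->
  cderive v (fun q => f q * g q) p = cderive v f p * g p + f p * cderive v g p.
Proof.
move=> [df df'] [dg dg']; rewrite /cderive.
under eq_fun do rewrite complex_ReM.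
under [X in Complex _ ('D_v X p)]eq_fun do rewrite complex_ImM.
rewrite deriveB ?deriveD; try by apply: diff_derivable; exact: differentiableM.
rewrite !deriveM; try exact: diff_derivable.
move: ('D_v _ p) ('D_v _ p) ('D_v _ p) ('D_v _ p) => x y z t.
case: (f p) (g p) => [a b] [c d]; apply/eqP; rewrite eq_complex /=.
by rewrite /GRing.scale /=; apply/andP; split; apply/eqP; ring.
Qed.

Lemma cderive_sum (I : Type) (r : seq I) (P : pred I) (F : I -> 'rV[R]_m -> C) p v :
  (forall i, P i -> cdiff (F i) p) ->
  cderive v (fun q => \sum_(i <- r | P i) F i q) p =
  \sum_(i <- r | P i) cderive v (F i) p.
Proof.
move=> dF; elim: r => [|i r IH].
  by under eq_fun do rewrite big_nil; rewrite cderive_cst big_nil.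
rewrite big_cons; case Pi: (P i); last first.
  by rewrite -IH; under eq_fun do rewrite big_cons Pi.
under eq_fun do rewrite big_cons Pi.
rewrite cderiveD ?IH //; first exact: dF.
exact: cdiff_sum.
Qed.

Lemma cderiveZ (c : C) f p v : cdiff f p ->
  cderive v (fun q => c * f q) p = c * cderive v f p.
Proof.
by move=> df; rewrite cderiveM ?cderive_cst ?mul0r ?add0r //; exact: cdiff_cst.
Qed.

Lemma cderive_coordE f p v : cdiff f p ->
  cderive v f p = \sum_c (v 0 c)%:C%C * cderive (delta_mx 0 c) f p.
Proof.
move=> [df df']; rewrite /cderive derive_coordE // [X in Complex _ X]derive_coordE //.
elim: (index_enum _) => [|c r IH]; first by rewrite !big_nil.
rewrite !big_cons -IH; apply/eqP; rewrite eq_complex /=.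
by apply/andP; split; apply/eqP; ring.
Qed.

Lemma csmooth_cdiff W f p : open W -> W p -> csmooth_on W f -> cdiff f p.
Proof.
move=> oW Wp [sf sf'].
by split; exact: smooth_differentiable sf || exact: smooth_differentiable sf'.
Qed.

Lemma csmooth_ext W f g : open W -> (forall p, W p -> g p = f p) ->
  csmooth_on W f -> csmooth_on W g.
Proof.
move=> oW fg [sf sf']; split.
  by apply: smooth_ext oW _ sf => p Wp; rewrite fg.
by apply: smooth_ext oW _ sf' => p Wp; rewrite fg.
Qed.

Lemma csmooth_real W (h : 'rV[R]_m -> R) : open W -> smooth_on W h ->
  csmooth_on W (fun p => (h p)%:C%C).
Proof. by move=> oW sh; split; [exact: sh|exact: smooth_cst]. Qed.

Lemma csmooth_cst W (c : C) : open W -> csmooth_on W (fun=> c).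
Proof. by move=> oW; split; exact: smooth_cst. Qed.

Lemma csmoothD W f g : open W -> csmooth_on W f -> csmooth_on W g ->
  csmooth_on W (fun p => f p + g p).
Proof.
move=> oW [sf sf'] [sg sg']; split.
  by apply: (smooth_ext oW _ (smooth_add oW sf sg)) => p _; rewrite complex_ReD.
by apply: (smooth_ext oW _ (smooth_add oW sf' sg')) => p _; rewrite complex_ImD.
Qed.

Lemma csmoothM W f g : open W -> csmooth_on W f -> csmooth_on W g ->
  csmooth_on W (fun p => f p * g p).
Proof.
move=> oW [sf sf'] [sg sg']; split.
  apply: (smooth_ext oW _ (smooth_sub_fun oW (smooth_mul oW sf sg) (smooth_mul oW sf' sg'))).
  by move=> p _; rewrite complex_ReM.
apply: (smooth_ext oW _ (smooth_add oW (smooth_mul oW sf sg') (smooth_mul oW sf' sg))).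
by move=> p _; rewrite complex_ImM.
Qed.

Lemma csmooth_sum W (I : Type) (r : seq I) (P : pred I) (F : I -> 'rV[R]_m -> C) :
  open W -> (forall i, P i -> csmooth_on W (F i)) ->
  csmooth_on W (fun p => \sum_(i <- r | P i) F i p).
Proof.
move=> oW sF; elim: r => [|i r IH].
  by apply: csmooth_ext (csmooth_cst 0 oW) => // p _; rewrite big_nil.
case Pi: (P i); last by apply: csmooth_ext IH => // p _; rewrite big_cons Pi.
by apply: (csmooth_ext oW _ (csmoothD oW (sF i Pi) IH)) => p _; rewrite big_cons Pi.
Qed.

Lemma csmooth_derive W f v : csmooth_on W f -> csmooth_on W (cderive v f).
Proof. by move=> [sf sf']; split; [exact: smooth_derive v sf|exact: smooth_derive v sf']. Qed.

Lemma cschwarz W f p u v : open W -> W p -> csmooth_on W f ->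
  cderive v (cderive u f) p = cderive u (cderive v f) p.
Proof.
move=> oW Wp [sf sf'].
exact: (f_equal2 (@Complex R) (schwarz u v oW Wp sf) (schwarz u v oW Wp sf')).
Qed.

End ComplexCalculus.

Section ComplexChainRule.
Variables (R : realType) (m n : nat).
Local Notation C := R[i].
Implicit Types (phi : 'rV[R]_m -> 'rV[R]_n) (f : 'rV[R]_n -> C).

Lemma cdiff_comp phi f p : differentiable phi p -> cdiff f (phi p) ->
  cdiff (f \o phi) p.
Proof.
move=> dphi [df df']; split.
  exact: (differentiable_comp dphi df).
exact: (differentiable_comp dphi df').
Qed.

Lemma cderive_chain phi f p v : differentiable phi p -> cdiff f (phi p) ->
  cderive v (f \o phi) p = cderive ('D_v phi p) f (phi p).
Proof.
move=> dphi [df df']; congr (Complex _ _).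
  exact: (derive_chain v dphi df).
exact: (derive_chain v dphi df').
Qed.

Lemma csmooth_comp (W : set 'rV[R]_m) (U : set 'rV[R]_n) phi f : open W -> open U ->
  (forall p, W p -> U (phi p)) ->
  (forall c, smooth_on W (fun p => phi p 0 c)) -> csmooth_on U f ->
  csmooth_on W (f \o phi).
Proof.
move=> oW oU WU sphi [sf sf']; split.
  exact: (smooth_comp oW oU WU sphi sf).
exact: (smooth_comp oW oU WU sphi sf').
Qed.

End ComplexChainRule.

(** * Exterior algebra on multilinear functions *)

Section ExteriorForms.
Variables (R : realType) (m : nat).
Local Notation C := R[i].
Local Notation V := 'rV[R]_m.
Local Notation exform := (exform R m).
Implicit Types (w : exform) (s : seq V) (u v : V) (X xi : 'rV[C]_m) (g : 'rV[C]_(m + m)).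

Definition covec xi (v : V) : C := (map_mx (real_complex R) v *m xi^T) 0 0.

Lemma covecE xi v : covec xi v = \sum_a (v 0 a)%:C%C * xi 0 a.
Proof. by rewrite /covec mxE; apply: eq_bigr => a _; rewrite !mxE. Qed.

Lemma covecP xi (a : R) u v : covec xi (a *: u + v) = (a%:C)%C * covec xi u + covec xi v.
Proof.
rewrite !covecE mulr_sumr -big_split /=; apply: eq_bigr => k _.
by rewrite !mxE rmorphD rmorphM /= mulrDl mulrA.
Qed.

Lemma wedge1_nil xi w : wedge1 xi w [::] = 0.
Proof. by rewrite /wedge1 big_ord0. Qed.

(** With this recursion on the list of vectors, the identities of the exterior
    algebra are proved by induction, without sums over shuffles. *)
Lemma wedge1_cons xi w v s :
  wedge1 xi w (v :: s) = covec xi v * w s - wedge1 xi (fun t => w (v :: t)) s.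
Proof.
rewrite /wedge1 [size _]/= big_ord_recl /= expr0 mul1r /Defs.del /= drop0.
congr (_ + _); rewrite -sumrN; apply: eq_bigr => j _.
by rewrite /bump /= add1n exprS !mulNr mul1r.
Qed.

Lemma wedge1D xi w w' s :
  wedge1 xi (fun t => w t + w' t) s = wedge1 xi w s + wedge1 xi w' s.
Proof. by rewrite /wedge1 -big_split; apply: eq_bigr => j _; rewrite mulrDr. Qed.

Lemma wedge1Z xi (c : C) w s : wedge1 xi (fun t => c * w t) s = c * wedge1 xi w s.
Proof. by rewrite /wedge1 mulr_sumr; apply: eq_bigr => j _; rewrite mulrCA. Qed.

Lemma wedge1N xi w s : wedge1 xi (fun t => - w t) s = - wedge1 xi w s.
Proof. by rewrite /wedge1 -sumrN; apply: eq_bigr => j _; rewrite mulrN. Qed.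

Lemma wedge1_linl (a : C) xi eta w s :
  wedge1 (a *: xi + eta) w s = a * wedge1 xi w s + wedge1 eta w s.
Proof.
rewrite /wedge1 mulr_sumr -big_split; apply: eq_bigr => j _ /=.
have -> x : (x *m (a *: xi + eta)^T) 0 0 = a * (x *m xi^T) 0 0 + (x *m eta^T) 0 0 :> C.
  by rewrite linearP /= mulmxDr -scalemxAr mxE [in X in X + _]mxE.
ring.
Qed.

Definition swap_antisym w := forall s1 u v s2,
  w (s1 ++ u :: v :: s2) = - w (s1 ++ v :: u :: s2).

Lemma exform_swap w : is_exform w -> swap_antisym w.
Proof.
move=> [ml alt] s1 u v s2.
have A x : w (s1 ++ x :: x :: s2) = 0 by exact: (alt s1 [::] s2 x).
have D x y t1 t2 : w (t1 ++ (x + y) :: t2) = w (t1 ++ x :: t2) + w (t1 ++ y :: t2).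
  by have := ml t1 t2 1 x y; rewrite scale1r mul1r.
have D2 x : w (s1 ++ x :: (u + v) :: s2) = w (s1 ++ x :: u :: s2) + w (s1 ++ x :: v :: s2).
  by have := D u v (rcons s1 x) s2; rewrite !cat_rcons.
have /eqP := A (u + v); rewrite D !D2 !A add0r addr0 addrC addr_eq0 => /eqP ->.
by rewrite opprK.
Qed.

(** Moving the second copy of a repeated vector next to the first one only
    changes the sign. *)
Lemma swap_exform w : multilinear w -> swap_antisym w -> is_exform w.
Proof.
move=> ml sw; split=> // s1 s2 s3 v; elim: s2 s1 => [|y s2 IH] s1 /=.
  have := sw s1 v v s3 => /eqP; rewrite -subr_eq0 opprK -mulr2n -mulr_natr mulf_eq0.
  by rewrite pnatr_eq0 orbF => /eqP.
by rewrite sw -cat_rcons IH oppr0.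
Qed.

Lemma exform_cons w v : is_exform w -> is_exform (fun s => w (v :: s)).
Proof.
move=> [ml alt]; split=> [s1 s2 a x y|s1 s2 s3 x]; first exact: (ml (v :: s1)).
exact: (alt (v :: s1)).
Qed.

Lemma exform0 : is_exform (fun _ : seq V => 0 : C).
Proof. by split=> [s1 s2 a x y|s1 s2 s3 x] //; rewrite mulr0 addr0. Qed.

Lemma exformP w w' (c : C) : is_exform w -> is_exform w' ->
  is_exform (fun s => c * w s + w' s).
Proof.
move=> [ml alt] [ml' alt']; split=> [s1 s2 a x y|s1 s2 s3 x].
  by rewrite ml ml'; ring.
by rewrite alt alt' mulr0 addr0.
Qed.

Lemma exformD w w' : is_exform w -> is_exform w' -> is_exform (fun s => w s + w' s).
Proof. by move=> ew /(exformP 1 ew); under eq_fun do rewrite mul1r. Qed.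

Lemma exformZ w (c : C) : is_exform w -> is_exform (fun s => c * w s).
Proof. by move=> ew; have := exformP c ew exform0; under eq_fun do rewrite addr0. Qed.

Lemma exform_sum (I : Type) (r : seq I) (P : pred I) (F : I -> exform) :
  (forall i, P i -> is_exform (F i)) ->
  is_exform (fun s => \sum_(i <- r | P i) F i s).
Proof.
move=> eF; elim: r => [|i r IH].
  by under eq_fun do rewrite big_nil; exact: exform0.
case Pi: (P i); last by under eq_fun do rewrite big_cons Pi.
by under eq_fun do rewrite big_cons Pi; apply: exformD => //; exact: eF.
Qed.

Lemma exform_contract X w : is_exform w -> is_exform (contract X w).
Proof. by move=> ew; apply: exformD; last apply: exformZ; exact: exform_cons. Qed.

Lemma exform_wedge1 xi w : is_exform w -> is_exform (wedge1 xi w).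
Proof.
move=> ew; apply: swap_exform.
  move=> s1 s2 a u v; elim: s1 w ew => [|x s1 IH] w ew /=; last first.
    by rewrite !wedge1_cons (IH _ (exform_cons x ew)) ew.1; ring.
  rewrite !wedge1_cons covecP.
  have -> : (fun t => w ((a *: u + v) :: t)) = (fun t => (a%:C)%C * w (u :: t) + w (v :: t)).
    by apply/funext => t; exact: (ew.1 [::]).
  by rewrite wedge1D wedge1Z; ring.
move=> s1 u v s2; elim: s1 w ew => [|x s1 IH] w ew /=; last first.
  by rewrite !wedge1_cons (IH _ (exform_cons x ew)) (exform_swap ew); ring.
rewrite !wedge1_cons.
have -> : (fun t => w (u :: v :: t)) = (fun t => - w (v :: u :: t)).
  by apply/funext => t; exact: (exform_swap ew [::]).
by rewrite wedge1N; ring.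
Qed.

Lemma exform_clifford g w : is_exform w -> is_exform (clifford g w).
Proof. by move=> ew; apply: exformD; [exact: exform_contract|exact: exform_wedge1]. Qed.

Lemma wedge1_anticomm xi eta w s :
  wedge1 xi (wedge1 eta w) s + wedge1 eta (wedge1 xi w) s = 0.
Proof.
elim: s w => [|v s IH] w; first by rewrite !wedge1_nil addr0.
have E z : (fun t => wedge1 z w (v :: t)) =
    (fun t => covec z v * w t + - wedge1 z (fun t' => w (v :: t')) t).
  by apply/funext => t; rewrite wedge1_cons.
rewrite !wedge1_cons !E !wedge1D !wedge1Z !wedge1N.
have := IH (fun t => w (v :: t)); set A := wedge1 _ _ _; set B := wedge1 _ _ _ => AB.
by apply: etrans AB; ring.
Qed.

Lemma contract_anticomm X Y w s : is_exform w ->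
  contract X (contract Y w) s + contract Y (contract X w) s = 0.
Proof.
move=> ew; have sw := exform_swap ew [::].
rewrite /contract !(sw (map_mx _ Y)) /=; ring.
Qed.

Lemma contract_wedge1 X xi w s :
  contract X (wedge1 xi w) s + wedge1 xi (contract X w) s = (X *m xi^T) 0 0 * w s.
Proof.
rewrite {1}/contract !wedge1_cons /contract wedge1D wedge1Z.
have -> : (X *m xi^T) 0 0 = covec xi (map_mx (fun z => complex.Re z) X) +
    'i%C * covec xi (map_mx (fun z => complex.Im z) X).
  rewrite !covecE mulr_sumr -big_split mxE /=; apply: eq_bigr => k _.
  by rewrite !mxE mulrA -mulrDl -complexE.
ring.
Qed.

Lemma contract_linl (a : C) X Y w s : is_exform w ->
  contract (a *: X + Y) w s = a * contract X w s + contract Y w s.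
Proof.
move=> [ml _]; rewrite /contract.
have re : map_mx (fun z : C => complex.Re z) (a *: X + Y) =
    complex.Re a *: map_mx (fun z : C => complex.Re z) X +
    ((- complex.Im a) *: map_mx (fun z : C => complex.Im z) X +
     map_mx (fun z : C => complex.Re z) Y).
  by apply/rowP => k; rewrite !mxE complex_ReD complex_ReM mulNr addrA.
have im : map_mx (fun z : C => complex.Im z) (a *: X + Y) =
    complex.Re a *: map_mx (fun z : C => complex.Im z) X +
    (complex.Im a *: map_mx (fun z : C => complex.Re z) X +
     map_mx (fun z : C => complex.Im z) Y).
  by apply/rowP => k; rewrite !mxE complex_ImD complex_ImM addrA.
rewrite re im; do !rewrite (ml [::] s) /=.
rewrite [X in _ = X * _ + _](complexE a) rmorphN /=.
move: ((complex.Re a)%:C)%C ((complex.Im a)%:C)%C (w _) (w _) (w _) (w _) => x y A B D E.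
have i2 : 'i%C * 'i%C = -1 :> C by rewrite -expr2 sqr_i.
by move: 'i%C i2 => i i2; ring: i2.
Qed.

Lemma contractD X w w' s :
  contract X (fun t => w t + w' t) s = contract X w s + contract X w' s.
Proof. by rewrite /contract mulrDr addrACA. Qed.

Lemma contractZ X (c : C) w s : contract X (fun t => c * w t) s = c * contract X w s.
Proof. by rewrite /contract mulrDr [in RHS]mulrCA. Qed.

Lemma clifford_linl (a : C) g h w s : is_exform w ->
  clifford (a *: g + h) w s = a * clifford g w s + clifford h w s.
Proof.
move=> ew; rewrite /clifford !linearP /= wedge1_linl contract_linl //.
by rewrite addrACA -mulrDr.
Qed.

Lemma clifford_clifford g h w s : clifford g (clifford h w) s =
  contract (lsubmx g) (contract (lsubmx h) w) s + contract (lsubmx g) (wedge1 (rsubmx h) w) s +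
  (wedge1 (rsubmx g) (contract (lsubmx h) w) s + wedge1 (rsubmx g) (wedge1 (rsubmx h) w) s).
Proof. by rewrite {1}/clifford contractD wedge1D. Qed.

(** The terms with two contractions or two wedge products cancel; the mixed ones
    leave a scalar, which is twice the pairing. *)
Lemma clifford_anticomm g h w s : is_exform w ->
  clifford g (clifford h w) s + clifford h (clifford g w) s =
  ((lsubmx g *m (rsubmx h)^T) 0 0 + (lsubmx h *m (rsubmx g)^T) 0 0) * w s.
Proof.
move=> ew; rewrite !clifford_clifford mulrDl -!contract_wedge1.
have h1 := contract_anticomm (lsubmx g) (lsubmx h) s ew.
have h2 := wedge1_anticomm (rsubmx g) (rsubmx h) w s.
move: h1 h2.
move: (contract _ _ s) (contract _ _ s) (contract _ _ s) (contract _ _ s) => a b c e.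
move: (wedge1 _ _ s) (wedge1 _ _ s) (wedge1 _ _ s) (wedge1 _ _ s) => a' b' c' e'.
move=> h1 h2; transitivity (e + c + (e' + c') + (b + a' + (a + b'))); first by ring.
by rewrite h1 h2 !add0r.
Qed.

End ExteriorForms.

(** * The Clifford module of alternating forms *)

Section CliffordModule.
Variables (R : realType) (m : nat).
Local Notation C := R[i].
Local Notation V := 'rV[R]_m.
Local Notation cgen := 'rV[C]_(m + m).

Record altform := AltForm {
  form_val :> exform R m;
  form_valP : is_exform form_val
}.

HB.instance Definition _ := gen_eqMixin altform.
HB.instance Definition _ := gen_choiceMixin altform.

Lemma altform_eq (w w' : altform) : (forall s, form_val w s = form_val w' s) -> w = w'.
Proof.
case: w w' => [w pw] [w' pw'] /= /funext E; case: _ / E in pw' *.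
by congr AltForm; exact: Prop_irrelevance.
Qed.

(* The operations are sealed: otherwise unification compares forms by unfolding
   them to functions, then to complex arithmetic. *)
Fact altform_add_subproof : {f : altform -> altform -> altform |
  forall w w' s, form_val (f w w') s = form_val w s + form_val w' s}.
Proof. by exists (fun w w' => AltForm (exformD (form_valP w) (form_valP w'))). Qed.
Fact altform_scale_subproof : {f : C -> altform -> altform |
  forall c w s, form_val (f c w) s = c * form_val w s}.
Proof. by exists (fun c w => AltForm (exformZ c (form_valP w))). Qed.

Definition altform0 := AltForm (exform0 R m).
Definition altform_add := sval altform_add_subproof.
Definition altform_scale := sval altform_scale_subproof.
Definition altform_opp w := altform_scale (-1) w.

Fact altform_add_val w w' s :
  form_val (altform_add w w') s = form_val w s + form_val w' s.
Proof. exact: (svalP altform_add_subproof). Qed.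
Fact altform_scale_val c w s : form_val (altform_scale c w) s = c * form_val w s.
Proof. exact: (svalP altform_scale_subproof). Qed.
Let valE := (altform_add_val, altform_scale_val).

Fact altform_addA : associative altform_add.
Proof. by move=> u v w; apply: altform_eq => s; rewrite !valE addrA. Qed.
Fact altform_addC : commutative altform_add.
Proof. by move=> u v; apply: altform_eq => s; rewrite !valE addrC. Qed.
Fact altform_add0 : left_id altform0 altform_add.
Proof. by move=> u; apply: altform_eq => s; rewrite !valE add0r. Qed.
Fact altform_addN : left_inverse altform0 altform_opp altform_add.
Proof. by move=> u; apply: altform_eq => s; rewrite !valE mulN1r addNr. Qed.

HB.instance Definition _ := GRing.isZmodule.Build altform
  altform_addA altform_addC altform_add0 altform_addN.

Fact altform_scaleA a b w : altform_scale a (altform_scale b w) = altform_scale (a * b) w.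
Proof. by apply: altform_eq => s; rewrite !valE mulrA. Qed.
Fact altform_scale1 : left_id 1 altform_scale.
Proof. by move=> u; apply: altform_eq => s; rewrite !valE mul1r. Qed.
Fact altform_scaleDr : right_distributive altform_scale +%R.
Proof. by move=> a u v; apply: altform_eq => s; rewrite !valE mulrDr. Qed.
Fact altform_scaleDl w : {morph altform_scale^~ w : a b / a + b}.
Proof. by move=> a b; apply: altform_eq => s; rewrite !valE mulrDl. Qed.

HB.instance Definition _ := GRing.Zmodule_isLmodule.Build C altform
  altform_scaleA altform_scale1 altform_scaleDr altform_scaleDl.

(* Values are taken through a constant that is not a projection: rewriting with
   the lemmas below then only looks at values of forms. *)
Definition evform (w : altform) : exform R m := form_val w.

Lemma evformP (w : altform) : is_exform (evform w).
Proof. exact: form_valP. Qed.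
Lemma evform_eq (w w' : altform) : (forall s, evform w s = evform w' s) -> w = w'.
Proof. exact: altform_eq. Qed.
Lemma evformD (w w' : altform) s : evform (w + w') s = evform w s + evform w' s.
Proof. exact: altform_add_val. Qed.
Lemma evformZ c (w : altform) s : evform (c *: w) s = c * evform w s.
Proof. exact: altform_scale_val. Qed.
Lemma evformN (w : altform) s : evform (- w) s = - evform w s.
Proof. by rewrite -scaleN1r evformZ mulN1r. Qed.
Lemma evform0 s : evform (0 : altform) s = 0.
Proof. by []. Qed.
Lemma evform_sum (I : Type) (r : seq I) (P : pred I) (F : I -> altform) s :
  evform (\sum_(i <- r | P i) F i) s = \sum_(i <- r | P i) evform (F i) s.
Proof. by elim/big_rec2: _ => // i y1 y2 _ <-; rewrite evformD. Qed.
Definition evformE := (evformD, evformZ, evformN, evform0).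

Fact cl_subproof : {f : cgen -> altform -> altform |
  forall g w, evform (f g w) = clifford g (evform w)}.
Proof. by exists (fun g w => AltForm (exform_clifford g (evformP w))). Qed.
Definition cl := sval cl_subproof.

Lemma cl_val g w : evform (cl g w) = clifford g (evform w).
Proof. exact: (svalP cl_subproof). Qed.

Fact cl_is_linear g : linear (cl g).
Proof.
move=> a u v; apply: evform_eq => s; rewrite evformD evformZ !cl_val.
have -> : evform (a *: u + v) = fun t => a * evform u t + evform v t.
  by apply/funext => t; rewrite evformD evformZ.
move: (evform u) (evform v) => U W; rewrite /clifford contractD wedge1D wedge1Z mulrDr.
by rewrite contractZ addrACA.
Qed.
HB.instance Definition _ g := GRing.isLinear.Build C altform altform *:%R (cl g)
  (cl_is_linear g).

Lemma cl_addr g (v w : altform) : cl g (v + w) = cl g v + cl g w.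
Proof. exact: linearD. Qed.
Lemma cl_scaler g c (w : altform) : cl g (c *: w) = c *: cl g w.
Proof. exact: linearZ. Qed.
Lemma cl_oppr g (w : altform) : cl g (- w) = - cl g w.
Proof. exact: linearN. Qed.

Lemma clP a (g h : cgen) w : cl (a *: g + h) w = a *: cl g w + cl h w.
Proof.
apply: evform_eq => s; rewrite evformD evformZ !cl_val.
by rewrite clifford_linl //; exact: evformP.
Qed.

Definition cl_l (w : altform) (g : cgen) := cl g w.
Fact cl_l_is_linear w : linear (cl_l w).
Proof. by move=> a u v; exact: clP. Qed.
HB.instance Definition _ w := GRing.isLinear.Build C cgen altform *:%R (cl_l w)
  (cl_l_is_linear w).

Lemma clD g h w : cl (g + h) w = cl g w + cl h w.
Proof. exact: (linearD (cl_l w)). Qed.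
Lemma clZ a g w : cl (a *: g) w = a *: cl g w.
Proof. by rewrite -[a *: g]addr0 clP -/(cl_l w 0) linear0 addr0. Qed.
Lemma clN g w : cl (- g) w = - cl g w.
Proof. exact: (linearN (cl_l w)). Qed.
Lemma cl0 w : cl 0 w = 0.
Proof. exact: (linear0 (cl_l w)). Qed.
Lemma cl_suml (I : Type) (r : seq I) (P : pred I) (F : I -> cgen) w :
  cl (\sum_(i <- r | P i) F i) w = \sum_(i <- r | P i) cl (F i) w.
Proof. exact: (linear_sum (cl_l w)). Qed.

(** [bil] is twice the natural pairing, extended to complex generators, and [Smx]
    is its Gram matrix. *)
Definition Smx : 'M[C]_(m + m) := block_mx 0 1%:M 1%:M 0.
Definition bil (u v : cgen) : C := (u *m Smx *m v^T) 0 0.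

Lemma Smx_tr : Smx^T = Smx.
Proof. by rewrite /Smx tr_block_mx !trmx0 !trmx1. Qed.
Lemma Smx_sqr : Smx *m Smx = 1%:M.
Proof.
by rewrite /Smx mulmx_block !mul0mx !mulmx0 !mul1mx !addr0 !add0r -scalar_mx_block.
Qed.
Lemma bilE (u v : cgen) : bil u v =
  (lsubmx u *m (rsubmx v)^T) 0 0 + (rsubmx u *m (lsubmx v)^T) 0 0.
Proof.
rewrite /bil -{1}[u]hsubmxK -{1}[v]hsubmxK /Smx mul_row_block !mulmx0 !mulmx1 add0r addr0.
by rewrite tr_row_mx mul_row_col mxE addrC.
Qed.
Lemma dotC k (X Y : 'rV[C]_k) : (X *m Y^T) 0 0 = (Y *m X^T) 0 0.
Proof. by rewrite !mxE; apply: eq_bigr => a _; rewrite !mxE mulrC. Qed.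
Lemma bilC u v : bil u v = bil v u.
Proof.
by rewrite !bilE addrC; congr (_ + _); exact: dotC.
Qed.

Lemma cl_anticomm u v w : cl u (cl v w) = bil u v *: w - cl v (cl u w).
Proof.
apply/eqP; rewrite eq_sym subr_eq eq_sym; apply/eqP; apply: evform_eq => s.
rewrite evformD evformZ !cl_val clifford_anticomm; last exact: evformP.
by rewrite bilE [in RHS](dotC (rsubmx u)).
Qed.

(** The action of the element sum_AB T_AB e_A e_B of the Clifford algebra, where the
    e_A are the coordinate generators. *)
Definition quad (T : 'M[C]_(m + m)) (w : altform) : altform :=
  \sum_A cl (delta_mx 0 A) (cl (row A T) w).

Fact quad_is_linear T : linear (quad T).
Proof.
move=> a u v; rewrite /quad scaler_sumr -big_split /=; apply: eq_bigr => A _.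
by rewrite !linearP.
Qed.
HB.instance Definition _ T := GRing.isLinear.Build C altform altform *:%R (quad T)
  (quad_is_linear T).

Lemma quadE k (P Q : 'M[C]_(k, m + m)) w :
  \sum_i cl (row i P) (cl (row i Q) w) = quad (P^T *m Q) w.
Proof.
transitivity (\sum_i \sum_A cl (delta_mx 0 A) (cl (P i A *: row i Q) w)).
  apply: eq_bigr => i _; rewrite {1}[row i P]row_sum_delta cl_suml.
  by apply: eq_bigr => A _; rewrite !clZ mxE linearZ.
rewrite exchange_big; apply: eq_bigr => A _ /=.
rewrite -linear_sum -cl_suml; congr (cl _ (cl _ w)).
by rewrite row_mul mulmx_sum_row; apply: eq_bigr => i _; rewrite !mxE.
Qed.

Lemma quadP a T T' w : quad (a *: T + T') w = a *: quad T w + quad T' w.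
Proof.
rewrite /quad scaler_sumr -big_split; apply: eq_bigr => A _ /=.
by rewrite linearP /= clP linearP.
Qed.

Lemma quad_cl T u w :
  quad T (cl u w) = cl u (quad T w) + cl (u *m Smx *m (T^T - T)) w.
Proof.
have step A : cl (delta_mx 0 A) (cl (row A T) (cl u w)) =
   cl u (cl (delta_mx 0 A) (cl (row A T) w)) +
   cl (bil (row A T) u *: delta_mx 0 A - bil (delta_mx 0 A) u *: row A T) w.
  rewrite (cl_anticomm (row A T)) linearB linearZ /=.
  rewrite (cl_anticomm (delta_mx 0 A)) clD clN !clZ.
  by rewrite opprB addrCA.
rewrite /quad; under eq_bigr do rewrite step.
rewrite big_split /= -linear_sum -cl_suml; congr (_ + cl _ w).
rewrite sumrB mulmxBr; congr (_ - _).
  rewrite [RHS]row_sum_delta; apply: eq_bigr => A _; congr (_ *: _).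
  rewrite bilC /bil -mulmxA -[in RHS]mulmxA; rewrite !mxE; apply: eq_bigr => B _.
  congr (_ * _); rewrite !mxE; apply: eq_bigr => D _; by rewrite !mxE.
rewrite mulmx_sum_row; apply: eq_bigr => A _; congr (_ *: _).
by rewrite bilC /bil trmx_delta -colE mxE.
Qed.

(** The Lie algebra of the orthogonal group of the pairing, for endomorphisms acting
    on row vectors from the right. *)
Definition skew (B : 'M[C]_(m + m)) := B *m Smx = - (Smx *m B^T).

Lemma skew_bil B u v : skew B -> bil (u *m B) v = - bil u (v *m B).
Proof.
rewrite /bil /skew => sB; rewrite -[u *m B *m _]mulmxA sB mulmxN mulNmx mxE; congr (- _).
by rewrite trmx_mul !mulmxA.
Qed.

Lemma skew_trS B : skew B -> B^T *m Smx = - (Smx *m B).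
Proof.
move=> sB; rewrite -[RHS]mulmx1 -Smx_sqr mulNmx -[Smx *m B *m _]mulmxA [B *m _]mulmxA sB.
by rewrite mulNmx mulmxN opprK !mulmxA Smx_sqr mul1mx.
Qed.

Fact spin_subproof : {f : 'M[C]_(m + m) -> altform -> altform |
  forall B w, f B w = quad (- 2^-1 *: (Smx *m B)) w}.
Proof. by exists (fun B => quad (- 2^-1 *: (Smx *m B))). Qed.
(** The spin representation of the orthogonal Lie algebra on forms. *)
Definition spin := sval spin_subproof.

Lemma spinE B w : spin B w = quad (- 2^-1 *: (Smx *m B)) w.
Proof. exact: (svalP spin_subproof). Qed.

Fact spin_is_linear B : linear (spin B).
Proof. by move=> a u v; rewrite !spinE linearP. Qed.
HB.instance Definition _ B := GRing.isLinear.Build C altform altform *:%R (spin B)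
  (spin_is_linear B).

Lemma spinP a B B' w : spin (a *: B + B') w = a *: spin B w + spin B' w.
Proof. by rewrite !spinE mulmxDr -scalemxAr scalerDr scalerA mulrC -scalerA quadP. Qed.

Lemma spin_addr B (v w : altform) : spin B (v + w) = spin B v + spin B w.
Proof. exact: linearD. Qed.
Lemma spin_scaler B c (w : altform) : spin B (c *: w) = c *: spin B w.
Proof. exact: linearZ. Qed.
Lemma spin_oppr B (w : altform) : spin B (- w) = - spin B w.
Proof. exact: linearN. Qed.

Lemma spin0 w : spin 0 w = 0.
Proof. by have := spinP (-1) 0 0 w; rewrite scaler0 addr0 scaleN1r addNr. Qed.
Lemma spinZ a B w : spin (a *: B) w = a *: spin B w.
Proof. by have := spinP a B 0 w; rewrite addr0 spin0 addr0. Qed.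

(** This identity is what the normalization by -1/2 is for: [spin B] acts on the
    generators by commutators as [B] does. *)
Lemma spin_cl B u w : skew B -> spin B (cl u w) = cl u (spin B w) + cl (u *m B) w.
Proof.
move=> sB; rewrite !spinE quad_cl; congr (_ + cl _ w).
rewrite linearZ /= trmx_mul Smx_tr skew_trS // scalerN -opprD -scalerDl -scaleNr.
have -> : - (- 2^-1 + - 2^-1) = 1 :> C by field.
by rewrite scale1r -mulmxA [Smx *m _]mulmxA Smx_sqr mul1mx.
Qed.

Lemma spin_spin J B w : skew J ->
  spin J (spin B w) = spin B (spin J w) + spin (B *m J - J *m B) w.
Proof.
move=> sJ; rewrite (spinE B w) (spinE B (spin J w)) (spinE (_ - _)) {1 2}/quad.
set T := _ *: (Smx *m B).
rewrite linear_sum /=.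
under eq_bigr => A _ do rewrite !spin_cl // linearD /= -addrA.
rewrite big_split /=; congr (_ + _).
rewrite big_split /= addrC.
have -> : \sum_A cl (delta_mx 0 A *m J) (cl (row A T) w) = quad (J^T *m T) w.
  by rewrite -quadE; apply: eq_bigr => A _; rewrite -rowE.
have -> : \sum_A cl (delta_mx 0 A) (cl (row A T *m J) w) = quad (T *m J) w.
  by apply: eq_bigr => A _; rewrite -row_mul.
rewrite -[quad (J^T *m T) w]scale1r -quadP scale1r; congr (quad _ w).
rewrite /T -scalemxAl -scalemxAr mulmxA skew_trS // -scalerDr; congr (_ *: _).
by rewrite mulmxBr !mulmxA mulNmx addrC.
Qed.

(** Twice this element is the sum of the anticommutators of dual basis vectors. *)
Lemma quad_Smx w : quad Smx w = m%:R *: w.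
Proof.
have E : quad Smx w + quad Smx w = (m + m)%:R *: w.
  rewrite -{1}[Smx]mulmx1 -{1}Smx_tr -quadE /quad -big_split /=.
  transitivity (\sum_(A < m + m) w).
    apply: eq_bigr => A _; rewrite row1 cl_anticomm subrK.
    by rewrite /bil -row_mul Smx_sqr trmx_delta -colE !mxE eqxx scale1r.
  by rewrite sumr_const card_ord -scaler_nat.
apply: (@scalerI _ _ (2 : C)); first by rewrite pnatr_eq0.
by rewrite scalerA -natrM mul2n -addnn -E -[in RHS]mulr2n scaler_nat.
Qed.

End CliffordModule.

(** Linear identities between forms, checked on values.  Applications of operators
    are generalized first, which keeps conversion tests trivial. *)
Ltac form_ring :=
  repeat match goal with
  | |- context [cl ?g ?w] => generalize (cl g w); intro
  | |- context [spin ?B ?w] => generalize (spin B w); intro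
  end;
  repeat match goal with |- context [bil ?u ?v] => generalize (bil u v); intro end;
  apply: evform_eq => ?; rewrite ?evformE; ring.

(** * Spinor decomposition at a point *)

Section SpinorDecomposition.
Variables (R : realType) (m : nat).
Local Notation C := R[i].
Local Notation cgen := 'rV[C]_(m + m).
Local Notation altform := (altform R m).
Local Notation S := (@Smx R m).
Variable K : 'M[C]_(m + m).
Hypothesis K_sqr : K *m K = - 1%:M.
Hypothesis K_skew : skew K.
Hypothesis K_real : map_mx conjc K = K.
Implicit Types (u v : cgen) (w rho : altform).

Local Notation ii := ('i%C : C).

Lemma ii_sqr : ii * ii = -1. Proof. by rewrite -expr2 sqr_i. Qed.
Lemma conj_ii : conjc ii = - ii.
Proof. by apply/eqP; rewrite eq_complex /= oppr0 !eqxx. Qed.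
Lemma half_double (T : lmodType C) (v : T) : 2^-1 *: (v + v) = v.
Proof. by rewrite -mulr2n -[v *+ 2]scaler_nat scalerA mulVf ?scale1r ?pnatr_eq0. Qed.
Lemma ii_neq0 : ii != 0.
Proof. by apply/eqP => /(congr1 (fun z => z * z)) /eqP; rewrite ii_sqr mul0r oppr_eq0 oner_eq0. Qed.

Definition inL u := u *m K = ii *: u.
Definition inLb u := u *m K = - ii *: u.

(** The eigenvalue of the spin action on the forms obtained from canonical ones
    by j creation operators. *)
Definition lam (j : nat) : C := ii * (m%:R / 2 - j%:R).

Lemma lam_inj : injective lam.
Proof.
move=> j k /(mulfI ii_neq0) /addrI /oppr_inj /eqP.
by rewrite eqr_nat => /eqP.
Qed.

(** The canonical forms, seen as the vacuum vectors of a Fock space in which L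
    annihilates and Lbar creates. *)
Definition vac rho := forall u, inL u -> cl u rho = 0.

Lemma vac_cl s rho : vac rho -> cl (s *m K) rho = - ii *: cl s rho.
Proof.
(* this vector is twice the component of [s] in L *)
move=> /(_ (s - ii *: (s *m K))) h.
have /h : inL (s - ii *: (s *m K)).
  rewrite /inL mulmxBl -scalemxAl -mulmxA K_sqr mulmxN mulmx1 scalerN opprK.
  by rewrite scalerBr scalerA ii_sqr scaleN1r opprK addrC.
rewrite clD clN clZ => /eqP; rewrite subr_eq0 => /eqP ->.
by rewrite scalerA mulNr ii_sqr opprK scale1r.
Qed.

Lemma spin_vac rho : vac rho -> spin K rho = lam 0 *: rho.
Proof.
move=> vr; rewrite spinE /quad.
transitivity (\sum_A (2^-1 * ii) *: cl (delta_mx 0 A) (cl (row A S) rho)).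
  apply: eq_bigr => A _; rewrite linearZ /= row_mul clZ vac_cl //.
  by rewrite scalerA linearZ /= mulrNN.
by rewrite -scaler_sumr -/(quad S rho) quad_Smx scalerA /lam subr0; congr (_ *: _); ring.
Qed.

Lemma spin_create u w j : inLb u -> spin K w = lam j *: w ->
  spin K (cl u w) = lam j.+1 *: cl u w.
Proof.
move=> uL sw; rewrite spin_cl // sw uL linearZ /= clZ -scalerDl; congr (_ *: _).
by rewrite /lam -[j.+1]addn1 natrD; ring.
Qed.

(** The spans in the definition of the fibres of U, in inductive form.  The forms
    satisfying [A] are the canonical ones in the end, and forms killed by part of a
    basis of L in the course of the decomposition. *)
Inductive cspan (A : altform -> Prop) : nat -> altform -> Prop :=
| CspanVac rho : A rho -> cspan A 0 rho
| CspanZero j : cspan A j 0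
| CspanAdd j w w' : cspan A j w -> cspan A j w' -> cspan A j (w + w')
| CspanCreate j u w : inLb u -> cspan A j w -> cspan A j.+1 (cl u w).

Lemma cspan_spin j w : cspan vac j w -> spin K w = lam j *: w.
Proof.
elim=> {j w}[rho|j|j w w' _ IH _ IH'|j u w uL _ IH].
- exact: spin_vac.
- by rewrite linear0 scaler0.
- by rewrite linearD /= IH IH' scalerDr.
- exact: spin_create.
Qed.

Definition decomposes (A : altform -> Prop) N w :=
  exists2 f : nat -> altform, forall j, cspan A j (f j) & w = \sum_(j < N) f j.

Lemma decomposesD A N w w' : decomposes A N w -> decomposes A N w' ->
  decomposes A N (w + w').
Proof.
move=> [f fA ->] [f' fA' ->]; exists (fun j => f j + f' j).
  by move=> j; exact: CspanAdd.
by rewrite big_split.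
Qed.

Lemma decomposes1 A N j w : (j < N)%N -> cspan A j w -> decomposes A N w.
Proof.
move=> jN wA; exists (fun k => if k == j then w else 0).
  by move=> k; case: eqP => [->|_] //; exact: CspanZero.
rewrite (bigD1 (Ordinal jN)) //= eqxx big1 ?addr0 // => k kj.
by rewrite ifN.
Qed.

Lemma decomposes_sum A N (I : Type) (r : seq I) (F : I -> altform) :
  (forall i, decomposes A N (F i)) -> decomposes A N (\sum_(i <- r) F i).
Proof.
move=> h; elim/big_ind: _ => // [|w w']; last exact: decomposesD.
exists (fun=> 0); first by move=> j; exact: CspanZero.
by rewrite big1.
Qed.

Definition projL : 'M[C]_(m + m) := 2^-1 *: (1%:M - ii *: K).
Definition projLb : 'M[C]_(m + m) := 2^-1 *: (1%:M + ii *: K).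

Lemma projL_K : projL *m K = ii *: projL.
Proof.
rewrite /projL -scalemxAl mulmxBl mul1mx -scalemxAl K_sqr scalerN opprK.
rewrite [RHS]scalerA mulrC -scalerA; congr (_ *: _).
by rewrite scalerBr scalerA ii_sqr scaleN1r opprK addrC.
Qed.

Lemma projL_conj : map_mx conjc projL = projLb.
Proof.
rewrite /projL /projLb map_mxZ map_mxB map_mx1 map_mxZ K_real; congr (_ *: (_ + _)).
  by rewrite rmorphV ?unitfE ?pnatr_eq0 // rmorph_nat.
rewrite -scaleNr; congr (_ *: _).
by apply: (canLR (@opprK _)); exact: conj_ii.
Qed.

Lemma projLb_K : projLb *m K = - ii *: projLb.
Proof.
rewrite /projLb -scalemxAl mulmxDl mul1mx -scalemxAl K_sqr scalerN.
rewrite [RHS]scalerA mulrC -scalerA; congr (_ *: _).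
by rewrite scalerDr scalerA mulNr ii_sqr opprK scale1r scaleNr addrC scalemx1.
Qed.

Lemma projD : projL + projLb = 1%:M.
Proof.
by rewrite /projL /projLb -scalerDr addrACA addNr addr0 half_double.
Qed.

Lemma inL_proj u : inL u -> u *m projL = u.
Proof.
move=> uL; rewrite /projL -scalemxAr mulmxBr mulmx1 -scalemxAr uL scalerA ii_sqr.
by rewrite scaleN1r opprK half_double.
Qed.

Lemma projL_inL u : inL (u *m projL).
Proof. by rewrite /inL -mulmxA projL_K scalemxAr. Qed.
Lemma projLb_inLb u : inLb (u *m projLb).
Proof. by rewrite /inLb -mulmxA projLb_K scalemxAr. Qed.

Lemma projL_projLb : projL *m projLb = 0.
Proof.
rewrite /projLb -scalemxAr mulmxDr mulmx1 -scalemxAr projL_K scalerA ii_sqr.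
by rewrite scaleN1r subrr scaler0.
Qed.

(** The two projections are conjugate, so they have the same rank, and their
    product vanishes. *)
Lemma rank_projL : (\rank projL <= m)%N.
Proof.
have := mulmx0_rank_max projL_projLb; rewrite -projL_conj mxrank_map => h.
by rewrite -leq_double -!addnn.
Qed.

Local Notation r := (\rank projL).
Definition basisL : 'M[C]_(r, m + m) := row_base projL.
Definition basisLb : 'M[C]_(r, m + m) := map_mx conjc basisL.
Definition gram : 'M[C]_r := basisL *m S *m basisLb^T.

Lemma basisL_K : basisL *m K = ii *: basisL.
Proof.
have /submxP [X ->] : (basisL <= projL)%MS by rewrite eq_row_base.
by rewrite -mulmxA projL_K scalemxAr.
Qed.

Lemma basisLb_K : basisLb *m K = - ii *: basisLb.
Proof.
rewrite /basisLb -{1}K_real -map_mxM basisL_K map_mxZ; congr (_ *: _).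
exact: conj_ii.
Qed.

Lemma bil_rows k l (X : 'M[C]_(k, m + m)) (Y : 'M[C]_(l, m + m)) a b :
  bil (row a X) (row b Y) = (X *m S *m Y^T) a b.
Proof. by rewrite /bil -row_mul !mxE; apply: eq_bigr => c _; rewrite !mxE. Qed.

Lemma inL_isotropic u v : inL u -> inL v -> bil u v = 0.
Proof.
move=> uL vL; have := skew_bil u v K_skew; rewrite uL vL /bil.
rewrite -!scalemxAl linearZ /= -scalemxAr !mxE => /eqP.
rewrite -subr_eq0 opprK -mulr2n -mulr_natr !mulf_eq0 pnatr_eq0 (negbTE ii_neq0) /= orbF.
by move=> /eqP.
Qed.

Lemma basisL_inL a : inL (row a basisL).
Proof. by rewrite /inL -row_mul basisL_K linearZ. Qed.

Lemma bil_basisL a b : bil (row a basisL) (row b basisL) = 0.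
Proof. by apply: inL_isotropic; exact: basisL_inL. Qed.

Lemma basisL_isotropic : basisL *m S *m basisL^T = 0.
Proof. by apply/matrixP => a b; rewrite -bil_rows bil_basisL mxE. Qed.

Lemma projL_basis : exists Y, projL = Y *m basisL.
Proof. by apply/submxP; rewrite eq_row_base. Qed.

(** A vector of L orthogonal to Lbar is orthogonal to L + Lbar, which is
    everything. *)
Lemma gram_unit : gram \in unitmx.
Proof.
have [Y YE] := projL_basis.
have ET : projL^T = basisL^T *m Y^T := etrans (congr1 trmx YE) (trmx_mul _ _).
have EbT : projLb^T = basisLb^T *m (map_mx conjc Y)^T.
  rewrite -trmx_mul -projL_conj; congr trmx.
  exact: etrans (congr1 (map_mx conjc) YE) (map_mxM _ _ _).
rewrite -row_free_unit; apply: inj_row_free => v vG.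
have vL : v *m basisL *m S *m projL^T = 0.
  by rewrite ET mulmxA -[v *m _ *m _]mulmxA -[v *m _ *m _]mulmxA basisL_isotropic mulmx0 mul0mx.
have vLb : v *m basisL *m S *m projLb^T = 0.
  by rewrite EbT mulmxA -[v *m _ *m _]mulmxA -[v *m _ *m _]mulmxA -/gram vG mul0mx.
have vB : v *m basisL = 0.
  rewrite -[LHS]mulmx1 -(@Smx_sqr R m) mulmxA.
  have -> : v *m basisL *m S = 0; last by rewrite mul0mx.
  by rewrite -[LHS]mulmx1 -trmx1 -projD linearD /= mulmxDr vL vLb addr0.
by apply/eqP; rewrite -(mulmx_free_eq0 _ (row_base_free projL)) -/basisL vB.
Qed.

Definition dualLb : 'M[C]_(r, m + m) := (invmx gram)^T *m basisLb.

Lemma dualLb_inLb a : inLb (row a dualLb).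
Proof. by rewrite /inLb -row_mul -mulmxA basisLb_K -scalemxAr linearZ. Qed.

Lemma bil_dual a b : bil (row a basisL) (row b dualLb) = (a == b)%:R.
Proof.
rewrite bil_rows /dualLb trmx_mul trmxK mulmxA mulmxV ?mxE //.
exact: gram_unit.
Qed.

Definition killed (t : nat) rho := forall a : 'I_r, (a < t)%N -> cl (row a basisL) rho = 0.

(** One step of normal ordering: with a the t-th annihilation operator and b the dual
    creation operator, 1 = a b + b a splits a form into one killed by a and the product
    of b with another one. *)
Lemma cspan_step (t : 'I_r) j w : cspan (killed t) j w ->
  exists w1 w2, [/\ cspan (killed t.+1) j w1, cspan (killed t.+1) j.+1 w2 & w = w1 + w2].
Proof.
set l := row t basisL; set ld := row t dualLb.
elim=> {j w}[rho kr|j|j w w' _ [w1 [w2 [c1 c2 ->]]] _ [w1' [w2' [c1' c2' ->]]]|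
             j u w uL _ [w1 [w2 [c1 c2 ->]]]].
- have anti (a : 'I_r) (v : altform) : cl (row a basisL) (cl l v) = - cl l (cl (row a basisL) v).
    by rewrite cl_anticomm bil_basisL scale0r sub0r.
  have sq (v : altform) : cl l (cl l v) = 0.
    have /eqP := anti t v; rewrite -subr_eq0 opprK -mulr2n -scaler_nat scaler_eq0.
    by rewrite pnatr_eq0 => /eqP.
  have kl (v : altform) : (forall a : 'I_r, (a < t)%N -> cl (row a basisL) v = 0) ->
      killed t.+1 (cl l v).
    move=> kv a; rewrite ltnS leq_eqVlt => /orP[/eqP /val_inj ->|at_].
      exact: sq.
    by rewrite anti kv // linear0 oppr0.
  exists (cl l (cl ld rho)), (cl ld (cl l rho)); split.
  + apply: CspanVac; apply: kl => a at_.
    rewrite cl_anticomm bil_dual kr // linear0 subr0.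
    rewrite (_ : (a == t) = false) ?scale0r //; apply/negbTE.
    by rewrite -(inj_eq val_inj) neq_ltn at_.
  + apply: CspanCreate; first exact: dualLb_inLb.
    by apply: CspanVac; apply: kl => a; exact: kr.
  + by rewrite cl_anticomm bil_dual eqxx scale1r subrK.
- by exists 0, 0; split; [exact: CspanZero|exact: CspanZero|rewrite addr0].
- exists (w1 + w1'), (w2 + w2'); split; [exact: CspanAdd|exact: CspanAdd|].
  by rewrite addrACA.
- exists (cl u w1), (cl u w2); split; [exact: CspanCreate|exact: CspanCreate|].
  by rewrite linearD.
Qed.

Lemma decomposes_killed t w : (t <= r)%N -> decomposes (killed t) t.+1 w.
Proof.
elim: t => [|t IH] tr; first by apply: (@decomposes1 _ _ 0) => //; apply: CspanVac.
have [f fA ->] := IH (ltnW tr).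
apply: decomposes_sum => j.
have [w1 [w2 [c1 c2 ->]]] := @cspan_step (Ordinal tr) j _ (fA j).
apply: decomposesD; first by apply: decomposes1 c1; exact: ltnW (ltn_ord _).
by apply: decomposes1 c2; rewrite ltnS ltn_ord.
Qed.

Lemma killed_vac rho : killed r rho -> vac rho.
Proof.
move=> kr u uL; have [Y YE] := projL_basis.
have -> : u = (u *m Y) *m basisL.
  by rewrite -mulmxA; apply: etrans (congr1 (mulmx u) YE); rewrite inL_proj.
rewrite mulmx_sum_row cl_suml big1 // => a _.
by rewrite clZ kr ?scaler0 // ltn_ord.
Qed.

Lemma cspan_mono (A B : altform -> Prop) j w : (forall rho, A rho -> B rho) ->
  cspan A j w -> cspan B j w.
Proof.
move=> AB; elim=> {j w}[rho|j|j w w' _ IH _ IH'|j u w uL _ IH].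
- by move=> /AB; exact: CspanVac.
- exact: CspanZero.
- exact: CspanAdd.
- exact: CspanCreate.
Qed.

(** Normal ordering for all vectors of the basis of L, whose number is at most m. *)
Lemma decomposes_vac w : decomposes vac m.+1 w.
Proof.
have [f fA ->] := decomposes_killed w (leqnn r).
apply: decomposes_sum => j; apply: (@decomposes1 _ _ j).
  by apply: leq_trans (ltn_ord j) _; rewrite ltnS rank_projL.
by apply: cspan_mono (fA j) => rho; exact: killed_vac.
Qed.

(** The components of a form, as polynomials in the spin action (Lagrange
    interpolation); in this form they manifestly depend smoothly on K. *)
Definition pr_step (j : nat) (l : nat) (v : altform) : altform :=
  (lam j - lam l)^-1 *: (spin K v - lam l *: v).
Definition pr_indices (j : nat) := [seq l <- iota 0 m.+1 | l != j].
Definition pr (j : nat) (w : altform) : altform := foldr (pr_step j) w (pr_indices j).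

Lemma pr_stepD j l (v w : altform) : pr_step j l (v + w) = pr_step j l v + pr_step j l w.
Proof. by rewrite /pr_step [spin K _]linearD [lam l *: _]scalerDr opprD addrACA scalerDr. Qed.

Lemma prD j (v w : altform) : pr j (v + w) = pr j v + pr j w.
Proof. by rewrite /pr; elim: pr_indices => //= l s ->; rewrite pr_stepD. Qed.

Lemma pr0 j : pr j 0 = 0.
Proof. by apply: (@addrI _ (pr j 0)); rewrite -prD !addr0. Qed.

Lemma pr_sum j (I : Type) (s : seq I) (F : I -> altform) :
  pr j (\sum_(i <- s) F i) = \sum_(i <- s) pr j (F i).
Proof. by apply: (big_morph _ (prD j) (pr0 j)). Qed.

Lemma pr_eigen j k (v : altform) : (k <= m)%N -> spin K v = lam k *: v ->
  pr j v = if k == j then v else 0.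
Proof.
move=> km sv.
have E s : foldr (pr_step j) v s = (\prod_(l <- s) ((lam k - lam l) / (lam j - lam l))) *: v.
  elim: s => [|l s IH] /=; first by rewrite big_nil scale1r.
  rewrite IH /pr_step [spin K _]linearZ /= sv !scalerA -scalerBl scalerA big_cons.
  by congr (_ *: _); ring.
rewrite /pr E; case: eqP => [->|/eqP kj].
  rewrite big_seq big1 ?scale1r // => l; rewrite mem_filter => /andP[lj _].
  by rewrite divff // subr_eq0 (inj_eq lam_inj) eq_sym.
have kin : k \in pr_indices j by rewrite mem_filter kj mem_iota /= add0n ltnS.
have -> : \prod_(l <- pr_indices j) ((lam k - lam l) / (lam j - lam l)) = 0.
  by rewrite (perm_big _ (perm_to_rem kin)) big_cons /= subrr mul0r mul0r.
exact: scale0r.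
Qed.

Lemma pr_cspan_sum (f : nat -> altform) j : (j <= m)%N ->
  (forall k, cspan vac k (f k)) -> pr j (\sum_(k < m.+1) f k) = f j.
Proof.
move=> jm fA; rewrite pr_sum (bigD1 (inord j)) //= big1 => [|k kj].
  by rewrite (@pr_eigen _ j) ?inordK ?eqxx ?addr0 //; exact: cspan_spin.
rewrite (@pr_eigen _ k) ?ifN //; first by rewrite -(inj_eq val_inj) /= inordK in kj.
  by rewrite -ltnS ltn_ord.
exact: cspan_spin.
Qed.

Lemma pr_cspan j w : (j <= m)%N -> cspan vac j (pr j w).
Proof. by move=> jm; have [f fA ->] := decomposes_vac w; rewrite pr_cspan_sum. Qed.

Lemma pr_total w : w = \sum_(j < m.+1) pr j w.
Proof.
have [f fA E] := decomposes_vac w; rewrite {1}E; apply: eq_bigr => j _.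
by rewrite E pr_cspan_sum // -ltnS ltn_ord.
Qed.

Lemma spin_cspan j w : (j <= m)%N -> spin K w = lam j *: w -> cspan vac j w.
Proof. by move=> jm /(pr_eigen j jm); rewrite eqxx => <-; exact: pr_cspan. Qed.

Lemma prZ j c (w : altform) : pr j (c *: w) = c *: pr j w.
Proof.
rewrite /pr; elim: pr_indices => //= l s ->.
rewrite /pr_step [spin K _]linearZ /=; form_ring.
Qed.

Lemma pr_spin j (w : altform) : pr j (spin K w) = spin K (pr j w).
Proof.
rewrite /pr; elim: pr_indices => //= l s ->.
by rewrite /pr_step !(spin_scaler, spin_addr, spin_oppr).
Qed.

(** Being generated by canonical forms is stated with an explicit finite sum in
    the definition of the fibres of U. *)
Lemma cspanP j w : cspan vac j w <->
  exists (N : nat) (l : 'I_N -> seq cgen) (rho : 'I_N -> altform),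
    [/\ forall a, size (l a) = j, forall a u, u \in l a -> inLb u,
        forall a, vac (rho a) & w = \sum_(a < N) foldr (@cl R m) (rho a) (l a)].
Proof.
split=> [|[N [l [rho [sl lL vr ->]]]]]; last first.
  elim/big_ind: _ => [|x y|a _]; [exact: CspanZero|exact: CspanAdd|].
  rewrite -(sl a); have := lL a; elim: (l a) => [|u s IH] sL /=.
    exact: CspanVac.
  apply: CspanCreate; first by apply: sL; rewrite mem_head.
  by apply: IH => v vs; apply: sL; rewrite inE vs orbT.
move=> cw; suff [ts [ts_ok ->]] : exists ts : seq (seq cgen * altform),
    (forall t, List.In t ts -> [/\ size t.1 = j, forall u, u \in t.1 -> inLb u & vac t.2]) /\
    w = \sum_(t <- ts) foldr (@cl R m) t.2 t.1.
  exists (size ts), (fun a => (tnth (in_tuple ts) a).1), (fun a => (tnth (in_tuple ts) a).2).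
  have tin (a : 'I_(size ts)) : List.In (tnth (in_tuple ts) a) ts.
    rewrite (tnth_nth ([::], 0)) /=; case: a => a /=.
    by elim: ts {ts_ok} a => // t ts IH [|a] /=; [left|rewrite ltnS => /IH; right].
  split.
  - by move=> a; have [] := ts_ok _ (tin a).
  - by move=> a; have [] := ts_ok _ (tin a).
  - by move=> a; have [] := ts_ok _ (tin a).
  - by rewrite big_tnth.
elim: cw => {j w}[rho vr|j|j w w' _ [ts [ok ->]] _ [ts' [ok' ->]]|j u w uL _ [ts [ok ->]]].
- exists [:: ([::], rho)]; split; last by rewrite big_seq1.
  by move=> t [<-|] //=.
- by exists [::]; split; last by rewrite big_nil.
- exists (ts ++ ts'); split; last by rewrite big_cat.
  by move=> t tin; have [/ok|/ok'] := List.in_app_or _ _ _ tin.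
- exists [seq (u :: t.1, t.2) | t <- ts]; split.
    move=> t /(List.in_map_iff _ _ _).1 [t' [<- /ok [st tL vt]]].
    split=> //=; first by rewrite st.
    by move=> v; rewrite inE => /orP[/eqP -> //|/tL].
  by rewrite big_map linear_sum.
Qed.

End SpinorDecomposition.

(** * The first order obstruction *)

Section Obstruction.
Variables (R : realType) (m : nat).
Local Notation C := R[i].
Local Notation cgen := 'rV[C]_(m + m).
Local Notation altform := (altform R m).
Local Notation S := (@Smx R m).
Variables (K : 'M[C]_(m + m)) (Ka : 'I_m -> 'M[C]_(m + m)).
Hypothesis K_sqr : K *m K = - 1%:M.
Hypothesis K_skew : skew K.
Hypothesis Ka_skew : forall a, skew (Ka a).
Hypothesis Ka_anti : forall a, K *m Ka a = - (Ka a *m K).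

Local Notation ii := ('i%C : C).

(** The covector dx_a. *)
Definition dxa (a : 'I_m) : cgen := delta_mx 0 (rshift m a).

(** When [K] and [Ka] are the values at a point of a generalized complex structure
    and of its partial derivatives, this is, up to a constant factor, the Courant
    bracket of two sections of L with values u and v at that point. *)
Definition bracket_mx (u v : cgen) : cgen :=
  \sum_a (bil (dxa a) u *: (v *m Ka a) - bil (dxa a) v *: (u *m Ka a) +
          bil (u *m Ka a) v *: dxa a).

(* Involutivity of L and of its conjugate, in terms of first derivatives. *)
Hypothesis integrableL : forall u v, inL K u -> inL K v -> inL K (bracket_mx u v).
Hypothesis integrableLb : forall u v, inLb K u -> inLb K v -> inLb K (bracket_mx u v).

Lemma skew_KaK a : skew (Ka a *m K).
Proof.
rewrite /skew -mulmxA K_skew mulmxN mulmxA Ka_skew mulNmx opprK -mulmxA -trmx_mul Ka_anti.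
by rewrite raddfN mulmxN.
Qed.

Lemma spin_K_Ka a w : spin K (spin (Ka a) w) =
  spin (Ka a) (spin K w) + 2 *: spin (Ka a *m K) w.
Proof.
by rewrite spin_spin // Ka_anti opprK -spinZ; congr (_ + spin _ w); rewrite -mulr2n scaler_nat.
Qed.

Lemma spin_K_KaK a w : spin K (spin (Ka a *m K) w) =
  spin (Ka a *m K) (spin K w) - 2 *: spin (Ka a) w.
Proof.
rewrite spin_spin // -scaleNr -spinZ; congr (_ + spin _ w).
rewrite mulmxA Ka_anti mulNmx opprK -mulmxA K_sqr mulmxN mulmx1.
by rewrite -mulr2n scaleNr scaler_nat mulNrn.
Qed.

(** The obstruction to the splitting of d: if D is the value of dF at the point and F
    is an eigenvector of the spin action for l, then (spin K - l)^2 + 1 maps D to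
    - 2 theta F.  It is the action of a cubic element of the Clifford algebra. *)
Definition theta (w : altform) : altform :=
  \sum_a (cl (dxa a *m K) (spin (Ka a) w) + cl (dxa a) (spin (Ka a *m K) w)).
Definition theta' (w : altform) : altform :=
  \sum_a (cl (dxa a *m K) (spin (Ka a *m K) w) - cl (dxa a) (spin (Ka a) w)).

Lemma thetaP c v w : theta (c *: v + w) = c *: theta v + theta w.
Proof.
rewrite /theta scaler_sumr -big_split; apply: eq_bigr => a _ /=.
rewrite !(spin_addr, spin_scaler, cl_addr, cl_scaler); form_ring.
Qed.
Lemma theta'P c v w : theta' (c *: v + w) = c *: theta' v + theta' w.
Proof.
rewrite /theta' scaler_sumr -big_split; apply: eq_bigr => a _ /=.
rewrite !(spin_addr, spin_scaler, cl_addr, cl_scaler); form_ring.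
Qed.
HB.instance Definition _ := GRing.isLinear.Build C altform altform *:%R theta thetaP.
HB.instance Definition _ := GRing.isLinear.Build C altform altform *:%R theta' theta'P.

Lemma theta_addr v w : theta (v + w) = theta v + theta w.
Proof. exact: linearD. Qed.
Lemma theta_scaler c w : theta (c *: w) = c *: theta w.
Proof. exact: linearZ. Qed.
Lemma theta'_addr v w : theta' (v + w) = theta' v + theta' w.
Proof. exact: linearD. Qed.
Lemma theta'_scaler c w : theta' (c *: w) = c *: theta' w.
Proof. exact: linearZ. Qed.

Lemma dxaKK a : dxa a *m K *m K = - dxa a.
Proof. by rewrite -mulmxA K_sqr mulmxN mulmx1. Qed.

(** By these two commutation rules, [theta] only has components of degrees 3 and
    -3 for the grading by the spin action. *)
Lemma spin_theta w : spin K (theta w) = theta (spin K w) + 3 *: theta' w.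
Proof.
rewrite linear_sum /theta /theta' scaler_sumr -big_split; apply: eq_bigr => a _ /=.
rewrite spin_addr !spin_cl // spin_K_Ka spin_K_KaK dxaKK clN.
rewrite !(cl_addr, cl_oppr, cl_scaler); form_ring.
Qed.

Lemma spin_theta' w : spin K (theta' w) = theta' (spin K w) - 3 *: theta w.
Proof.
rewrite linear_sum /theta /theta' scaler_sumr -sumrB; apply: eq_bigr => a _ /=.
rewrite spin_addr spin_oppr !spin_cl // spin_K_Ka spin_K_KaK dxaKK clN.
rewrite !(cl_addr, cl_oppr, cl_scaler); form_ring.
Qed.

(** As [theta] is cubic, its anticommutator with a generator is quadratic, and the
    commutator of the latter with another generator is again a generator. *)
Definition theta_acl u (w : altform) : altform := theta (cl u w) + cl u (theta w).

Lemma cl_spin_acl (g u : cgen) B (w : altform) : skew B ->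
  cl g (spin B (cl u w)) + cl u (cl g (spin B w)) =
  cl g (cl (u *m B) w) + bil u g *: spin B w.
Proof.
move=> sB; rewrite spin_cl // cl_addr (cl_anticomm u g); form_ring.
Qed.

Lemma theta_aclE u w : theta_acl u w =
  \sum_a (cl (dxa a *m K) (cl (u *m Ka a) w) + bil u (dxa a *m K) *: spin (Ka a) w +
          (cl (dxa a) (cl (u *m Ka a *m K) w) + bil u (dxa a) *: spin (Ka a *m K) w)).
Proof.
rewrite /theta_acl /theta linear_sum -big_split; apply: eq_bigr => a _ /=.
rewrite cl_addr -mulmxA -(cl_spin_acl (dxa a *m K) u w (Ka_skew a)).
by rewrite -(cl_spin_acl (dxa a) u w (skew_KaK a)) addrACA.
Qed.

Lemma theta_acl_addr u v w : theta_acl u (v + w) = theta_acl u v + theta_acl u w.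
Proof. by rewrite /theta_acl !(cl_addr, theta_addr) addrACA. Qed.
Lemma theta_acl_sum u (I : Type) (r : seq I) (P : pred I) (F : I -> altform) :
  theta_acl u (\sum_(i <- r | P i) F i) = \sum_(i <- r | P i) theta_acl u (F i).
Proof.
apply: (big_morph _ (theta_acl_addr u)).
by rewrite /theta_acl !linear0 addr0.
Qed.

Lemma theta_aclD u u' w : theta_acl (u + u') w = theta_acl u w + theta_acl u' w.
Proof. rewrite /theta_acl !clD linearD /=; form_ring. Qed.

Definition xi_term (g u v : cgen) (B : 'M[C]_(m + m)) : cgen :=
  bil (u *m B) v *: g - bil g v *: (u *m B) + bil u g *: (v *m B).

Lemma acl_term_cl (g u v : cgen) B (w : altform) : skew B ->
  cl g (cl (u *m B) (cl v w)) + bil u g *: spin B (cl v w) =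
  cl v (cl g (cl (u *m B) w) + bil u g *: spin B w) + cl (xi_term g u v B) w.
Proof.
move=> sB; rewrite (cl_anticomm (u *m B) v) spin_cl // !(cl_addr, cl_oppr, cl_scaler).
rewrite (cl_anticomm g v) /xi_term !clD clN !clZ; form_ring.
Qed.

Definition xi_mx (u v : cgen) : cgen :=
  \sum_a (xi_term (dxa a *m K) u v (Ka a) + xi_term (dxa a) u v (Ka a *m K)).

Lemma theta_acl_cl u v w :
  theta_acl u (cl v w) = cl v (theta_acl u w) + cl (xi_mx u v) w.
Proof.
rewrite !theta_aclE linear_sum /= /xi_mx cl_suml -big_split; apply: eq_bigr => a _ /=.
rewrite -!mulmxA (acl_term_cl (dxa a *m K) u v w (Ka_skew a)).
rewrite (acl_term_cl (dxa a) u v w (skew_KaK a)).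
by rewrite clD [in RHS]cl_addr addrACA.
Qed.

(** For two vectors in the same eigenbundle of K, [xi_mx] is, up to a constant factor,
    the component of their bracket in the other eigenbundle. *)
Lemma xi_mx_same u v c : c * c = -1 -> u *m K = c *: u -> v *m K = c *: v ->
  bracket_mx u v *m K = c *: bracket_mx u v -> xi_mx u v = 0.
Proof.
move=> cc uK vK bK.
have -> : xi_mx u v = bracket_mx u v *m K - c *: bracket_mx u v; last by rewrite bK subrr.
rewrite /bracket_mx mulmx_suml scaler_sumr -sumrB; apply: eq_bigr => a _; rewrite /xi_term !mulmxA.
have uKaK (x : cgen) : x *m K = c *: x -> x *m Ka a *m K = - c *: (x *m Ka a).
  by move=> xK; rewrite -mulmxA -[Ka a *m K]opprK -Ka_anti mulmxN mulmxA xK -scalemxAl scaleNr.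
have blK (x y : cgen) : y *m K = c *: y -> bil (x *m K) y = - (c * bil x y).
  by move=> yK; rewrite skew_bil // yK /bil linearZ /= -scalemxAr mxE.
rewrite (bilC u (dxa a *m K)) (bilC u (dxa a)) !blK //.
rewrite !mulmxDl mulNmx -!scalemxAl !uKaK //.
move: (bil (dxa a) u) (bil (dxa a) v) (bil (u *m Ka a) v) => x y z.
move: (dxa a *m K) (dxa a) (u *m Ka a) (v *m Ka a) => f g h k.
by apply/rowP => b; rewrite !mxE; ring.
Qed.

(** For vectors in opposite eigenbundles there is no condition: each [Ka a]
    exchanges the eigenbundles, and all terms cancel. *)
Lemma xi_mx_opp u v c : c != 0 -> u *m K = c *: u -> v *m K = - c *: v ->
  xi_mx u v = 0.
Proof.
move=> c0 uK vK; apply: big1 => a _; rewrite /xi_term !mulmxA.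
have uKaK : u *m Ka a *m K = - c *: (u *m Ka a).
  by rewrite -mulmxA -[Ka a *m K]opprK -Ka_anti mulmxN mulmxA uK -scalemxAl scaleNr.
have vKaK : v *m Ka a *m K = c *: (v *m Ka a).
  by rewrite -mulmxA -[Ka a *m K]opprK -Ka_anti mulmxN mulmxA vK -scalemxAl scaleNr opprK.
have blK (x y : cgen) e : y *m K = e *: y -> bil (x *m K) y = - (e * bil x y).
  by move=> yK; rewrite skew_bil // yK /bil linearZ /= -scalemxAr mxE.
have b0 : bil (u *m Ka a) v = 0.
  have /eqP := blK (u *m Ka a) v _ vK; rewrite uKaK /bil -!scalemxAl mxE.
  rewrite mulNr opprK -subr_eq0 -opprD oppr_eq0 -mulr2n -mulr_natr !mulf_eq0.
  by rewrite (negbTE c0) pnatr_eq0 /= orbF => /eqP.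
rewrite (bilC u (dxa a *m K)) (bilC u (dxa a)) (blK _ _ _ vK) (blK _ _ _ uK).
have -> : bil (u *m Ka a *m K) v = 0 by rewrite (blK _ _ _ vK) b0 mulr0 oppr0.
rewrite b0 uKaK vKaK !scale0r.
by apply/rowP => b; rewrite !mxE; ring.
Qed.

Lemma split_cgen (x : cgen) : exists x1 x2, [/\ x = x1 + x2, inL K x1 & inLb K x2].
Proof.
exists (x *m projL K), (x *m projLb K).
by split; [rewrite -mulmxDr projD mulmx1|exact: projL_inL|exact: projLb_inLb].
Qed.

Lemma theta_acl_comm_cl u v w : theta_acl u (cl v w) = cl v (theta_acl u w).
Proof.
have xi0 x y : (inL K x \/ inLb K x) -> (inL K y \/ inLb K y) -> xi_mx x y = 0.
  have i2 := @ii_sqr R; have i2' : (- ii) * (- ii) = -1 by rewrite mulrNN.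
  have i0 := @ii_neq0 R; have i0' : - ii != 0 by rewrite oppr_eq0.
  move=> [xL|xL] [yL|yL].
  - by apply: (xi_mx_same i2) => //; exact: integrableL.
  - exact: (xi_mx_opp i0).
  - by apply: (xi_mx_opp i0') => //; rewrite opprK.
  - by apply: (xi_mx_same i2') => //; exact: integrableLb.
have [u1 [u2 [-> u1L u2L]]] := split_cgen u; have [v1 [v2 [-> v1L v2L]]] := split_cgen v.
rewrite !clD !theta_aclD !theta_acl_addr !theta_acl_cl !xi0 ?cl0; try by [left|right].
by rewrite !addr0 !cl_addr; form_ring.
Qed.

Lemma theta_acl_quad u T w : theta_acl u (quad T w) = quad T (theta_acl u w).
Proof.
rewrite /quad theta_acl_sum; apply: eq_bigr => A _.
by rewrite !theta_acl_comm_cl.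
Qed.

(** The possible weights of [theta_acl u] for the spin action are c + 3i and c - 3i,
    with c = i or -i.  As it commutes with that action and no weight is 0, it
    vanishes. *)
Lemma theta_acl_eigen u c w : c * c = -1 -> u *m K = c *: u -> theta_acl u w = 0.
Proof.
move=> cc uK.
pose theta'_acl (w : altform) := theta' (cl u w) + cl u (theta' w).
have E1 v : spin K (theta_acl u v) = theta_acl u (spin K v) + c *: theta_acl u v +
    3 *: theta'_acl v.
  rewrite /theta_acl /theta'_acl spin_addr spin_theta !spin_cl // spin_theta uK !clZ.
  by rewrite !(theta_addr, theta_scaler, cl_addr, cl_scaler); form_ring.
have E2 v : spin K (theta'_acl v) = theta'_acl (spin K v) + c *: theta'_acl v -
    3 *: theta_acl u v.
  rewrite /theta_acl /theta'_acl spin_addr spin_theta' !spin_cl // spin_theta' uK !clZ.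
  by rewrite !(theta'_addr, theta'_scaler, cl_addr, cl_oppr, cl_scaler); form_ring.
have acl_spin v : theta_acl u (spin K v) = spin K (theta_acl u v).
  by rewrite !spinE theta_acl_quad.
have T' v : theta'_acl v = (- c / 3) *: theta_acl u v.
  have /eqP := E1 v; rewrite acl_spin -addrA -subr_eq0 opprD addNKr.
  rewrite oppr_eq0 addr_eq0 => /eqP h.
  apply: (@scalerI _ _ (3 : C)); first by rewrite pnatr_eq0.
  by rewrite scalerA mulrC divfK ?pnatr_eq0 // scaleNr -[LHS]opprK -h.
have /eqP := E2 w; rewrite !T' spin_scaler -acl_spin.
rewrite -addrA -subr_eq0 opprD addNKr oppr_eq0 scalerA -scalerBl scaler_eq0.
have -> : c * (- c / 3) - 3 = - (8 / 3).
  by rewrite mulrA mulrN cc; field.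
by rewrite oppr_eq0 mulf_eq0 invr_eq0 !pnatr_eq0 => /eqP.
Qed.

Lemma theta_anticomm u w : theta (cl u w) = - cl u (theta w).
Proof.
have [u1 [u2 [-> u1L u2L]]] := split_cgen u.
apply/eqP; rewrite -addr_eq0; apply/eqP.
rewrite -[LHS]/(theta_acl (u1 + u2) w) theta_aclD.
rewrite (theta_acl_eigen _ (@ii_sqr R) u1L) (theta_acl_eigen _ _ u2L) ?addr0 //.
by rewrite mulrNN ii_sqr.
Qed.

(** As it anticommutes with all generators, [theta] commutes with the spin action,
    which is quadratic; but its weights are not 0. *)
Lemma theta0 w : theta w = 0.
Proof.
have comm v : theta (spin K v) = spin K (theta v).
  rewrite !spinE /quad !linear_sum; apply: eq_bigr => A _ /=.
  by rewrite !theta_anticomm cl_oppr opprK.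
have t'0 v : theta' v = 0.
  have /eqP := spin_theta v; rewrite comm -subr_eq0 opprD addNKr oppr_eq0.
  by rewrite scaler_eq0 pnatr_eq0 => /eqP.
have /eqP := spin_theta' w; rewrite !t'0 linear0 sub0r eq_sym oppr_eq0.
by rewrite scaler_eq0 pnatr_eq0 => /eqP.
Qed.

(** The second hypothesis is the derivative of the eigenvalue equation for [F], with
    [Fa] the partial derivatives of [F], and [D] is then its exterior derivative.
    Since [theta F] is 0, (spin K - l)^2 = - 1 on [D]. *)
Lemma spin_differential (F : altform) (Fa : 'I_m -> altform) (l : C) :
  spin K F = l *: F -> (forall a, spin (Ka a) F + spin K (Fa a) = l *: Fa a) ->
  let D := \sum_a cl (dxa a) (Fa a) in
  exists D1 D2, [/\ D = D1 + D2, spin K D1 = (l + ii) *: D1 & spin K D2 = (l - ii) *: D2].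
Proof.
move=> KF KFa D.
pose G := spin K D - l *: D.
have GE : G = \sum_a (cl (dxa a *m K) (Fa a) - cl (dxa a) (spin (Ka a) F)).
  rewrite /G /D linear_sum scaler_sumr -sumrB; apply: eq_bigr => a _ /=.
  have -> : spin (Ka a) F = l *: Fa a - spin K (Fa a) by rewrite -KFa addrK.
  by rewrite spin_cl // cl_addr cl_oppr cl_scaler; form_ring.
have KG : spin K G - l *: G = - D.
  transitivity (- D - 2 *: theta F); last by rewrite theta0 scaler0 subr0.
  rewrite GE linear_sum /theta /D !scaler_sumr -!sumrN -!big_split /=; apply: eq_bigr => a _.
  rewrite spin_addr spin_oppr !spin_cl // spin_K_Ka KF spin_scaler dxaKK clN.
  have -> : spin K (Fa a) = l *: Fa a - spin (Ka a) F by rewrite -KFa addrC addKr.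
  by rewrite !(cl_addr, cl_oppr, cl_scaler); form_ring.
have KD : spin K D = l *: D + G by rewrite /G addrC subrK.
have {}KG : spin K G = l *: G - D by rewrite -KG addrC subrK.
clearbody G D.
exists (2^-1 *: (D - ii *: G)), (2^-1 *: (D + ii *: G)); split.
- by rewrite -scalerDr addrACA addNr addr0 half_double.
- rewrite !(spin_scaler, spin_addr, spin_oppr) KD KG.
  apply: evform_eq => s; rewrite !evformE.
  by move: (evform D s) (evform G s) (2^-1 : C) ii (@ii_sqr R) => x y h i i2; ring: i2.
- rewrite !(spin_scaler, spin_addr, spin_oppr) KD KG.
  apply: evform_eq => s; rewrite !evformE.
  by move: (evform D s) (evform G s) (2^-1 : C) ii (@ii_sqr R) => x y h i i2; ring: i2.
Qed.

End Obstruction.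

(** * Charts and transition maps *)

Section Jacobians.
Variable R : realType.

Lemma jacobian_near m n (f g : 'rV[R]_m -> 'rV[R]_n) p :
  differentiable f p -> differentiable g p -> (\forall q \near p, f q = g q) ->
  jacobian f p = jacobian g p.
Proof.
move=> df dg fg; apply/matrixP => a c.
apply: etrans (jacobian_entry a c df) _; apply: etrans (esym (jacobian_entry a c dg)).
by apply: near_eq_derive; apply: filterS fg => q ->.
Qed.

Lemma jacobian_comp m n k (f : 'rV[R]_m -> 'rV[R]_n) (g : 'rV[R]_n -> 'rV[R]_k) p :
  differentiable f p -> differentiable g (f p) ->
  jacobian (g \o f) p = jacobian f p *m jacobian g (f p).
Proof.
move=> df dg; apply/row_matrixP => a; rewrite !rowE mulmxA /jacobian !mul_rV_lin1.
by rewrite diff_comp.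
Qed.

Lemma jacobian_id m (p : 'rV[R]_m) : jacobian id p = 1%:M.
Proof.
apply/row_matrixP => a; rewrite !rowE mulmx1 /jacobian mul_rV_lin1.
by rewrite (@diff_lin _ _ _ idfun) // => ?.
Qed.

End Jacobians.

Section Charts.
Variables (R : realType) (m : nat) (M : smooth_manifold R m).
Local Notation V := 'rV[R]_m.
Implicit Types (i j k : chart_index M) (x : M) (q : V).

Definition cdom i : set V := chart i @` dom i.
Definition overlap i j : set V := chart i @` (dom i `&` dom j).
Definition trans i j : V -> V := chart j \o chart_inv i.

Lemma cdom_inv i q : cdom i q -> dom i (chart_inv i q) /\ chart i (chart_inv i q) = q.
Proof. by move=> [x dx <-]; rewrite chartK. Qed.

Lemma cdom_chart i x : dom i x -> cdom i (chart i x).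
Proof. by move=> dx; exists x. Qed.

Lemma overlapE i j : overlap i j = cdom i `&` chart_inv i @^-1` dom j.
Proof.
apply/seteqP; split=> q /=.
  by move=> [x [di dj] <-]; split; [exact: cdom_chart|rewrite chartK].
by move=> [/cdom_inv [di qE] dj]; exists (chart_inv i q).
Qed.

Lemma overlap_open i j : open (overlap i j).
Proof.
rewrite overlapE; have oi := @image_open _ _ M i.
have ci := @chart_inv_continuous _ _ M i; rewrite (continuous_open_subspace _ oi) in ci.
by move/(continuous_inP _ oi): ci; apply; exact: dom_open.
Qed.

Lemma chart_overlap i j x : dom i x -> dom j x -> overlap i j (chart i x).
Proof. by move=> di dj; exists x. Qed.

Lemma overlap_near i j x : dom i x -> dom j x ->
  \forall q \near chart i x, overlap i j q.
Proof.
move=> di dj; apply: open_nbhs_nbhs; split; first exact: (@overlap_open i j).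
exact: chart_overlap.
Qed.

Lemma overlap_dom i j q : overlap i j q ->
  [/\ dom i (chart_inv i q), dom j (chart_inv i q) & chart i (chart_inv i q) = q].
Proof. by move=> [x [di dj] <-]; rewrite chartK. Qed.

Lemma trans_smooth i j a : smooth_on (overlap i j) (fun q => trans i j q 0 a).
Proof. exact: transition_smooth. Qed.

Lemma trans_diff i j x : dom i x -> dom j x -> differentiable (trans i j) (chart i x).
Proof.
move=> di dj; apply: differentiable_rV => c.
apply: (smooth_differentiable (@overlap_open i j)); first exact: chart_overlap.
exact: trans_smooth.
Qed.

Definition tjac i j q : 'M[R]_m := jacobian (trans i j) q.

Lemma tjac_smooth i j a b : smooth_on (overlap i j) (fun q => tjac i j q a b).
Proof.
apply: (smooth_ext (@overlap_open i j) _ (smooth_derive (delta_mx 0 a) (@trans_smooth i j b))).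
move=> q [x [di dj] <-]; rewrite /tjac.
exact: jacobian_entry (trans_diff di dj).
Qed.

Lemma tjac_comp i j k x : dom i x -> dom j x -> dom k x ->
  tjac i k (chart i x) = tjac i j (chart i x) *m tjac j k (chart j x).
Proof.
move=> di dj dk.
have E : trans i j (chart i x) = chart j x by rewrite /trans /= chartK.
have dij := trans_diff di dj; have djk := trans_diff dj dk.
rewrite -E in djk; apply: etrans (_ : _ = jacobian (trans j k \o trans i j) (chart i x)) _.
  apply: jacobian_near; first exact: trans_diff.
    exact: differentiable_comp.
  apply: filterS (overlap_near di dj) => q /overlap_dom [_ dj' _].
  by rewrite /trans /= chartK.
by apply: etrans (jacobian_comp dij djk) _; rewrite E.
Qed.

Lemma tjac_id i x : dom i x -> tjac i i (chart i x) = 1%:M.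
Proof.
move=> di; rewrite -(jacobian_id (chart i x)); apply: jacobian_near.
- exact: trans_diff.
- exact: (@ex_diff _ _ _ _ _ id id).
- by apply: filterS (overlap_near di di) => q /overlap_dom [].
Qed.

Lemma tjacK i j x : dom i x -> dom j x ->
  tjac i j (chart i x) *m tjac j i (chart j x) = 1%:M.
Proof. by move=> di dj; rewrite -tjac_comp // tjac_id. Qed.

Lemma of_chartE i x : of_chart i x = tjac i (chart_at x) (chart i x).
Proof. by []. Qed.
Lemma to_chartE i x : to_chart i x = tjac (chart_at x) i (chart (chart_at x) x).
Proof. by []. Qed.

Lemma of_to_chart i x : dom i x -> of_chart i x *m to_chart i x = 1%:M.
Proof. by move=> di; rewrite of_chartE to_chartE tjacK //; exact: mem_chart_at. Qed.
Lemma to_of_chart i x : dom i x -> to_chart i x *m of_chart i x = 1%:M.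
Proof. by move=> di; rewrite of_chartE to_chartE tjacK //; exact: mem_chart_at. Qed.
Lemma of_chart_at x : of_chart (chart_at x) x = 1%:M.
Proof. by rewrite of_chartE tjac_id //; exact: mem_chart_at. Qed.
Lemma to_chart_at x : to_chart (chart_at x) x = 1%:M.
Proof. by rewrite to_chartE tjac_id //; exact: mem_chart_at. Qed.

Lemma of_chart_trans i j x : dom i x -> dom j x ->
  of_chart i x = tjac i j (chart i x) *m of_chart j x.
Proof. by move=> di dj; rewrite !of_chartE -tjac_comp //; exact: mem_chart_at. Qed.

Lemma of_to_trans i j x : dom i x -> dom j x ->
  of_chart i x *m to_chart j x = tjac i j (chart i x).
Proof. by move=> di dj; rewrite of_chartE to_chartE -tjac_comp //; exact: mem_chart_at. Qed.

End Charts.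

(** * Pull-back and exterior derivative in a chart *)

Section Pullback.
Variables (R : realType) (m : nat).
Local Notation C := R[i].
Local Notation V := 'rV[R]_m.
Local Notation exform := (exform R m).
Implicit Types (w : exform) (s t : seq V) (u v : V) (G : 'M[R]_m) (p q : V).

Local Notation ex a := (delta_mx 0 a : V).
Local Notation dx a := (delta_mx 0 a : 'rV[C]_m).

Definition push G s : seq V := [seq v *m G | v <- s].

Lemma exform_push G w : is_exform w -> is_exform (fun s => w (push G s)).
Proof.
move=> [ml alt]; split=> [s1 s2 a u v|s1 s2 s3 v]; rewrite /push.
  by rewrite !map_cat /= mulmxDl -scalemxAl ml.
by rewrite map_cat /= map_cat /= alt.
Qed.

Lemma exform_expand w u t : is_exform w ->
  w (u :: t) = \sum_c (u 0 c)%:C%C * w (ex c :: t).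
Proof.
move=> [ml _].
have Z : w ((0 : V) :: t) = 0.
  have := ml [::] t (-1) 0 0; rewrite /= scaler0 addr0 => {1}->.
  by rewrite rmorphN rmorph1 mulN1r addNr.
rewrite {1}[u]row_sum_delta; elim: (index_enum _) => [|c r IH]; first by rewrite !big_nil.
by rewrite !big_cons -IH; exact: (ml [::]).
Qed.

Lemma covec_dx a v : covec (dx a) v = (v 0 a)%:C%C.
Proof.
rewrite covecE (bigD1 a) //= big1 => [|b /negbTE ba]; rewrite mxE eqxx /=.
  by rewrite eqxx mulr1 addr0.
by rewrite ba mulr0.
Qed.

Definition dirderiv v (F : V -> exform) p : exform := fun s => cderive v (F^~ s) p.

Definition dE (F : V -> exform) p : exform := fun s =>
  \sum_(j < size s) (-1) ^+ j * cderive (nth 0 s j) (F^~ (Defs.del j s)) p.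

Lemma dE_wedge F p s : (forall t, cdiff (F^~ t) p) ->
  dE F p s = \sum_a wedge1 (dx a) (dirderiv (ex a) F p) s.
Proof.
move=> dF; rewrite /dE /wedge1 exchange_big; apply: eq_bigr => j _ /=.
rewrite cderive_coordE // mulr_sumr; apply: eq_bigr => a _.
by rewrite -[(map_mx _ _ *m _) 0 0]/(covec (dx a) _) covec_dx mulrA.
Qed.

Lemma exform_dirderiv v F p : (forall q, is_exform (F q)) -> (forall t, cdiff (F^~ t) p) ->
  is_exform (dirderiv v F p).
Proof.
move=> eF dF; split=> [s1 s2 a x y|s1 s2 s3 x]; rewrite /dirderiv.
  under eq_fun do rewrite (eF _).1.
  rewrite cderiveD ?cderiveZ //; exact: cdiffM (cdiff_cst _ _) (dF _).
by under eq_fun do rewrite (eF _).2; exact: cderive_cst.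
Qed.

Lemma exform_dE F p : (forall q, is_exform (F q)) -> (forall t, cdiff (F^~ t) p) ->
  is_exform (dE F p).
Proof.
move=> eF dF; have -> : dE F p = fun s => \sum_a wedge1 (dx a) (dirderiv (ex a) F p) s.
  by apply/funext => s; exact: dE_wedge.
by apply: exform_sum => a _; apply: exform_wedge1; exact: exform_dirderiv.
Qed.

Lemma dE_near F F' p : (\forall q \near p, F q = F' q) -> dE F p = dE F' p.
Proof.
move=> FF'; apply/funext => s; apply: eq_bigr => j _; congr (_ * _).
by apply: cderive_near; apply: filterS FF' => q ->.
Qed.

Lemma wedge1_sum xi (I : Type) (r : seq I) (P : pred I) (F : I -> exform) s :
  wedge1 xi (fun t => \sum_(i <- r | P i) F i t) s = \sum_(i <- r | P i) wedge1 xi (F i) s.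
Proof.
rewrite /wedge1 exchange_big; apply: eq_bigr => j _ /=.
by rewrite mulr_sumr.
Qed.

Lemma cdiff_wedge1 xi F p s : (forall t, cdiff (F^~ t) p) ->
  cdiff (fun q => wedge1 xi (F q) s) p.
Proof.
by move=> dF; apply: cdiff_sum => j _; apply: cdiffM => //; exact: cdiff_cst.
Qed.

Lemma dirderiv_wedge1 v xi F p s : (forall t, cdiff (F^~ t) p) ->
  cderive v (fun q => wedge1 xi (F q) s) p = wedge1 xi (dirderiv v F p) s.
Proof.
move=> dF; rewrite /wedge1 cderive_sum => [|j _].
  by apply: eq_bigr => j _; rewrite cderiveZ.
by apply: cdiffM => //; exact: cdiff_cst.
Qed.

(** The two wedge products anticommute, while [h] is symmetric. *)
Lemma wedge1_sym (h : 'I_m -> 'I_m -> exform) s :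
  (forall a b t, h a b t = h b a t) ->
  \sum_a \sum_b wedge1 (dx a) (wedge1 (dx b) (h a b)) s = 0.
Proof.
move=> hs; set X := \sum_a _.
have E : X = - X.
  rewrite {1}/X exchange_big -sumrN; apply: eq_bigr => a _ /=.
  rewrite -sumrN; apply: eq_bigr => b _.
  have -> : h b a = h a b by apply/funext => t; exact: hs.
  by apply/eqP; rewrite -addr_eq0 wedge1_anticomm.
have /eqP := E; rewrite -subr_eq0 opprK -mulr2n -mulr_natr mulf_eq0 pnatr_eq0 orbF.
by move=> /eqP.
Qed.

(** The second derivatives are symmetric in the two directions, so [wedge1_sym]
    applies. *)
Lemma dE_dE F p (W : set V) : open W -> W p -> (forall t, csmooth_on W (F^~ t)) ->
  forall s, dE (dE F) p s = 0.
Proof.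
move=> oW Wp sF s.
have dF q t : W q -> cdiff (F^~ t) q by move=> Wq; exact: csmooth_cdiff oW Wq (sF t).
have dF1 a t : cdiff (fun q => dirderiv (ex a) F q t) p.
  exact: csmooth_cdiff oW Wp (csmooth_derive (ex a) (sF t)).
pose F1 q : exform := fun t => \sum_a wedge1 (dx a) (dirderiv (ex a) F q) t.
have nearF1 : \forall q \near p, dE F q = F1 q.
  apply: filterS (open_nbhs_nbhs (conj oW Wp)) => q Wq.
  by apply/funext => t; apply: dE_wedge => t'; exact: dF.
rewrite (dE_near nearF1) dE_wedge => [|t]; last first.
  by apply: cdiff_sum => a _; exact: cdiff_wedge1.
rewrite -[RHS](@wedge1_sym (fun a b => dirderiv (ex a) (dirderiv (ex b) F) p) s) => [|a b t].
  apply: eq_bigr => a _; rewrite -wedge1_sum; congr (wedge1 _ _ s); apply/funext => t.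
  rewrite [LHS]cderive_sum; last by move=> b _; exact: cdiff_wedge1.
  by apply: eq_bigr => b _; rewrite dirderiv_wedge1.
exact: cschwarz oW Wp (sF t).
Qed.

End Pullback.

Section LeibnizPullback.
Variables (R : realType) (m : nat).
Local Notation C := R[i].
Local Notation V := 'rV[R]_m.
Local Notation exform := (exform R m).
Implicit Types (s t : seq V) (u v : V) (p q : V).
Local Notation ex a := (delta_mx 0 a : V).
Local Notation dx a := (delta_mx 0 a : 'rV[C]_m).

Lemma wedge1_push (xi : 'rV[C]_m) (G : 'M[R]_m) (w : exform) s :
  wedge1 xi w (push G s) =
  wedge1 (xi *m map_mx (real_complex R) G^T) (fun t => w (push G t)) s.
Proof.
elim: s w => [|v s IH] w; first by rewrite !wedge1_nil.
rewrite /= !wedge1_cons IH; congr (_ * _ - _).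
by rewrite /covec trmx_mul !map_mxM -map_trmx trmxK mulmxA.
Qed.

Lemma cdiff_push (Phi : V -> exform) (G : V -> 'M[R]_m) p s :
  (forall q, is_exform (Phi q)) -> (forall t, cdiff (Phi^~ t) p) ->
  (forall b c, differentiable (fun q => G q b c) p) ->
  cdiff (fun q => Phi q (push (G q) s)) p.
Proof.
move=> eP dP dG; elim: s Phi eP dP => [|x s IH] Phi eP dP; first exact: dP.
have E q : Phi q (push (G q) (x :: s)) =
    \sum_c (\sum_b (x 0 b)%:C%C * (G q b c)%:C%C) * Phi q (ex c :: push (G q) s).
  rewrite /= exform_expand //; apply: eq_bigr => c _; rewrite mxE rmorph_sum.
  by congr (_ * _); apply: eq_bigr => b _; rewrite rmorphM.
apply: cdiff_ext (fun q => esym (E q)) _.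
apply: cdiff_sum => c _; apply: cdiffM.
  apply: cdiff_sum => b _; apply: cdiffM; first exact: cdiff_cst.
  by split; [exact: dG|exact: differentiable_cst].
apply: (IH (fun q t => Phi q (ex c :: t))) => [q|t]; last exact: dP.
exact: exform_cons.
Qed.

Lemma cderive_real v (h : V -> R) p : cderive v (fun q => (h q)%:C%C) p = ('D_v h p)%:C%C.
Proof. by rewrite /cderive derive_cst. Qed.

(** Differentiating the linear map amounts to applying the derivation of the exterior
    algebra given by the derivative of [G], as a sum of contractions followed by
    wedge products. *)
Lemma dirderiv_push (Phi : V -> exform) (G : V -> 'M[R]_m) v p s :
  (forall q, is_exform (Phi q)) -> (forall t, cdiff (Phi^~ t) p) ->
  (forall b c, differentiable (fun q => G q b c) p) ->
  cderive v (fun q => Phi q (push (G q) s)) p =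
  dirderiv v Phi p (push (G p) s) +
  \sum_b \sum_c ('D_v (fun q => G q b c) p)%:C%C *
     wedge1 (dx b) (fun t => Phi p (ex c :: push (G p) t)) s.
Proof.
move=> eP dP dG; elim: s Phi eP dP => [|x s IH] Phi eP dP.
  rewrite [X in _ + X]big1 ?addr0 // => b _; apply: big1 => c _.
  by rewrite wedge1_nil mulr0.
have dGC b c : cdiff (fun q => (G q b c)%:C%C) p.
  by split; [exact: dG|exact: differentiable_cst].
have ePc c q : is_exform (fun t => Phi q (ex c :: t)) by exact: exform_cons.
have E q : Phi q (push (G q) (x :: s)) =
    \sum_c (\sum_b (x 0 b)%:C%C * (G q b c)%:C%C) * Phi q (ex c :: push (G q) s).
  rewrite /= exform_expand //; apply: eq_bigr => c _; rewrite mxE rmorph_sum.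
  by congr (_ * _); apply: eq_bigr => b _; rewrite rmorphM.
have dxG c : cdiff (fun q => \sum_b (x 0 b)%:C%C * (G q b c)%:C%C) p.
  by apply: cdiff_sum => b _; apply: cdiffM; [exact: cdiff_cst|exact: dGC].
have dPc c : cdiff (fun q => Phi q (ex c :: push (G q) s)) p.
  exact: (@cdiff_push (fun q t => Phi q (ex c :: t))).
apply: etrans (congr1 (fun f => cderive v f p) (funext E)) _.
rewrite cderive_sum => [|c _]; last exact: cdiffM.
under eq_bigr => c _.
  rewrite cderiveM // (IH (fun q t => Phi q (ex c :: t))) // cderive_sum; last first.
    by move=> b _; apply: cdiffM; [exact: cdiff_cst|exact: dGC].
  under eq_bigr => b _ do rewrite cderiveZ // cderive_real.
  over.
rewrite big_split /= addrC; under eq_bigr do rewrite mulrDr.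
rewrite big_split /= -addrA; congr (_ + _).
  have eD : is_exform (dirderiv v Phi p) by exact: exform_dirderiv.
  rewrite (exform_expand _ _ eD); apply: eq_bigr => c _; rewrite mxE rmorph_sum.
  by congr (_ * _); apply: eq_bigr => b _; rewrite rmorphM.
under [RHS]eq_bigr => b _ do under eq_bigr => c _ do rewrite wedge1_cons covec_dx mulrBr.
under [RHS]eq_bigr do rewrite sumrB.
rewrite sumrB addrC; congr (_ + _).
  rewrite exchange_big; apply: eq_bigr => c _ /=; rewrite mulr_suml.
  by apply: eq_bigr => b _; rewrite mulrCA mulrA.
under eq_bigr do rewrite mulr_sumr; rewrite exchange_big -sumrN; apply: eq_bigr => b _ /=.
under eq_bigr do rewrite mulr_sumr; rewrite exchange_big -sumrN; apply: eq_bigr => c _ /=.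
under eq_bigr do rewrite mulrCA; rewrite -mulr_sumr -mulrN; congr (_ * _).
under eq_bigr do rewrite -wedge1Z; rewrite -wedge1_sum -wedge1N; congr (wedge1 _ _ s).
apply/funext => t; have /= -> := exform_swap (eP p) [::] (ex c) (x *m G p).
rewrite opprK [RHS](exform_expand _ _ (eP p)); apply: eq_bigr => c' _; rewrite mxE rmorph_sum.
by congr (_ * _); apply: eq_bigr => b' _; rewrite rmorphM.
Qed.

(** The second derivatives of [phi] contribute terms that are symmetric in the two
    directions of derivation, and these vanish by [wedge1_sym]. *)
Lemma dE_natural (W : set V) (phi : V -> V) (F F' : V -> exform) p s :
  open W -> W p -> (forall c, smooth_on W (fun q => phi q 0 c)) ->
  (forall q, is_exform (F q)) -> (forall t, cdiff (F^~ t) (phi p)) ->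
  (forall t, cdiff (F'^~ t) p) ->
  (\forall q \near p, F' q = fun t => F (phi q) (push (jacobian phi q) t)) ->
  dE F' p s = dE F (phi p) (push (jacobian phi p) s).
Proof.
move=> oW Wp sphi eF dF dF' FF'.
have dphi q : W q -> differentiable phi q.
  by move=> Wq; apply: differentiable_rV => c; exact: smooth_differentiable oW Wq (sphi c).
have JE b c q : W q -> jacobian phi q b c = 'D_(ex b) (fun q' => phi q' 0 c) q.
  by move=> Wq; exact: jacobian_entry (dphi q Wq).
have sJ b c : smooth_on W (fun q => jacobian phi q b c).
  by apply: (smooth_ext oW _ (smooth_derive (ex b) (sphi c))) => q Wq; exact: JE.
have dJ b c : differentiable (fun q => jacobian phi q b c) p.
  exact: smooth_differentiable oW Wp (sJ b c).
have dFphi t : cdiff (fun q => F (phi q) t) p by exact: cdiff_comp (dphi p Wp) (dF t).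
pose H a b c : C := ('D_(ex a) (fun q => jacobian phi q b c) p)%:C%C.
have Hsym a b c : H a b c = H b a c.
  rewrite /H; congr (_%:C)%C.
  rewrite (open_derive_eq (ex a) oW Wp (JE b c)) (open_derive_eq (ex b) oW Wp (JE a c)).
  exact: schwarz oW Wp (sphi c).
set G := jacobian phi p.
pose Psi c : exform := fun t => F (phi p) (ex c :: push G t).
have derivF' a t : dirderiv (ex a) F' p t =
    \sum_c (G a c)%:C%C * dirderiv (ex c) F (phi p) (push G t) +
    \sum_b wedge1 (dx b) (fun t' => \sum_c H a b c * Psi c t') t.
  have -> : dirderiv (ex a) F' p t =
      cderive (ex a) (fun q => F (phi q) (push (jacobian phi q) t)) p.
    by apply: cderive_near; apply: filterS FF' => q ->.
  rewrite (@dirderiv_push (fun q => F (phi q))) //; congr (_ + _).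
    rewrite /dirderiv -[LHS]/(cderive (ex a) ((F^~ (push G t)) \o phi) p).
    rewrite cderive_chain //; last exact: dphi.
    rewrite cderive_coordE //; apply: eq_bigr => c _; congr (_%:C%C * _).
    by rewrite deriveEjacobian -?rowE ?mxE //; exact: dphi.
  by apply: eq_bigr => b _; rewrite wedge1_sum; apply: eq_bigr => c _; rewrite wedge1Z.
rewrite !dE_wedge //.
have -> : \sum_a wedge1 (dx a) (dirderiv (ex a) F' p) s =
    \sum_a wedge1 (dx a) (fun t =>
       \sum_c (G a c)%:C%C * dirderiv (ex c) F (phi p) (push G t)) s +
    \sum_a \sum_b wedge1 (dx a) (wedge1 (dx b) (fun t' => \sum_c H a b c * Psi c t')) s.
  rewrite -big_split; apply: eq_bigr => a _ /=.
  by rewrite -wedge1_sum -wedge1D; congr (wedge1 _ _ s); apply/funext => t.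
rewrite wedge1_sym ?addr0 => [|a b t]; last first.
  by apply: eq_bigr => c _; rewrite Hsym.
under eq_bigr do rewrite wedge1_sum; rewrite exchange_big; apply: eq_bigr => c _ /=.
rewrite wedge1_push.
have -> : dx c *m map_mx (real_complex R) G^T = \sum_a (G a c)%:C%C *: dx a.
  by rewrite [LHS]row_sum_delta; apply: eq_bigr => a _; rewrite -rowE !mxE.
set Y := fun t => dirderiv _ _ _ _.
elim: (index_enum _) => [|a r IH].
  by rewrite !big_nil /wedge1 big1 // => j _; rewrite trmx0 mulmx0 mxE mulr0 mul0r.
by rewrite !big_cons wedge1_linl IH wedge1Z.
Qed.

End LeibnizPullback.

(** * Differential forms on the manifold *)

Section ManifoldForms.
Variables (R : realType) (m : nat) (M : smooth_manifold R m).
Local Notation C := R[i].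
Local Notation V := 'rV[R]_m.
Local Notation rawform := (rawform M).
Local Notation Omega := (@Omega R m M).
Local Notation d := (@d R m M).
Implicit Types (i j k : chart_index M) (x : M) (q : V) (w : rawform) (s : seq V).

Lemma push_mul (A B : 'M[R]_m) s : push (A *m B) s = push B (push A s).
Proof. by rewrite /push -map_comp; apply: eq_map => v /=; rewrite mulmxA. Qed.
Lemma push1 s : push 1%:M s = s.
Proof. by rewrite /push (eq_map (fun v => mulmx1 v)) map_id. Qed.

Lemma exform_chart i w : (forall x, is_exform (w x)) ->
  forall q, is_exform (form_in_chart i w q).
Proof. by move=> ew q; exact: exform_push. Qed.

Lemma form_in_chartE i w x s : dom i x ->
  form_in_chart i w (chart i x) s = w x (push (of_chart i x) s).
Proof. by move=> di; rewrite /form_in_chart chartK. Qed.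

Lemma form_in_chart_at w x : form_in_chart (chart_at x) w (chart (chart_at x) x) = w x.
Proof.
apply/funext => s; rewrite form_in_chartE; last exact: mem_chart_at.
by rewrite of_chart_at push1.
Qed.

Lemma form_in_chart_trans i j w x s : dom i x -> dom j x ->
  form_in_chart i w (chart i x) s =
  form_in_chart j w (chart j x) (push (tjac i j (chart i x)) s).
Proof.
by move=> di dj; rewrite !form_in_chartE // (of_chart_trans di dj) push_mul.
Qed.

Lemma Omega_exform w : Omega w -> forall x, is_exform (w x).
Proof. by case. Qed.

Lemma Omega_csmooth i w s : Omega w -> csmooth_on (cdom i) ((form_in_chart i w)^~ s).
Proof. by case=> _ /(_ i s). Qed.

Lemma cdom_open i : open (cdom i).
Proof. exact: (@image_open _ _ M i). Qed.

Lemma Omega_cdiff i w q s : Omega w -> cdom i q -> cdiff ((form_in_chart i w)^~ s) q.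
Proof. by move=> Ow dq; exact: csmooth_cdiff (@cdom_open i) dq (Omega_csmooth i s Ow). Qed.

Lemma d_dE w x : d w x = dE (form_in_chart (chart_at x) w) (chart (chart_at x) x).
Proof. by []. Qed.

(** The value of [d w] at a point is computed in one chart around that point;
    naturality makes the same formula valid in all charts. *)
Lemma d_in_chart i w q : Omega w -> cdom i q ->
  form_in_chart i (d w) q = dE (form_in_chart i w) q.
Proof.
move=> Ow [x di <-]; apply/funext => s; rewrite form_in_chartE // d_dE of_chartE.
set k := chart_at x; have dk : dom k x by exact: mem_chart_at.
have E : trans i k (chart i x) = chart k x by rewrite /trans /= chartK.
rewrite -E; apply: esym; apply: (@dE_natural _ _ (overlap i k)).
- exact: (@overlap_open _ _ _ i k).
- exact: chart_overlap.
- by move=> c; exact: trans_smooth.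
- by apply: exform_chart; exact: Omega_exform.
- by move=> t; rewrite E; apply: Omega_cdiff => //; exact: cdom_chart.
- by move=> t; apply: Omega_cdiff => //; exact: cdom_chart.
- apply: filterS (overlap_near di dk) => q' [y [di' dk'] <-].
  apply/funext => t; rewrite (form_in_chart_trans w t di' dk') /trans /= chartK //.
Qed.

Lemma Omega_d w : Omega w -> Omega (d w).
Proof.
move=> Ow; split=> [x|i s].
  rewrite d_dE; apply: exform_dE => [q|t]; first by apply: exform_chart; exact: Omega_exform.
  by apply: Omega_cdiff => //; apply: cdom_chart; exact: mem_chart_at.
apply: (csmooth_ext (@cdom_open i) (fun q dq => congr1 (fun f => f s) (d_in_chart Ow dq))).
apply: csmooth_sum => [|j _]; first exact: cdom_open.
apply: csmoothM; [exact: cdom_open|exact: csmooth_cst (@cdom_open i)|].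
exact: csmooth_derive (Omega_csmooth i _ Ow).
Qed.

Lemma d_d w : Omega w -> d (d w) = 0.
Proof.
move=> Ow; apply/funext => x; apply/funext => s; rewrite d_dE.
set k := chart_at x; have dk : dom k x by exact: mem_chart_at.
have -> : dE (form_in_chart k (d w)) (chart k x) = dE (dE (form_in_chart k w)) (chart k x).
  apply: dE_near; apply: filterS (overlap_near dk dk) => q [y [dy _] <-].
  by apply: d_in_chart => //; exact: cdom_chart.
apply: (dE_dE (@cdom_open k)); first exact: cdom_chart.
by move=> t; exact: Omega_csmooth.
Qed.

Definition rscale (c : C) w : rawform := fun x s => c * w x s.

Lemma Omega_add w w' : Omega w -> Omega w' -> Omega (w + w').
Proof.
move=> Ow Ow'; split=> [x|i s]; first exact: exformD (Omega_exform Ow x) (Omega_exform Ow' x).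
exact: csmoothD (@cdom_open i) (Omega_csmooth i s Ow) (Omega_csmooth i s Ow').
Qed.

Lemma Omega_scale c w : Omega w -> Omega (rscale c w).
Proof.
move=> Ow; split=> [x|i s]; first exact: exformZ (Omega_exform Ow x).
have oi := @cdom_open i.
exact: csmoothM oi (csmooth_cst c oi) (Omega_csmooth i s Ow).
Qed.

Lemma Omega0 : Omega 0.
Proof.
split=> [x|i s]; first exact: exform0.
exact: csmooth_cst (@cdom_open i).
Qed.

Lemma d_add w w' : Omega w -> Omega w' -> d (w + w') = d w + d w'.
Proof.
move=> Ow Ow'; apply/funext => x; apply/funext => s.
have dk : cdom (chart_at x) (chart (chart_at x) x) by apply: cdom_chart; exact: mem_chart_at.
rewrite -[RHS]/(d w x s + d w' x s) !d_dE /dE -big_split; apply: eq_bigr => j _ /=.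
rewrite -mulrDr; congr (_ * _).
by apply: cderiveD; exact: Omega_cdiff.
Qed.

Lemma d_scale c w : Omega w -> d (rscale c w) = rscale c (d w).
Proof.
move=> Ow; apply/funext => x; apply/funext => s.
have dk : cdom (chart_at x) (chart (chart_at x) x) by apply: cdom_chart; exact: mem_chart_at.
rewrite -[RHS]/(c * d w x s) !d_dE /dE mulr_sumr; apply: eq_bigr => j _ /=.
rewrite mulrCA; congr (_ * _).
by apply: cderiveZ; exact: Omega_cdiff.
Qed.

(** The spin action on functions that are not bundled with a proof that they are
    forms, for families of functions depending on a point. *)
Definition rspin (K : 'M[C]_(m + m)) (w : exform R m) : exform R m := fun s =>
  \sum_A \sum_B (- 2^-1 * (Smx R m *m K) A B) *
    clifford (delta_mx 0 A) (clifford (delta_mx 0 B) w) s.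

Lemma evform_spin K (w : altform R m) : evform (spin K w) = rspin K (evform w).
Proof.
apply/funext => s; rewrite spinE /quad evform_sum; apply: eq_bigr => A _.
rewrite [row A _]row_sum_delta cl_suml linear_sum evform_sum; apply: eq_bigr => B _.
by rewrite clZ /= cl_scaler evformZ !cl_val !mxE.
Qed.

Lemma clifford_push u (w : exform R m) (G H : 'M[R]_m) s : H *m G = 1%:M ->
  clifford u w (push G s) =
  clifford (u *m map_mx (real_complex R) (block_mx H 0 0 G^T)) (fun t => w (push G t)) s.
Proof.
move=> HG; rewrite /clifford wedge1_push.
have -> : u *m map_mx (real_complex R) (block_mx H 0 0 G^T) =
    row_mx (lsubmx u *m map_mx (real_complex R) H) (rsubmx u *m map_mx (real_complex R) G^T).
  rewrite -{1}[u]hsubmxK map_block_mx !map_mx0 mul_row_block.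
  by rewrite !mulmx0 addr0 add0r.
rewrite row_mxKl row_mxKr; congr (_ + _); rewrite /contract /=.
have re (X : 'rV[C]_m) : map_mx (fun z => complex.Re z) (X *m map_mx (real_complex R) H) *m G =
    map_mx (fun z => complex.Re z) X.
  rewrite -[RHS]mulmx1 -HG mulmxA; congr (_ *m _); apply/rowP => a; rewrite !mxE.
  rewrite (big_morph _ (@complex_ReD R) (erefl : complex.Re (0 : C) = 0)).
  by apply: eq_bigr => b _; rewrite !mxE complex_ReM /= mulr0 subr0.
have im (X : 'rV[C]_m) : map_mx (fun z => complex.Im z) (X *m map_mx (real_complex R) H) *m G =
    map_mx (fun z => complex.Im z) X.
  rewrite -[RHS]mulmx1 -HG mulmxA; congr (_ *m _); apply/rowP => a; rewrite !mxE.
  rewrite (big_morph _ (@complex_ImD R) (erefl : complex.Im (0 : C) = 0)).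
  by apply: eq_bigr => b _; rewrite !mxE complex_ImM /= mulr0 add0r.
by rewrite re im.
Qed.

Definition pullform (G : 'M[R]_m) (w : altform R m) : altform R m :=
  AltForm (exform_push G (evformP w)).

Lemma pullform_val G (w : altform R m) s : evform (pullform G w) s = evform w (push G s).
Proof. by []. Qed.

Lemma pullform_cl u G H (w : altform R m) : H *m G = 1%:M ->
  pullform G (cl u w) =
  cl (u *m map_mx (real_complex R) (block_mx H 0 0 G^T)) (pullform G w).
Proof.
move=> HG; apply: evform_eq => s.
by rewrite pullform_val !cl_val (clifford_push _ _ _ HG).
Qed.

Lemma pullform_sum G (I : Type) (r : seq I) (P : pred I) (F : I -> altform R m) :
  pullform G (\sum_(i <- r | P i) F i) = \sum_(i <- r | P i) pullform G (F i).
Proof. by apply: evform_eq => s; rewrite pullform_val !evform_sum. Qed.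

Lemma pullform_spin K G H (w : altform R m) : H *m G = 1%:M ->
  pullform G (spin K w) =
  spin (map_mx (real_complex R) (block_mx G 0 0 H^T) *m K *m
        map_mx (real_complex R) (block_mx H 0 0 G^T)) (pullform G w).
Proof.
move=> HG; rewrite !spinE /quad pullform_sum.
set T := map_mx _ (block_mx H 0 0 G^T); set T' := map_mx _ _.
under eq_bigr => A _ do rewrite !(pullform_cl _ _ HG) -/T -!rowE -row_mul.
rewrite quadE; congr (quad _ _); rewrite -scalemxAl -scalemxAr; congr (_ *: _).
rewrite !mulmxA; do 2 congr (_ *m _).
rewrite /T /T' /Smx !map_block_mx !map_mx0 tr_block_mx !trmx0 !mulmx_block.
by rewrite !mul0mx !mulmx0 !mul1mx !mulmx1 !addr0 !add0r -!map_trmx trmxK.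
Qed.

Variable J : M -> 'M[R]_(m + m).
Hypothesis J_smooth : smooth_endo J.

Definition Jmx x : 'M[C]_(m + m) := map_mx (real_complex R) (J x).
Definition Jchart_real i q : 'M[R]_(m + m) :=
  let x := chart_inv i q in of_chart_gen i x *m J x *m to_chart_gen i x.
Definition Jchart i q : 'M[C]_(m + m) := map_mx (real_complex R) (Jchart_real i q).

Definition spinJ w : rawform := fun x => rspin (Jmx x) (w x).

Lemma spinJ_in_chart i w q : (forall x, is_exform (w x)) -> cdom i q ->
  form_in_chart i (spinJ w) q = rspin (Jchart i q) (form_in_chart i w q).
Proof.
move=> ew /cdom_inv [di _]; apply/funext => s.
rewrite /form_in_chart /spinJ; set x := chart_inv i q.
have e := @pullform_spin (Jmx x) _ _ (AltForm (ew x)) (to_of_chart di).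
have := congr1 (fun f => evform f s) e; rewrite pullform_val !evform_spin => ->.
congr (rspin _ _ s); rewrite /Jchart /Jchart_real /= -/x !map_mxM.
by rewrite /of_chart_gen /to_chart_gen.
Qed.

Lemma csmooth_clifford (W : set V) g (F : V -> exform R m) s : open W ->
  (forall t, csmooth_on W (F^~ t)) -> csmooth_on W (fun q => clifford g (F q) s).
Proof.
move=> oW sF; apply: csmoothD => //.
  apply: csmoothD => //; apply: csmoothM => //; exact: csmooth_cst.
apply: csmooth_sum => // j _; apply: csmoothM => //; exact: csmooth_cst.
Qed.

Lemma Jchart_smooth i a b : csmooth_on (cdom i) (fun q => Jchart i q a b).
Proof.
have sJ : smooth_on (cdom i) (fun q => Jchart_real i q a b) by exact: J_smooth.
apply: csmooth_ext (@cdom_open i) _ (csmooth_real (@cdom_open i) sJ).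
by move=> q _; rewrite mxE.
Qed.

Lemma csmooth_rspin (W : set V) (K : V -> 'M[C]_(m + m)) (F : V -> exform R m) s : open W ->
  (forall a b, csmooth_on W (fun q => K q a b)) ->
  (forall t, csmooth_on W (F^~ t)) -> csmooth_on W (fun q => rspin (K q) (F q) s).
Proof.
move=> oW sK sF; apply: csmooth_sum => // A _; apply: csmooth_sum => // B _.
apply: csmoothM => //; last first.
  by apply: csmooth_clifford => // t; exact: csmooth_clifford.
apply: csmoothM => //; first exact: csmooth_cst.
apply: (csmooth_ext oW (fun q _ => mxE _ _ _ _)).
by apply: csmooth_sum => // D _; apply: csmoothM => //; exact: csmooth_cst.
Qed.

Lemma Omega_spinJ w : Omega w -> Omega (spinJ w).
Proof.
move=> Ow; split=> [x|i s].
  rewrite /spinJ -(evform_spin _ (AltForm (Omega_exform Ow x))).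
  exact: evformP.
apply: (csmooth_ext (@cdom_open i)).
  by move=> q dq; rewrite (spinJ_in_chart (Omega_exform Ow) dq).
apply: csmooth_rspin; first exact: cdom_open.
  by move=> a b; exact: Jchart_smooth.
by move=> t; exact: Omega_csmooth.
Qed.

End ManifoldForms.

(** * Matrices depending smoothly on a point *)

Section SmoothMatrices.
Variables (R : realType) (m : nat).
Local Notation C := R[i].
Local Notation V := 'rV[R]_m.
Local Notation rc := (real_complex R).
Implicit Types (W : set V) (p v : V).

Definition mderive v k l (A : V -> 'M[C]_(k, l)) p : 'M[C]_(k, l) :=
  \matrix_(a, b) cderive v (fun q => A q a b) p.
Definition mdiff k l (A : V -> 'M[C]_(k, l)) p := forall a b, cdiff (fun q => A q a b) p.
Definition msmooth W k l (A : V -> 'M[C]_(k, l)) :=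
  forall a b, csmooth_on W (fun q => A q a b).

Lemma mderiveE v k l (A : V -> 'M[C]_(k, l)) p a b :
  mderive v A p a b = cderive v (fun q => A q a b) p.
Proof. by rewrite mxE. Qed.

Lemma mderive_near v k l (A B : V -> 'M[C]_(k, l)) p :
  (\forall q \near p, A q = B q) -> mderive v A p = mderive v B p.
Proof.
move=> AB; apply/matrixP => a b; rewrite !mxE; apply: cderive_near.
by apply: filterS AB => q ->.
Qed.

Lemma mderive_cst v k l (A : 'M[C]_(k, l)) p : mderive v (fun=> A) p = 0.
Proof. by apply/matrixP => a b; rewrite !mxE cderive_cst. Qed.

Lemma mderiveM v k l r (A : V -> 'M[C]_(k, l)) (B : V -> 'M[C]_(l, r)) p :
  mdiff A p -> mdiff B p ->
  mderive v (fun q => A q *m B q) p = mderive v A p *m B p + A p *m mderive v B p.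
Proof.
move=> dA dB; apply/matrixP => a b; rewrite !mxE.
transitivity (cderive v (fun q => \sum_c A q a c * B q c b) p).
  by apply: (f_equal (fun f => cderive v f p)); apply/funext => q; rewrite mxE.
rewrite cderive_sum => [|c _]; last exact: cdiffM.
rewrite -big_split; apply: eq_bigr => c _ /=; rewrite !mxE.
exact: cderiveM.
Qed.

Lemma mdiff_cst k l (A : 'M[C]_(k, l)) p : mdiff (fun=> A) p.
Proof. by move=> a b; exact: cdiff_cst. Qed.

Lemma mderive_mulr v k l r (A : V -> 'M[C]_(k, l)) (B : 'M[C]_(l, r)) p :
  mdiff A p -> mderive v (fun q => A q *m B) p = mderive v A p *m B.
Proof.
by move=> dA; rewrite (mderiveM v dA (mdiff_cst B p)) mderive_cst mulmx0 addr0.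
Qed.
Lemma mderive_mull v k l r (A : 'M[C]_(k, l)) (B : V -> 'M[C]_(l, r)) p :
  mdiff B p -> mderive v (fun q => A *m B q) p = A *m mderive v B p.
Proof.
by move=> dB; rewrite (mderiveM v (mdiff_cst A p) dB) mderive_cst mul0mx add0r.
Qed.

Lemma mderive_tr v k l (A : V -> 'M[C]_(k, l)) p :
  mderive v (fun q => (A q)^T) p = (mderive v A p)^T.
Proof.
apply/matrixP => a b; rewrite !mxE.
by apply: (f_equal (fun f => cderive v f p)); apply/funext => q; rewrite mxE.
Qed.

Lemma mderive_lin v k l (a : C) (A : V -> 'M[C]_(k, l)) (B : 'M[C]_(k, l)) p :
  mdiff A p -> mderive v (fun q => a *: A q + B) p = a *: mderive v A p.
Proof.
move=> dA; apply/matrixP => c e; rewrite !mxE.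
transitivity (cderive v (fun q => a * A q c e + B c e) p).
  by apply: (f_equal (fun f => cderive v f p)); apply/funext => q; rewrite !mxE.
rewrite cderiveD; [|by apply: cdiffM; [exact: cdiff_cst|exact: dA]|exact: cdiff_cst].
by rewrite cderive_cst addr0; apply: cderiveZ.
Qed.

Lemma msmooth_mdiff W k l (A : V -> 'M[C]_(k, l)) p : open W -> W p ->
  msmooth W A -> mdiff A p.
Proof. by move=> oW Wp sA a b; exact: csmooth_cdiff oW Wp (sA a b). Qed.

Lemma msmooth_ext W k l (A B : V -> 'M[C]_(k, l)) : open W ->
  (forall q, W q -> B q = A q) -> msmooth W A -> msmooth W B.
Proof.
move=> oW AB sA a b; apply: csmooth_ext oW _ (sA a b) => q Wq.
by rewrite AB.
Qed.

Lemma msmooth_cst W k l (A : 'M[C]_(k, l)) : open W -> msmooth W (fun=> A).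
Proof. by move=> oW a b; exact: csmooth_cst. Qed.

Lemma msmoothM W k l r (A : V -> 'M[C]_(k, l)) (B : V -> 'M[C]_(l, r)) : open W ->
  msmooth W A -> msmooth W B -> msmooth W (fun q => A q *m B q).
Proof.
move=> oW sA sB a b.
apply: (csmooth_ext oW (fun q _ => mxE _ _ _ _)).
by apply: csmooth_sum => // c _; exact: csmoothM oW (sA a c) (sB c b).
Qed.

Lemma msmooth_lin W k l (a : C) (A : V -> 'M[C]_(k, l)) (B : 'M[C]_(k, l)) : open W ->
  msmooth W A -> msmooth W (fun q => a *: A q + B).
Proof.
move=> oW sA c e.
apply: (@csmooth_ext _ _ _ (fun q => a * A q c e + B c e)) => // [q _|].
  by rewrite !mxE.
exact: (csmoothD oW (csmoothM oW (csmooth_cst a oW) (sA c e)) (csmooth_cst (B c e) oW)).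
Qed.

Lemma msmooth_block W k1 k2 l1 l2 (A : V -> 'M[R]_(k1, l1)) (B : V -> 'M[R]_(k2, l2)) :
  open W ->
  (forall a b, smooth_on W (fun q => A q a b)) -> (forall a b, smooth_on W (fun q => B q a b)) ->
  msmooth W (fun q => map_mx rc (block_mx (A q) 0 0 (B q))).
Proof.
move=> oW sA sB a b.
apply: (@csmooth_ext _ _ _ (fun q => rc (block_mx (A q) 0 0 (B q) a b))) => // [q _|].
  by rewrite mxE.
apply: csmooth_real => //.
case: (split_ordP a) => a' ->; case: (split_ordP b) => b' ->.
- by under eq_fun do rewrite block_mxEul; exact: sA.
- by under eq_fun do rewrite block_mxEur mxE; exact: smooth_cst.
- by under eq_fun do rewrite block_mxEdl mxE; exact: smooth_cst.
- by under eq_fun do rewrite block_mxEdr; exact: sB.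
Qed.

End SmoothMatrices.

(** * The Courant bracket in terms of matrix derivatives *)

Section CourantBracket.
Variables (R : realType) (m : nat) (M : smooth_manifold R m).
Local Notation C := R[i].
Local Notation V := 'rV[R]_m.
Local Notation cgen := 'rV[C]_(m + m).
Local Notation ex a := (delta_mx 0 a : V).

Lemma bil_sum (u v : cgen) : bil u v =
  \sum_b (u 0 (lshift m b) * v 0 (rshift m b) + u 0 (rshift m b) * v 0 (lshift m b)).
Proof.
rewrite bilE !mxE -big_split; apply: eq_bigr => b _ /=.
by rewrite !mxE.
Qed.

Lemma bil_dxa a (u : cgen) : bil (dxa R a) u = u 0 (lshift m a).
Proof.
rewrite bil_sum (bigD1 a) //= big1 => [|b ba].
  by rewrite addr0 !mxE !eqxx eq_lrshift /= mul0r add0r mul1r.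
by rewrite !mxE eq_lrshift eq_rshift (negbTE ba) !mul0r add0r.
Qed.

Section CourantFormula.
Variables (u v : M -> cgen) (x : M).
Let p := chart (chart_at x) x.
Let U := gen_in_chart (chart_at x) u.
Let W := gen_in_chart (chart_at x) v.
Let DU a := mderive (ex a) U p.
Let DW a := mderive (ex a) W p.
Hypothesis dU : mdiff U p.
Hypothesis dW : mdiff W p.

Lemma courant_coord : courant u v x = row_mx
  (\row_a \sum_b (U p 0 (lshift m b) * DW b 0 (lshift m a) -
                  W p 0 (lshift m b) * DU b 0 (lshift m a)))
  (\row_a (\sum_b U p 0 (lshift m b) * (DW b 0 (rshift m a) - DW a 0 (rshift m b))
           - \sum_b W p 0 (lshift m b) * (DU b 0 (rshift m a) - DU a 0 (rshift m b))
           + 2^-1 * \sum_b (DU a 0 (lshift m b) * W p 0 (rshift m b) +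
                            U p 0 (lshift m b) * DW a 0 (rshift m b) -
                            (DW a 0 (lshift m b) * U p 0 (rshift m b) +
                             W p 0 (lshift m b) * DU a 0 (rshift m b))))).
Proof.
rewrite /courant -/p -/U -/W; rewrite /DU /DW; clear DU DW; clearbody U W p.
have dE (F : V -> cgen) b A : cderive (ex b) (fun q => F q 0 A) p = mderive (ex b) F p 0 A.
  by rewrite mderiveE.
apply: (f_equal2 (fun X Y => row_mx X Y)); apply/rowP => a.
  rewrite [LHS]mxE [RHS]mxE; apply: eq_bigr => b _; rewrite !dE.
  exact: erefl.
rewrite [LHS]mxE [RHS]mxE; apply: (f_equal2 (fun X Y => X + Y)).
  by apply: (f_equal2 (fun X Y => X - Y)); apply: eq_bigr => b _; rewrite !dE.
apply: (f_equal (fun X => 2^-1 * X)).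
have dN (f g : V -> C) : cdiff f p -> cdiff g p ->
    cderive (ex a) (fun q => f q - g q) p = cderive (ex a) f p - cderive (ex a) g p.
  move=> df dg; transitivity (cderive (ex a) (fun q => f q + -1 * g q) p).
    by apply: (f_equal (fun h => cderive (ex a) h p)); apply/funext => q; rewrite mulN1r.
  rewrite cderiveD //; last by apply: cdiffM => //; exact: cdiff_cst.
  by rewrite cderiveZ // mulN1r.
have dB (f g : V -> C) : cdiff f p -> cdiff g p -> cdiff (fun q => f q - g q) p.
  move=> df dg; apply: (@cdiff_ext _ _ (fun q => f q + -1 * g q)) => [q|].
    by rewrite mulN1r.
  by apply: cdiffD => //; apply: cdiffM => //; exact: cdiff_cst.
rewrite cderive_sum => [|b _]; last first.
  by apply: dB; (apply: cdiffM; [exact: dU|exact: dW]) || (apply: cdiffM; [exact: dW|exact: dU]).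
apply: eq_bigr => b _.
rewrite dN; [|apply: cdiffM; [exact: dU|exact: dW]|apply: cdiffM; [exact: dW|exact: dU]].
rewrite (cderiveM _ (dU 0 (lshift m b)) (dW 0 (rshift m b))).
rewrite (cderiveM _ (dW 0 (lshift m b)) (dU 0 (rshift m b))).
by rewrite !dE.
Qed.

(** The derivative of the pairing and the two other terms of the covector part combine
    into an expression in [bil]. *)
Lemma courantE :
  courant u v x = \sum_a (bil (dxa R a) (U p) *: DW a - bil (dxa R a) (W p) *: DU a +
    2^-1 * (bil (DU a) (W p) - bil (U p) (DW a)) *: dxa R a).
Proof.
rewrite courant_coord; clearbody DU DW; move: (U p) (W p) => Up Wp.
apply/rowP => A; rewrite [RHS]summxE.
case: (split_ordP A) => a ->.
  rewrite row_mxEl mxE; apply: eq_bigr => b _; rewrite !bil_dxa !mxE.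
  by rewrite eq_lrshift andbF mulr0 addr0.
rewrite row_mxEr mxE.
have -> : \sum_(i < m) (bil (dxa R i) Up *: DW i - bil (dxa R i) Wp *: DU i +
   2^-1 * (bil (DU i) Wp - bil Up (DW i)) *: dxa R i) 0 (rshift m a) =
   \sum_b (Up 0 (lshift m b) * DW b 0 (rshift m a) - Wp 0 (lshift m b) * DU b 0 (rshift m a)) +
   2^-1 * (bil (DU a) Wp - bil Up (DW a)).
  transitivity (\sum_b (Up 0 (lshift m b) * DW b 0 (rshift m a) -
      Wp 0 (lshift m b) * DU b 0 (rshift m a)) +
    \sum_b (2^-1 * (bil (DU b) Wp - bil Up (DW b)) * (b == a)%:R)).
    rewrite -big_split; apply: eq_bigr => b _ /=.
    by rewrite !bil_dxa !mxE eqxx eq_rshift eq_sym.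
  congr (_ + _); rewrite (bigD1 a) //= eqxx mulr1 big1 ?addr0 // => b /negbTE ->.
  by rewrite mulr0.
rewrite !bil_sum -!sumrB !mulr_sumr -!big_split /=; apply: eq_bigr => b _.
move: (Up 0 _) (Up 0 _) (Wp 0 _) (Wp 0 _) (DU a 0 _) (DU a 0 _) (DW a 0 _) (DW a 0 _).
move=> a1 a2 a3 a4 a5 a6 a7 a8; move: (DU b 0 _) (DW b 0 _) => b1 b2; by field.
Qed.

End CourantFormula.
End CourantBracket.

(** * The generalized complex structure in a chart *)

Section ChartStructure.
Variables (R : realType) (n : nat) (M : smooth_manifold R n.*2).
Variable J : gen_complex M.
Local Notation m := n.*2.
Local Notation C := R[i].
Local Notation V := 'rV[R]_m.
Local Notation cgen := 'rV[C]_(m + m).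
Local Notation ii := ('i%C : C).
Local Notation rc := (real_complex R).
Local Notation ex a := (delta_mx 0 a : V).
Implicit Types (i j : chart_index M) (x y : M) (q : V) (u v : cgen).

Definition Sreal : 'M[R]_(m + m) := block_mx 0 1%:M 1%:M 0.

Lemma Smx_map : map_mx rc Sreal = Smx R m.
Proof. by rewrite /Sreal /Smx map_block_mx !map_mx0 !map_mx1. Qed.

Lemma pairingE (u v : 'rV[R]_(m + m)) : pairing u v = 2^-1 * (u *m Sreal *m v^T) 0 0.
Proof.
rewrite /pairing; congr (_ * _); rewrite -{3}[u]hsubmxK -{3}[v]hsubmxK /Sreal.
rewrite mul_row_block !mulmx0 !mulmx1 add0r addr0 tr_row_mx mul_row_col [RHS]mxE.
congr (_ + _); rewrite !mxE; apply: eq_bigr => a _; rewrite !mxE; exact: mulrC.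
Qed.

Lemma J_orthogonal x : J x *m Sreal *m (J x)^T = Sreal.
Proof.
have E (A : 'M[R]_(m + m)) a b :
    A a b = ((delta_mx 0 a : 'rV_(m + m)) *m A *m (delta_mx 0 b : 'rV_(m + m))^T) 0 0.
  by rewrite -rowE trmx_delta -colE !mxE.
apply/matrixP => a b; rewrite !E.
have := gc_orthogonal J x (delta_mx 0 a) (delta_mx 0 b); rewrite !pairingE.
move=> /(mulfI _) <-; last by rewrite invr_eq0 pnatr_eq0.
by rewrite trmx_mul !mulmxA.
Qed.

Lemma J_skew x : J x *m Sreal = - (Sreal *m (J x)^T).
Proof.
have /(congr1 (mulmx (J x))) := J_orthogonal x.
by rewrite !mulmxA gc_sqr !mulNmx mul1mx => <-.
Qed.

Lemma of_to_chart_gen i x : dom i x -> of_chart_gen i x *m to_chart_gen i x = 1%:M.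
Proof.
move=> di; rewrite /of_chart_gen /to_chart_gen mulmx_block !mul0mx !mulmx0 !addr0 add0r.
by rewrite -trmx_mul of_to_chart // trmx1 -scalar_mx_block.
Qed.

Lemma to_of_chart_gen i x : dom i x -> to_chart_gen i x *m of_chart_gen i x = 1%:M.
Proof. by move=> di; apply: mulmx1C; exact: of_to_chart_gen. Qed.

Lemma of_chart_gen_skew i x : of_chart_gen i x *m Sreal = Sreal *m (to_chart_gen i x)^T.
Proof.
rewrite /of_chart_gen /to_chart_gen /Sreal tr_block_mx !trmx0 trmxK !mulmx_block.
by rewrite !mul0mx !mulmx0 !mulmx1 !mul1mx !addr0 !add0r.
Qed.
Lemma to_chart_gen_skew i x : to_chart_gen i x *m Sreal = Sreal *m (of_chart_gen i x)^T.
Proof.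
rewrite /of_chart_gen /to_chart_gen /Sreal tr_block_mx !trmx0 trmxK !mulmx_block.
by rewrite !mul0mx !mulmx0 !mulmx1 !mul1mx !addr0 !add0r.
Qed.

Lemma map_rc_conj k l (A : 'M[R]_(k, l)) : map_mx conjc (map_mx rc A) = map_mx rc A.
Proof. by apply/matrixP => a b; rewrite !mxE conjc_real. Qed.

Lemma map_rc_skew (A : 'M[R]_(m + m)) : A *m Sreal = - (Sreal *m A^T) -> skew (map_mx rc A).
Proof.
by rewrite /skew -Smx_map map_trmx -!map_mxM -map_mxN => ->.
Qed.

Lemma conj_sqr k (A G H : 'M[R]_k) : G *m H = 1%:M -> H *m G = 1%:M -> A *m A = - 1%:M ->
  (G *m A *m H) *m (G *m A *m H) = - 1%:M.
Proof.
move=> GH HG AA; rewrite !mulmxA -(mulmxA (G *m A) H G) HG mulmx1 -(mulmxA G A A) AA.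
by rewrite mulmxN mulmx1 mulNmx GH.
Qed.

Lemma Jchart_sqr i q : cdom i q -> Jchart J i q *m Jchart J i q = - 1%:M.
Proof.
move=> /cdom_inv [di _]; rewrite /Jchart -map_mxM.
have -> : Jchart_real J i q *m Jchart_real J i q = - 1%:M.
  exact: conj_sqr (of_to_chart_gen di) (to_of_chart_gen di) (gc_sqr J _).
by rewrite map_mxN map_mx1.
Qed.

Lemma Jchart_skew i q : skew (Jchart J i q).
Proof.
apply: map_rc_skew; rewrite /Jchart_real /=; set x := chart_inv i q.
have := J_skew x; have := of_chart_gen_skew i x; have := to_chart_gen_skew i x.
move: (J x) (of_chart_gen i x) (to_chart_gen i x) => A G H eH eG eA.
by rewrite -[LHS]mulmxA eH mulmxA -[X in X *m _]mulmxA eA mulmxN mulNmx mulmxA eG !trmx_mul !mulmxA.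
Qed.

Lemma Jchart_at x : Jchart J (chart_at x) (chart (chart_at x) x) = Jmx J x.
Proof.
have dx := mem_chart_at x.
rewrite /Jchart /Jchart_real /Jmx /= chartK // /of_chart_gen /to_chart_gen.
by rewrite of_chart_at to_chart_at trmx1 -scalar_mx_block mul1mx mulmx1.
Qed.

Lemma cdom_at x : cdom (chart_at x) (chart (chart_at x) x).
Proof. by apply: cdom_chart; exact: mem_chart_at. Qed.

Lemma Jmx_sqr x : Jmx J x *m Jmx J x = - 1%:M.
Proof. by rewrite -Jchart_at Jchart_sqr //; exact: cdom_at. Qed.
Lemma Jmx_conj x : map_mx conjc (Jmx J x) = Jmx J x.
Proof. exact: map_rc_conj. Qed.
Lemma Jmx_skew x : skew (Jmx J x).
Proof. by rewrite -Jchart_at; exact: Jchart_skew. Qed.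

Lemma Jchart_msmooth i : msmooth (cdom i) (Jchart J i).
Proof. by move=> a b; apply: Jchart_smooth; exact: gc_smooth. Qed.

Lemma Jchart_mdiff i q : cdom i q -> mdiff (Jchart J i) q.
Proof. by move=> dq; apply: msmooth_mdiff (@cdom_open _ _ _ i) dq (@Jchart_msmooth i). Qed.

Definition dJmx x a : 'M[C]_(m + m) :=
  mderive (ex a) (Jchart J (chart_at x)) (chart (chart_at x) x).

Lemma cdom_near x : \forall q \near chart (chart_at x) x, cdom (chart_at x) q.
Proof.
apply: open_nbhs_nbhs; split; first exact: (@cdom_open _ _ _ (chart_at x)).
exact: cdom_at.
Qed.

(** The next two lemmas differentiate J^2 = -1 and the orthogonality of J. *)
Lemma dJmx_anti x a : Jmx J x *m dJmx x a = - (dJmx x a *m Jmx J x).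
Proof.
set p := chart (chart_at x) x; have dK := Jchart_mdiff (cdom_at x).
have e : mderive (ex a) (fun q => Jchart J (chart_at x) q *m Jchart J (chart_at x) q) p = 0.
  rewrite -(mderive_cst (ex a) (- 1%:M : 'M[C]_(m + m)) p); apply: mderive_near.
  by apply: filterS (cdom_near x) => q; exact: Jchart_sqr.
move/eqP: e; rewrite (mderiveM _ dK dK) -/(dJmx x a) Jchart_at addr_eq0 => /eqP ->.
by rewrite opprK.
Qed.

Lemma dJmx_skew x a : skew (dJmx x a).
Proof.
set p := chart (chart_at x) x; have dK := Jchart_mdiff (cdom_at x).
rewrite /skew /dJmx -(mderive_mulr _ _ dK) -mderive_tr.
have dKt : mdiff (fun q => (Jchart J (chart_at x) q)^T) p.
  move=> b c; apply: (@cdiff_ext _ _ (fun q => Jchart J (chart_at x) q c b)) => [q|].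
    by rewrite [RHS]mxE.
  exact: dK.
rewrite -(mderive_mull _ _ dKt).
have dSKt : mdiff (fun q => Smx R m *m (Jchart J (chart_at x) q)^T) p.
  move=> b c; apply: (@cdiff_ext _ _ (fun q => \sum_e Smx R m b e * (Jchart J (chart_at x) q)^T e c)) => [q|].
    by rewrite [RHS]mxE.
  by apply: cdiff_sum => e _; apply: cdiffM (dKt e c); exact: cdiff_cst.
rewrite -scaleN1r -(mderive_lin _ _ 0 dSKt); apply: mderive_near.
by apply: filterS (cdom_near x) => q _; rewrite addr0 scaleN1r; exact: Jchart_skew.
Qed.

Lemma dJmx_conj x a : map_mx conjc (dJmx x a) = dJmx x a.
Proof.
apply/matrixP => b c; rewrite [LHS]mxE !mderiveE /cderive.
set f := fun q => complex.Im _.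
have -> : f = fun=> 0 by apply/funext => q; rewrite /f mxE.
by rewrite derive_cst /= oppr0.
Qed.

End ChartStructure.

(** * Integrability in terms of the derivatives of J *)

Section Integrability.
Variables (R : realType) (n : nat) (M : smooth_manifold R n.*2).
Variable J : gen_complex M.
Local Notation m := n.*2.
Local Notation C := R[i].
Local Notation V := 'rV[R]_m.
Local Notation cgen := 'rV[C]_(m + m).
Local Notation ii := ('i%C : C).
Local Notation rc := (real_complex R).
Local Notation ex a := (delta_mx 0 a : V).
Implicit Types (i j : chart_index M) (x y : M) (q : V) (u v : cgen).

(** The section of L over a chart whose value at the point y is the L-component of the
   vector with constant coordinates [u] in that chart. *)
Definition Lsec i u : M -> cgen := fun y =>
  u *m projL (Jchart J i (chart i y)) *m map_mx rc (of_chart_gen i y).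

Lemma Lsec_in_L i u y : dom i y -> in_L J y (Lsec i u y).
Proof.
move=> di; have : projL (Jchart J i (chart i y)) *m Jchart J i (chart i y) =
    ii *: projL (Jchart J i (chart i y)).
  by apply: projL_K; apply: Jchart_sqr; exact: cdom_chart.
have eR : of_chart_gen i y *m J y = Jchart_real J i (chart i y) *m of_chart_gen i y.
  rewrite /Jchart_real chartK //; have := to_of_chart_gen di.
  by move: (of_chart_gen i y) (to_chart_gen i y) (J y) => G H A HG; rewrite -[RHS]mulmxA HG mulmx1.
have : map_mx rc (of_chart_gen i y) *m map_mx rc (J y) =
    Jchart J i (chart i y) *m map_mx rc (of_chart_gen i y).
  by rewrite -(map_mxM rc) eR (map_mxM rc).
rewrite /in_L /Lsec; move: (map_mx rc (J y)) (map_mx rc (of_chart_gen i y)) => A G.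
move: (Jchart J i (chart i y)) (projL _) => K P eG eP.
by rewrite -mulmxA eG mulmxA -[X in X *m G]mulmxA eP -scalemxAr -scalemxAl.
Qed.

Lemma Lsec_in_chart i u q : cdom i q ->
  gen_in_chart i (Lsec i u) q = u *m projL (Jchart J i q).
Proof.
move=> /cdom_inv [di e]; rewrite /gen_in_chart /Lsec /= e -mulmxA -map_mxM.
by rewrite of_to_chart_gen // map_mx1 mulmx1.
Qed.

Lemma projL_smooth i u : msmooth (cdom i) (fun q => u *m projL (Jchart J i q)).
Proof.
have oi := @cdom_open _ _ _ i.
apply: (msmoothM oi (msmooth_cst _ oi)).
apply: (@msmooth_ext _ _ _ _ _ (fun q => (- (2^-1 * ii)) *: Jchart J i q + 2^-1 *: 1%:M)) => //.
  by move=> q _; rewrite /projL scalerBr scalerA scaleNr addrC.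
exact: (msmooth_lin _ _ oi (@Jchart_msmooth _ _ _ J i)).
Qed.

Lemma Lsec_in_other_chart i j u q : overlap j i q ->
  gen_in_chart j (Lsec i u) q = u *m projL (Jchart J i (trans j i q)) *m
    map_mx rc (block_mx (tjac i j (trans j i q)) 0 0 (tjac j i q)^T).
Proof.
move=> /overlap_dom [dj di e]; have E1 := of_to_trans di dj.
have E2 := etrans (of_to_trans dj di) (f_equal (tjac j i) e).
have E3 : tjac i j (chart i (chart_inv j q)) = tjac i j (trans j i q) := erefl _.
have E4 : projL (Jchart J i (chart i (chart_inv j q))) = projL (Jchart J i (trans j i q)) := erefl _.
rewrite /gen_in_chart /Lsec /of_chart_gen /to_chart_gen E4 -E2 -E3 -E1.
move: (projL _) (of_chart _ _) (of_chart _ _) (to_chart _ _) (to_chart _ _) => P A B A' B'.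
rewrite -mulmxA -map_mxM; apply: (f_equal (fun T => _ *m map_mx rc T)).
by rewrite mulmx_block !mul0mx !mulmx0 !addr0 add0r trmx_mul.
Qed.

Lemma trans_overlap i j q : overlap j i q -> overlap i j (trans j i q).
Proof. by move=> /overlap_dom [dj di e]; exact: chart_overlap. Qed.

Lemma tjac_trans_smooth i j b c :
  smooth_on (overlap j i) (fun q => tjac i j (trans j i q) b c).
Proof.
have oij := @overlap_open _ _ _ i j.
have sf := csmooth_real oij (@tjac_smooth _ _ _ i j b c).
exact: (proj1 (csmooth_comp (@overlap_open _ _ _ j i) oij (@trans_overlap i j)
  (@trans_smooth _ _ _ j i) sf)).
Qed.

Lemma projL_trans_smooth i j u :
  msmooth (overlap j i) (fun q => u *m projL (Jchart J i (trans j i q))).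
Proof.
move=> a b.
have tr q : overlap j i q -> cdom i (trans j i q).
  by move=> /overlap_dom [_ di _]; exact: cdom_chart.
exact: (csmooth_comp (@overlap_open _ _ _ j i) (@cdom_open _ _ _ i) tr
  (@trans_smooth _ _ _ j i) (@projL_smooth i u a b)).
Qed.

Lemma Lsec_smooth i u : smooth_gen (dom i) (Lsec i u).
Proof.
move=> j a; have oij := @overlap_open _ _ _ j i.
refine (msmooth_ext oij (@Lsec_in_other_chart i j u) _ 0 a).
refine (msmoothM oij (@projL_trans_smooth i j u) (msmooth_block oij (@tjac_trans_smooth i j) _)).
move=> b c; apply: (smooth_ext oij _ (@tjac_smooth _ _ _ j i c b)) => q _.
by rewrite mxE.
Qed.

Lemma Lsec_mderive x u a : inL (Jmx J x) u ->
  let p := chart (chart_at x) x in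
  mderive (ex a) (gen_in_chart (chart_at x) (Lsec (chart_at x) u)) p =
    (- (2^-1 * ii)) *: (u *m dJmx J x a).
Proof.
move=> uL p.
have -> : mderive (ex a) (gen_in_chart (chart_at x) (Lsec (chart_at x) u)) p =
    mderive (ex a) (fun q => u *m projL (Jchart J (chart_at x) q)) p.
  by apply: mderive_near; apply: filterS (cdom_near x) => q; exact: Lsec_in_chart.
have dK := Jchart_mdiff J (cdom_at x).
have -> : (fun q => u *m projL (Jchart J (chart_at x) q)) =
    (fun q => (- (2^-1 * ii)) *: (u *m Jchart J (chart_at x) q) + 2^-1 *: u).
  apply/funext => q; rewrite /projL -scalemxAr mulmxBr mulmx1 -scalemxAr scalerBr scalerA.
  by rewrite scaleNr addrC.
rewrite mderive_lin ?mderive_mull //.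
move=> b c; apply: (@cdiff_ext _ _ (fun q => \sum_e u b e * Jchart J (chart_at x) q e c)) => [q|].
  by rewrite [RHS]mxE.
by apply: cdiff_sum => e _; apply: cdiffM (dK e c); exact: cdiff_cst.
Qed.

Lemma Lsec_at x u : inL (Jmx J x) u ->
  gen_in_chart (chart_at x) (Lsec (chart_at x) u) (chart (chart_at x) x) = u.
Proof.
by move=> uL; rewrite Lsec_in_chart ?Jchart_at ?inL_proj //; exact: cdom_at.
Qed.

Lemma bilZl c u v : bil (c *: u) v = c * bil u v.
Proof. by rewrite /bil -!scalemxAl mxE. Qed.
Lemma bilZr c u v : bil u (c *: v) = c * bil u v.
Proof. by rewrite bilC bilZl bilC. Qed.

(** The derivatives of the projection to L are - i/2 times those of J. *)
Lemma courant_Lsec x u v : inL (Jmx J x) u -> inL (Jmx J x) v ->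
  courant (Lsec (chart_at x) u) (Lsec (chart_at x) v) x =
    (- (2^-1 * ii)) *: bracket_mx (dJmx J x) u v.
Proof.
move=> uL vL; set i := chart_at x.
have dL w : inL (Jmx J x) w -> mdiff (gen_in_chart i (Lsec i w)) (chart i x).
  move=> wL a b; rewrite (ord1 a); have oi := @overlap_open _ _ _ i i.
  exact: (csmooth_cdiff oi (chart_overlap (mem_chart_at x) (mem_chart_at x))
    (@Lsec_smooth i w i b)).
rewrite (courantE (dL u uL) (dL v vL)) (Lsec_at uL) (Lsec_at vL) /bracket_mx scaler_sumr.
apply: eq_bigr => a _; rewrite (Lsec_mderive a uL) (Lsec_mderive a vL) bilZl bilZr.
have -> : bil u (v *m dJmx J x a) = - bil (u *m dJmx J x a) v.
  by rewrite (skew_bil _ _ (@dJmx_skew _ _ _ J x a)) opprK.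
have -> : 2^-1 * (- (2^-1 * ii) * bil (u *m dJmx J x a) v -
    - (2^-1 * ii) * - bil (u *m dJmx J x a) v) = - (2^-1 * ii) * bil (u *m dJmx J x a) v.
  by move: (bil _ v) ii => y k; field.
by rewrite scalerDr scalerBr !scalerA !(mulrC (- (2^-1 * ii))).
Qed.

(** Every vector of L at x is the value of a local section of L, to which
    involutivity applies. *)
Lemma integrable_L x u v : inL (Jmx J x) u -> inL (Jmx J x) v ->
  inL (Jmx J x) (bracket_mx (dJmx J x) u v).
Proof.
move=> uL vL; set i := chart_at x.
have L := @gc_integrable _ _ _ J (dom i) (Lsec i u) (Lsec i v) (dom_open i)
  (@Lsec_smooth i u) (@Lsec_smooth i v) (Lsec_in_L u) (Lsec_in_L v) x (mem_chart_at x).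
move: L; rewrite (courant_Lsec uL vL) /in_L /inL -/(Jmx J x).
rewrite -scalemxAl scalerA (mulrC ii) -scalerA; apply: scalerI.
by rewrite oppr_eq0 mulf_neq0 ?invr_eq0 ?pnatr_eq0 ?ii_neq0.
Qed.

Lemma mconjZ c u : map_mx conjc (c *: u) = conjc c *: map_mx conjc u.
Proof. by apply/rowP => a; rewrite !mxE rmorphM. Qed.
Lemma mconjD u v : map_mx conjc (u + v) = map_mx conjc u + map_mx conjc v.
Proof. by apply/rowP => a; rewrite !mxE rmorphD. Qed.
Lemma mconjN u : map_mx conjc (- u) = - map_mx conjc u.
Proof. by apply/rowP => a; rewrite !mxE rmorphN. Qed.
Lemma mconjM k l r (A : 'M[C]_(k, l)) (B : 'M[C]_(l, r)) :
  map_mx conjc (A *m B) = map_mx conjc A *m map_mx conjc B.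
Proof. exact: map_mxM. Qed.
Lemma mconjK u : map_mx conjc (map_mx conjc u) = u.
Proof. by apply/rowP => a; rewrite !mxE conjcK. Qed.

Lemma inLb_conj (K : 'M[C]_(m + m)) u : map_mx conjc K = K ->
  inLb K u <-> inL K (map_mx conjc u).
Proof.
have cN : conjc (- ii) = ii by apply/eqP; rewrite eq_complex /= !oppr0 opprK !eqxx.
move=> Kr; split=> /(congr1 (map_mx conjc)); rewrite /inL /inLb mconjM Kr mconjZ.
  by rewrite cN.
by rewrite mconjK conj_ii.
Qed.

Lemma bil_conj u v : bil (map_mx conjc u) (map_mx conjc v) = conjc (bil u v).
Proof.
have Sr : map_mx conjc (Smx R m) = Smx R m by rewrite -Smx_map map_rc_conj.
rewrite /bil map_trmx -[in LHS]Sr -!mconjM mxE; exact: erefl.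
Qed.

Lemma bracket_conj x u v : map_mx conjc (bracket_mx (dJmx J x) u v) =
  bracket_mx (dJmx J x) (map_mx conjc u) (map_mx conjc v).
Proof.
have dr a : map_mx conjc (dxa R a) = dxa R a.
  by apply/rowP => b; rewrite !mxE; case: andP => _; rewrite ?conjc1 ?conjc0.
have c0 : map_mx conjc (0 : cgen) = 0 by apply/rowP => b; rewrite !mxE conjc0.
rewrite /bracket_mx (big_morph (map_mx conjc) mconjD c0); apply: eq_bigr => a _.
by rewrite !(mconjD, mconjN, mconjZ, mconjM) -!bil_conj mconjM dr dJmx_conj.
Qed.

Lemma integrable_Lb x u v : inLb (Jmx J x) u -> inLb (Jmx J x) v ->
  inLb (Jmx J x) (bracket_mx (dJmx J x) u v).
Proof.
have Kr := Jmx_conj J x.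
move=> /(inLb_conj _ Kr) uL /(inLb_conj _ Kr) vL; apply/(inLb_conj _ Kr).
by rewrite bracket_conj; exact: integrable_L.
Qed.

End Integrability.

(** * Pure degree and the exterior derivative *)

Section CliffordDerivative.
Variables (R : realType) (m : nat).
Local Notation C := R[i].
Local Notation V := 'rV[R]_m.
Local Notation exform := (exform R m).
Implicit Types (F : V -> exform) (p v : V).

Lemma cdiff_clifford g F p s : (forall t, cdiff (F^~ t) p) ->
  cdiff (fun q => clifford g (F q) s) p.
Proof.
move=> dF; apply: cdiffD; last exact: cdiff_wedge1.
apply: cdiffD; first exact: dF.
by apply: cdiffM; [exact: cdiff_cst|exact: dF].
Qed.

Lemma cderive_clifford g F p v s : (forall t, cdiff (F^~ t) p) ->
  cderive v (fun q => clifford g (F q) s) p = clifford g (dirderiv v F p) s.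
Proof.
move=> dF; rewrite /clifford cderiveD; last exact: cdiff_wedge1.
  rewrite dirderiv_wedge1 // /contract cderiveD ?cderiveZ //.
  by apply: cdiffM; [exact: cdiff_cst|exact: dF].
apply: cdiffD; first exact: dF.
by apply: cdiffM; [exact: cdiff_cst|exact: dF].
Qed.

Lemma cderive_rspin (K : V -> 'M[C]_(m + m)) F p v s : mdiff K p ->
  (forall t, cdiff (F^~ t) p) ->
  cderive v (fun q => rspin (K q) (F q) s) p =
  rspin (mderive v K p) (F p) s + rspin (K p) (dirderiv v F p) s.
Proof.
move=> dK dF.
have dSK : mdiff (fun q => Smx R m *m K q) p.
  move=> A B; apply: (@cdiff_ext _ _ (fun q => \sum_D Smx R m A D * K q D B)) => [q|].
    by rewrite [RHS]mxE.
  by apply: cdiff_sum => D _; apply: cdiffM (dK D B); exact: cdiff_cst.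
have dSK2 A B : cdiff (fun q => - 2^-1 * (Smx R m *m K q) A B) p.
  by apply: cdiffM; [exact: cdiff_cst|exact: dSK].
have dcl A t : cdiff (fun q => clifford (delta_mx 0 A) (F q) t) p by exact: cdiff_clifford.
have dcl2 A B t : cdiff (fun q => clifford (delta_mx 0 A) (clifford (delta_mx 0 B) (F q)) t) p.
  by apply: (@cdiff_clifford _ (fun q => clifford (delta_mx 0 B) (F q))) => t'; exact: dcl.
rewrite /rspin cderive_sum => [|A _]; last first.
  by apply: cdiff_sum => B _; apply: cdiffM; [exact: dSK2|exact: dcl2].
rewrite -big_split; apply: eq_bigr => A _ /=.
rewrite cderive_sum => [|B _]; last by apply: cdiffM; [exact: dSK2|exact: dcl2].
rewrite -big_split; apply: eq_bigr => B _ /=.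
rewrite (cderiveM v (dSK2 A B) (dcl2 A B s)); apply: (f_equal2 (fun X Y => X + Y)).
  rewrite (@cderiveZ _ _ (- 2^-1) _ _ v (dSK A B)) -(mderive_mull v (Smx R m) dK).
  by rewrite mderiveE.
apply: (f_equal (fun X => _ * X)).
rewrite (@cderive_clifford _ (fun q => clifford (delta_mx 0 B) (F q)) p v s (dcl B)).
apply: (f_equal (fun X => clifford _ X s)); apply/funext => t.
exact: cderive_clifford.
Qed.

End CliffordDerivative.

Section PureDegree.
Variables (R : realType) (n : nat) (M : smooth_manifold R n.*2).
Variable J : gen_complex M.
Local Notation m := n.*2.
Local Notation C := R[i].
Local Notation V := 'rV[R]_m.
Local Notation cgen := 'rV[C]_(m + m).
Local Notation ii := ('i%C : C).
Local Notation ex a := (delta_mx 0 a : V).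
Local Notation rawform := (rawform M).
Local Notation Omega := (@Omega R m M).
Local Notation d := (@d R m M).
Local Notation lam := (lam R m).
Implicit Types (x : M) (w : rawform).

Lemma evform_foldr (l : seq cgen) (rho : altform R m) :
  evform (foldr (@cl R m) rho l) = foldr (@clifford R m) (evform rho) l.
Proof. by elim: l => //= u l <-; rewrite cl_val. Qed.

(** The fibres of U are the eigenspaces of the spin action of J.  An eigenvalue
    equation, unlike membership in a span, can be differentiated. *)
Lemma U_fibreP x r (w : exform R m) : (r <= m)%N ->
  U_fibre J x (n%:Z - r%:Z) w <->
  exists w' : altform R m, w = evform w' /\ spin (Jmx J x) w' = lam r *: w'.
Proof.
move=> rm; rewrite /U_fibre.
have -> : (- n%:Z <= n%:Z - r%:Z <= n%:Z) = true.
  by apply/andP; split; lia.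
have K1 := Jmx_sqr J x; have K2 := Jmx_skew J x; have K3 := Jmx_conj J x.
split.
  move=> [N [l [rho [sl lL cr ->]]]].
  pose rho' a := AltForm (proj1 (cr a)).
  exists (\sum_(a < N) foldr (@cl R m) (rho' a) (l a)); split.
    apply/funext => s; rewrite evform_sum fct_sumE; apply: eq_bigr => a _.
    by rewrite evform_foldr.
  apply: (cspan_spin K1 K2); apply/(cspanP _ _ _); exists N, l, rho'; split=> //.
  - by move=> a; have := sl a; rewrite opprB addrC subrK => -[].
  - move=> a u /(lL a u); rewrite /in_Lbar => uL.
    by apply/(inLb_conj _ K3).
  - move=> a u uL; apply: evform_eq => s; rewrite cl_val.
    by rewrite [clifford _ _](proj2 (cr a) u uL).
move=> [w' [-> sw]].
have /cspanP := spin_cspan K1 K2 K3 rm sw.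
move=> [N [l [rho [sl lL vr ->]]]]; exists N, l, (fun a => evform (rho a)); split.
- by move=> a; rewrite sl opprB addrC subrK.
- by move=> a u ul; apply/(inLb_conj _ K3); exact: lL ul.
- move=> a; split; first exact: evformP.
  by move=> u uL; rewrite -cl_val (vr a u uL); apply/funext => s; rewrite evform0.
- apply/funext => s; rewrite evform_sum fct_sumE; apply: eq_bigr => a _.
  by rewrite evform_foldr.
Qed.

(** As polynomials in the spin action of J, the components of a smooth form are
    smooth. *)
Definition rpr_step (j l : nat) w : rawform :=
  rscale (lam j - lam l)^-1 (spinJ J w + rscale (- lam l) w).
Definition rpr (j : nat) w : rawform := foldr (rpr_step j) w (pr_indices m j).

Lemma Omega_rpr j w : Omega w -> Omega (rpr j w).
Proof.
move=> Ow; rewrite /rpr; elim: pr_indices => //= l s IH.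
apply: Omega_scale; apply: Omega_add; last exact: Omega_scale.
by apply: Omega_spinJ => //; exact: gc_smooth.
Qed.

Lemma rpr_at j w x (A : altform R m) : w x = evform A ->
  rpr j w x = evform (pr (Jmx J x) j A).
Proof.
move=> wA; rewrite /rpr /pr; elim: pr_indices => //= l s IH.
apply/funext => t; rewrite -[LHS]/((lam j - lam l)^-1 *
  (rspin (Jmx J x) (foldr (rpr_step j) w s x) t + - lam l * foldr (rpr_step j) w s x t)).
by rewrite IH /pr_step !evformE evform_spin mulNr.
Qed.

Lemma U_secP r w : (r <= m)%N ->
  U_sec J (n%:Z - r%:Z) w <-> Omega w /\ rpr r w = w.
Proof.
move=> rm; split=> [[Ow Uw]|[Ow rw]]; split=> //.
  apply/funext => x; have [A [wA sA]] := (U_fibreP x _ rm).1 (Uw x).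
  have K1 := Jmx_sqr J x; have K2 := Jmx_skew J x; have K3 := Jmx_conj J x.
  by rewrite (rpr_at _ wA) (pr_eigen _ rm sA) eqxx wA.
move=> x; have K1 := Jmx_sqr J x; have K2 := Jmx_skew J x; have K3 := Jmx_conj J x.
pose A := AltForm (Omega_exform Ow x); have wA : w x = evform A by [].
apply/(U_fibreP x _ rm); exists (pr (Jmx J x) r A); split.
  by rewrite -(rpr_at _ wA) rw.
by apply: (cspan_spin K1 K2); exact: pr_cspan.
Qed.

Lemma U_sec_out k w : ~~ (- n%:Z <= k <= n%:Z) -> U_sec J k w <-> w = 0.
Proof.
move=> /negbTE kn; rewrite /U_sec /U_fibre kn; split=> [[_ w0]|->].
  by apply/funext => x; rewrite w0.
by split=> //; exact: Omega0.
Qed.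

Lemma rpr_rpr r j w : (r <= m)%N -> Omega w -> rpr j (rpr r w) = if j == r then rpr r w else 0.
Proof.
move=> rm Ow; apply/funext => x.
have K1 := Jmx_sqr J x; have K2 := Jmx_skew J x; have K3 := Jmx_conj J x.
pose A := AltForm (Omega_exform Ow x); have wA : w x = evform A by [].
rewrite (rpr_at _ (rpr_at r wA)) (@pr_eigen _ _ (Jmx J x) j r) //; last first.
  by apply: (cspan_spin K1 K2); exact: pr_cspan.
rewrite eq_sym; case: eqP => _; first by rewrite (rpr_at _ wA).
by apply/funext => s; rewrite evform0.
Qed.

Lemma rpr_total w : Omega w -> w = \sum_(r < m.+1) rpr r w.
Proof.
move=> Ow; apply/funext => x; apply/funext => s.
have K1 := Jmx_sqr J x; have K2 := Jmx_skew J x; have K3 := Jmx_conj J x.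
pose A := AltForm (Omega_exform Ow x); have wA : w x = evform A by [].
rewrite !fct_sumE [in LHS]wA (pr_total K1 K2 K3 A) evform_sum; apply: eq_bigr => r _.
by rewrite (rpr_at _ wA).
Qed.

Lemma rprD j w w' : Omega w -> Omega w' -> rpr j (w + w') = rpr j w + rpr j w'.
Proof.
move=> Ow Ow'; apply/funext => x; apply/funext => s.
pose A := AltForm (Omega_exform Ow x); have wA : w x = evform A by [].
pose A' := AltForm (Omega_exform Ow' x); have wA' : w' x = evform A' by [].
have wAA : (w + w') x = evform (A + A').
  by apply/funext => t; rewrite evformD -wA -wA'.
rewrite (rpr_at _ wAA) prD evformD.
by rewrite -[RHS]/(rpr j w x s + rpr j w' x s) (rpr_at _ wA) (rpr_at _ wA').
Qed.

Lemma rprZ j c w : Omega w -> rpr j (rscale c w) = rscale c (rpr j w).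
Proof.
move=> Ow; apply/funext => x; apply/funext => s.
pose A := AltForm (Omega_exform Ow x); have wA : w x = evform A by [].
have wAc : rscale c w x = evform (c *: A) by apply/funext => t; rewrite evformZ -wA.
by rewrite (rpr_at _ wAc) prZ evformZ -[RHS]/(c * rpr j w x s) (rpr_at _ wA).
Qed.

(** The eigenvalue equation of [w], differentiated in a chart, gives the hypotheses of
    [spin_differential] at x. *)
Lemma d_pure r w x : (r <= m)%N -> U_sec J (n%:Z - r%:Z) w ->
  exists D1 D2 : altform R m, [/\ d w x = evform (D1 + D2),
    spin (Jmx J x) D1 = (lam r + ii) *: D1 & spin (Jmx J x) D2 = (lam r - ii) *: D2].
Proof.
move=> rm [Ow Uw]; set i := chart_at x; set p := chart i x.
pose F := form_in_chart i w.
have eF q : is_exform (F q) by apply: exform_chart; exact: Omega_exform.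
have dp : cdom i p by exact: cdom_at.
have dF t : cdiff (F^~ t) p by exact: Omega_cdiff.
pose A := AltForm (eF p).
pose Aa a := AltForm (exform_dirderiv (ex a) eF dF).
have Fp : F p = w x by exact: form_in_chart_at.
have sA : spin (Jmx J x) A = lam r *: A.
  have [A' [wA' sA']] := (U_fibreP x _ rm).1 (Uw x).
  have -> // : A = A'.
  by apply: evform_eq => s; rewrite -wA' -Fp.
have sF q : cdom i q -> rspin (Jchart J i q) (F q) = fun s => lam r * F q s.
  move=> dq; rewrite -(spinJ_in_chart J (Omega_exform Ow) dq); apply/funext => s.
  rewrite /form_in_chart /spinJ; set y := chart_inv i q.
  have [A' [wA' sA']] := (U_fibreP y _ rm).1 (Uw y).
  by rewrite wA' -evform_spin sA' evformZ -wA'.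
have sAa a : spin (dJmx J x a) A + spin (Jmx J x) (Aa a) = lam r *: Aa a.
  apply: evform_eq => s; rewrite evformD evformZ !evform_spin.
  have e : cderive (ex a) (fun q => rspin (Jchart J i q) (F q) s) p =
      cderive (ex a) (fun q => lam r * F q s) p.
    apply: cderive_near; apply: filterS (cdom_near x) => q dq.
    by rewrite (sF q dq).
  rewrite (cderive_rspin (ex a) s (Jchart_mdiff J dp) dF) (cderiveZ _ _ (dF s)) in e.
  by rewrite Jchart_at in e.
have [D1 [D2 [ED s1 s2]]] := spin_differential (Jmx_sqr J x) (Jmx_skew J x)
  (@dJmx_skew _ _ _ J x) (@dJmx_anti _ _ _ J x) (@integrable_L _ _ _ J x)
  (@integrable_Lb _ _ _ J x) sA sAa.
exists D1, D2; split=> //; rewrite -ED; apply/funext => s.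
rewrite d_dE -/i -/p -/F (dE_wedge s dF) evform_sum; apply: eq_bigr => a _.
rewrite cl_val /clifford /dxa.
have -> : lsubmx (delta_mx 0 (rshift m a) : cgen) = 0.
  by apply/rowP => b; rewrite !mxE eq_lrshift andbF.
have -> : rsubmx (delta_mx 0 (rshift m a) : cgen) = delta_mx 0 a.
  by apply/rowP => b; rewrite !mxE eq_rshift.
have -> : contract (0 : 'rV[C]_m) (evform (Aa a)) s = 0.
  rewrite /contract.
  have -> : map_mx (fun z => complex.Re z) (0 : 'rV[C]_m) = 0 by apply/rowP => b; rewrite !mxE.
  have -> : map_mx (fun z => complex.Im z) (0 : 'rV[C]_m) = 0 by apply/rowP => b; rewrite !mxE.
  have := (evformP (Aa a)).1 [::] s (-1) 0 0; rewrite /= scaler0 addr0 rmorphN1 mulN1r addNr => ->.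
  by rewrite mulr0 addr0.
by rewrite add0r.
Qed.

Lemma rpr_d r j w : (r <= m)%N -> (j <= m)%N -> U_sec J (n%:Z - r%:Z) w ->
  j.+1 != r -> j != r.+1 -> rpr j (d w) = 0.
Proof.
move=> rm jm Uw jr1 jr2; apply/funext => x; apply/funext => s.
have [D1 [D2 [dD s1 s2]]] := d_pure x rm Uw; rewrite (rpr_at _ dD) prD evformD.
have K1 := Jmx_sqr J x; have K2 := Jmx_skew J x; have K3 := Jmx_conj J x.
have pr0 c (v : altform R m) : c != lam j -> spin (Jmx J x) v = c *: v ->
    pr (Jmx J x) j v = 0.
  move=> cj sv; have := cspan_spin K1 K2 (pr_cspan K1 K2 K3 v jm).
  move/eqP; rewrite -pr_spin sv prZ -subr_eq0 -scalerBl scaler_eq0 subr_eq0 (negbTE cj).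
  by move/eqP.
rewrite (pr0 _ _ _ s1) ?(pr0 _ _ _ s2) ?evform0 ?addr0 //.
  apply: contra jr2 => /eqP e; apply/eqP; apply: (@lam_inj R m); rewrite -e /lam.
  by rewrite -addn1 natrD; ring.
apply: contra jr1 => /eqP e; apply/eqP; apply: (@lam_inj R m).
have -> : lam r = lam j - ii by rewrite -e addrK.
by rewrite /lam -addn1 natrD; ring.
Qed.

End PureDegree.

(** * Homological algebra of a graded space with a differential of degrees 1 and -1 *)

Section GradedDifferential.
Variables (F : fieldType) (ii : F) (V : lmodType F) (N : nat).
Variables (P : nat -> {linear V -> V}) (d : {linear V -> V}).
Hypothesis ii_sqr : ii * ii = -1.
Hypothesis P_P : forall j r v, P j (P r v) = if j == r then P r v else 0.
Hypothesis P_total : forall v, v = \sum_(r < N.+1) P r v.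
Hypothesis P_d : forall j r v, j.+1 != r -> j != r.+1 -> P j (d (P r v)) = 0.
Hypothesis d_d : forall v, d (d v) = 0.
Implicit Types (u v w z : V) (j r : nat).

(** The index r stands for the degree k = n - r.  Hence [gdel], which raises the
    degree k by one, lowers r, and it is 0 where r = 0. *)
Definition P_pred r v := if r is r'.+1 then P r' v else 0.
Definition gdel v := \sum_(r < N.+1) P_pred r (d (P r v)).
Definition gdelbar v := \sum_(r < N.+1) P r.+1 (d (P r v)).
Definition gdJ v := - ii *: (gdel v - gdelbar v).

Lemma P_large r v : (N < r)%N -> P r v = 0.
Proof.
move=> Nr; rewrite [v]P_total linear_sum big1 // => j _; rewrite P_P.
by case: eqP => // e; move: (ltn_ord j); rewrite -e ltnS leqNgt Nr.
Qed.

Lemma P_ext v w : (forall j, P j v = P j w) -> v = w.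
Proof. by move=> e; rewrite [v]P_total [w]P_total; apply: eq_bigr. Qed.

Lemma P_sum_single j (f : nat -> V) r0 : (forall r, r != r0 -> P j (f r) = 0) ->
  (forall r, (N < r)%N -> f r = 0) -> P j (\sum_(r < N.+1) f r) = P j (f r0).
Proof.
move=> f0 fN; rewrite linear_sum; have [r0N|Nr0] := leqP r0 N.
  rewrite (bigD1 (Ordinal (leq_ltn_trans r0N (ltnSn N)))) //= big1 ?addr0 // => r.
  by move=> rr0; apply: f0.
rewrite (fN _ Nr0) linear0 big1 // => r _; apply: f0.
by rewrite neq_ltn (leq_ltn_trans _ Nr0) // -ltnS.
Qed.

Lemma P_gdel j v : P j (gdel v) = P j (d (P j.+1 v)).
Proof.
rewrite (@P_sum_single j (fun r => P_pred r (d (P r v))) j.+1) /=; first by rewrite P_P eqxx.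
  by case=> [|r] rj /=; rewrite ?linear0 // P_P eq_sym -eqSS (negbTE rj).
by move=> r Nr; rewrite P_large // linear0; case: r {Nr} => //= r; rewrite linear0.
Qed.

Lemma P_gdelbar j v : P j (gdelbar v) = P j (d (P_pred j v)).
Proof.
rewrite (@P_sum_single j (fun r => P r.+1 (d (P r v))) j.-1) /=.
- by case: j => [|j] /=; rewrite P_P ?eqxx // !linear0.
- move=> r rj; rewrite P_P; case: j rj => //= j; rewrite eqSS eq_sym => /negbTE -> //.
- by move=> r Nr; rewrite (P_large v Nr) !linear0.
Qed.

Lemma P_dE j v : P j (d v) = P j (gdel v) + P j (gdelbar v).
Proof.
rewrite P_gdel P_gdelbar {1}[v]P_total !linear_sum.
have E r : P j (d (P r v)) =
    (if r == j.+1 then P j (d (P r v)) else 0) + (if j == r.+1 then P j (d (P r v)) else 0).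
  have [->|rj] := eqVneq r j.+1.
    by rewrite ifN ?addr0 // neq_ltn ltnS leqnSn.
  by case: eqVneq => jr; rewrite add0r // P_d // eq_sym.
rewrite (eq_bigr (fun r : 'I_N.+1 => (if r == j.+1 :> nat then P j (d (P r v)) else 0) +
  (if j == r.+1 then P j (d (P r v)) else 0)) (fun (r : 'I_N.+1) _ => E r)) big_split /=; congr (_ + _).
  rewrite -big_mkcond /=; have [jN|jN] := ltnP j N.
    by rewrite (big_pred1 (Ordinal (jN : (j.+1 < N.+1)%N))).
  rewrite (P_large v (jN : (N < j.+1)%N)) !linear0 big1 // => r /eqP e.
  by move: (ltn_ord r); rewrite e ltnS ltnNge jN.
rewrite -big_mkcond /=; case: j {E} => [|j] /=; first by rewrite !linear0 big1.
have [jN|jN] := leqP j N.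
  by rewrite (big_pred1 (Ordinal (jN : (j < N.+1)%N))) // => r; rewrite eqSS eq_sym.
rewrite (P_large v jN) !linear0 big1 // => r /eqP [e].
by move: (ltn_ord r); rewrite -e ltnS leqNgt jN.
Qed.

Lemma gdE v : d v = gdel v + gdelbar v.
Proof. by apply: P_ext => j; rewrite linearD P_dE. Qed.

Lemma gdelP c v w : gdel (c *: v + w) = c *: gdel v + gdel w.
Proof. by apply: P_ext => j; rewrite linearP !P_gdel !linearP. Qed.
Lemma P_predP c r v w : P_pred r (c *: v + w) = c *: P_pred r v + P_pred r w.
Proof. by case: r => [|r] /=; rewrite ?scaler0 ?addr0 // linearP. Qed.
Lemma gdelbarP c v w : gdelbar (c *: v + w) = c *: gdelbar v + gdelbar w.
Proof. by apply: P_ext => j; rewrite linearP !P_gdelbar P_predP !linearP. Qed.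
HB.instance Definition _ := GRing.isLinear.Build F V V *:%R gdel gdelP.
HB.instance Definition _ := GRing.isLinear.Build F V V *:%R gdelbar gdelbarP.

Lemma gdJP c v w : gdJ (c *: v + w) = c *: gdJ v + gdJ w.
Proof.
rewrite /gdJ gdelP gdelbarP scalerA [c * _]mulrC -scalerA -scalerDr; congr (_ *: _).
by rewrite scalerBr opprD addrACA.
Qed.
HB.instance Definition _ := GRing.isLinear.Build F V V *:%R gdJ gdJP.

Lemma gdelD v w : gdel (v + w) = gdel v + gdel w. Proof. exact: linearD. Qed.
Lemma gdelbarD v w : gdelbar (v + w) = gdelbar v + gdelbar w. Proof. exact: linearD. Qed.
Lemma gdJD v w : gdJ (v + w) = gdJ v + gdJ w. Proof. exact: linearD. Qed.

Definition twist (c : nat -> F) v := \sum_(r < N.+1) c r *: P r v.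

Lemma P_twist c j v : P j (twist c v) = c j *: P j v.
Proof.
rewrite (@P_sum_single j (fun r => c r *: P r v) j); first by rewrite linearZ /= P_P eqxx.
  by move=> r rj; rewrite linearZ /= P_P eq_sym (negbTE rj) scaler0.
by move=> r Nr; rewrite P_large // scaler0.
Qed.

Lemma P_pred_twist c j v : P_pred j (twist c v) = c j.-1 *: P_pred j v.
Proof. by case: j => [|j] /=; rewrite ?scaler0 // P_twist. Qed.

(** Since (-i)^r = i^(n - r) / i^n, this is multiplication by i^k in degree k, up to a
    constant factor. *)
Definition tau := twist (fun r => (- ii) ^+ r).
Definition tau_inv := twist (fun r => ii ^+ r).

Lemma tauK v : tau_inv (tau v) = v.
Proof.
apply: P_ext => j; rewrite !P_twist scalerA -exprMn mulrN ii_sqr opprK expr1n.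
exact: scale1r.
Qed.
Lemma tau_invK v : tau (tau_inv v) = v.
Proof.
apply: P_ext => j; rewrite !P_twist scalerA -exprMn mulNr ii_sqr opprK expr1n.
exact: scale1r.
Qed.

Lemma P_tau_gdel j v : P j (gdel (tau v)) = (- ii) ^+ j *: (- ii *: P j (gdel v)).
Proof. by rewrite !P_gdel P_twist scalerA -exprSr !linearZ. Qed.

Lemma P_tau_gdelbar j v : P j (gdelbar (tau v)) = (- ii) ^+ j *: (ii *: P j (gdelbar v)).
Proof.
rewrite !P_gdelbar P_pred_twist; case: j => [|j] /=.
  by rewrite !scaler0 (linear0 d) (linear0 (P 0)) !scaler0.
by rewrite !linearZ /= scalerA exprSr mulrCA mulrA mulrN -mulrA ii_sqr mulrN1 opprK.
Qed.

(** Conjugation by [tau] multiplies the part of degree 1 of d by -i and the part of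
    degree -1 by i, which gives d^J. *)
Lemma d_tau v : d (tau v) = tau (gdJ v).
Proof.
apply: P_ext => j; rewrite gdE linearD P_tau_gdel P_tau_gdelbar P_twist /gdJ -scalerDr.
by congr (_ *: _); rewrite linearZ linearB /= scalerBr scaleNr [- ii *: P j (gdelbar v)]scaleNr opprK.
Qed.

Lemma gdJ_tau v : gdJ (tau v) = - tau (d v).
Proof.
apply: P_ext => j; rewrite linearN P_twist gdE linearD /gdJ linearZ linearB /=.
rewrite P_tau_gdel P_tau_gdelbar -scalerBr scalerA mulrC -scalerA -[RHS]scalerN.
apply: (f_equal (fun x => (- ii) ^+ j *: x)).
by rewrite scalerBr !scalerA mulrNN mulNr ii_sqr opprK scaleN1r scale1r opprD.
Qed.

Lemma tau_inj v w : tau v = tau w -> v = w.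
Proof. by move=> /(congr1 tau_inv); rewrite !tauK. Qed.

Lemma tauP c v w : tau (c *: v + w) = c *: tau v + tau w.
Proof.
apply: P_ext => j; rewrite !linearP !P_twist linearP scalerDr !scalerA.
by rewrite [c * _]mulrC.
Qed.
HB.instance Definition _ := GRing.isLinear.Build F V V *:%R tau tauP.

Lemma gdJ_gdJ v : gdJ (gdJ v) = 0.
Proof. by apply: tau_inj; rewrite -!d_tau d_d linear0. Qed.

(** d^2 = 0 has components in degrees 2, 0 and -2. *)
Lemma gdel_gdel v : gdel (gdel v) = 0.
Proof.
apply: P_ext => j; rewrite linear0 !P_gdel.
have := congr1 (P j) (d_d (P j.+2 v)); rewrite linear0 P_dE P_gdel P_gdelbar.
have -> : P_pred j (d (P j.+2 v)) = 0.
  by case: j => //= j; rewrite P_d //; lia.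
by rewrite !linear0 addr0.
Qed.

Lemma gdelbar_gdelbar v : gdelbar (gdelbar v) = 0.
Proof.
apply: P_ext => j; rewrite linear0 P_gdelbar; case: j => [|j] /=; first by rewrite !linear0.
rewrite P_gdelbar; case: j => [|j] /=; first by rewrite !linear0.
have := congr1 (P j.+2) (d_d (P j v)); rewrite linear0 P_dE P_gdel P_gdelbar /=.
by rewrite (@P_d j.+3 j) ?linear0 ?add0r //; lia.
Qed.

Lemma d_gdJ v : d (gdJ v) = - ii *: (gdelbar (gdel v) - gdel (gdelbar v)).
Proof.
rewrite /gdJ linearZ linearB /= !gdE gdel_gdel gdelbar_gdelbar add0r addr0.
by [].
Qed.

Lemma gdJ_d v : gdJ (d v) = - d (gdJ v).
Proof.
rewrite d_gdJ /gdJ gdE gdelD gdelbarD gdel_gdel gdelbar_gdelbar add0r addr0 -scalerN.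
by rewrite opprB.
Qed.

(** As [gdel] and [gdelbar] have square 0, d d^J only has a part of degree 0. *)
Lemma P_ddJ k v : P k (d (gdJ v)) = d (gdJ (P k v)).
Proof.
have E j x : P j (d (gdJ x)) =
    - ii *: (P j (d (P_pred j (d (P j x)))) - P j (d (P j.+1 (d (P j x))))).
  rewrite d_gdJ linearZ linearB /= P_gdelbar P_gdel; congr (_ *: (P j (d _) - P j (d _))).
    by case: j => //= j; rewrite P_gdel.
  by rewrite P_gdelbar.
apply: P_ext => j; rewrite P_P; case: eqP => [->|jk]; first by rewrite !E P_P eqxx.
rewrite E P_P; case: eqP => // _; have -> : P_pred j (d 0) = 0.
  by case: (j) => [|j'] /=; rewrite ?linear0.
rewrite (linear0 d) (linear0 (P j.+1)) !(linear0 d) (linear0 (P j)).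
by rewrite subrr scaler0.
Qed.

Hypothesis two_neq0 : (2 : F) != 0.

Lemma both_closed v : d v = 0 -> gdJ v = 0 -> gdel v = 0 /\ gdelbar v = 0.
Proof.
move=> dv /eqP; rewrite /gdJ scaler_eq0 oppr_eq0 => /orP[/eqP i0|].
  by move: ii_sqr; rewrite i0 mul0r => /eqP; rewrite eq_sym oppr_eq0 oner_eq0.
rewrite subr_eq0 => /eqP e; move: dv; rewrite gdE e -mulr2n -scaler_nat => /eqP.
by rewrite scaler_eq0 (negbTE two_neq0) /= => /eqP.
Qed.

(** Both conditions say that [gdel] and [gdelbar] kill v. *)
Lemma both_closedP v : (d v = 0 /\ gdJ v = 0) <-> (forall r, d (P r v) = 0).
Proof.
split=> [[dv jv] r|dP].
  have [e1 e2] := both_closed dv jv; apply: P_ext => j; rewrite linear0.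
  have [<-|rj] := eqVneq j.+1 r; first by rewrite -P_gdel e1 linear0.
  have [->|jr] := eqVneq j r.+1; first by rewrite -[P r v]/(P_pred r.+1 v) -P_gdelbar e2 linear0.
  exact: P_d.
have -> : gdJ v = 0.
  rewrite /gdJ /gdel /gdelbar !big1 ?subrr ?scaler0 // => r _; rewrite dP ?linear0 //.
  by case: (r : nat) => //= r'; rewrite linear0.
by split=> //; rewrite [v]P_total linear_sum big1.
Qed.

Definition ddJ_property := forall u, gdJ (d u) = 0 -> exists z, d u = d (gdJ z).
(** Surjectivity and injectivity, in cohomology, of the inclusion of the kernel of
    d^J. *)
Definition inclusion_surjective := forall v, d v = 0 ->
  exists w z, [/\ d w = 0, gdJ w = 0 & v = w + d z].
Definition inclusion_injective := forall z, gdJ (d z) = 0 ->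
  exists2 y, gdJ y = 0 & d z = d y.

(** Conjugation by [tau] exchanges, up to sign, the roles of d and d^J. *)
Lemma ddJ_conj : ddJ_property -> forall u, d (gdJ u) = 0 -> exists z, gdJ u = d (gdJ z).
Proof.
move=> A u du; have [|z E] := A (tau u).
  by rewrite d_tau gdJ_tau du linear0 oppr0.
exists (tau_inv z); apply: tau_inj; rewrite -d_tau E -[in LHS](tau_invK z).
by rewrite gdJ_tau linearN d_tau -linearN gdJ_d opprK.
Qed.

(** If d^J v = d d^J z, then v + d z is closed for both operators, because d and d^J
    anticommute. *)
Lemma ddJ_surjective : ddJ_property -> inclusion_surjective.
Proof.
move=> A v dv; have [|z E] := ddJ_conj A (u := v).
  by apply: oppr_inj; rewrite -gdJ_d dv linear0 oppr0.
exists (v + d z), (- z); split; last by rewrite linearN addrK.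
  by rewrite linearD dv d_d addr0.
by rewrite gdJD E gdJ_d addrN.
Qed.

Lemma ddJ_injective : ddJ_property -> inclusion_injective.
Proof. by move=> A z /A[y ->]; exists (gdJ y) => //; exact: gdJ_gdJ. Qed.

(** By injectivity d u = d g with d^J g = 0, so [tau g] is closed.  Represent it by a
    form closed for both operators, and conjugate back by [tau]. *)
Lemma inclusion_ddJ : inclusion_surjective -> inclusion_injective -> ddJ_property.
Proof.
move=> S I u /I[g jg ->].
have [|w [z [dw jw E]]] := S (tau g); first by rewrite d_tau jg linear0.
exists (tau_inv z).
have dz : d z = tau (gdJ (tau_inv z)) by rewrite -d_tau tau_invK.
apply: tau_inj; move: E; rewrite dz => /(congr1 gdJ); rewrite gdJ_tau gdJD jw add0r gdJ_tau.
by move=> /oppr_inj.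
Qed.

Lemma ddJ_components : ddJ_property -> forall v, d v = 0 -> exists2 w,
  forall r, d (P r w) = 0 & exists z, v = w + d z.
Proof.
move=> A v /(ddJ_surjective A)[w [z [dw jw E]]]; exists w; last by exists z.
by apply/both_closedP.
Qed.

(** As d d^J preserves the degree, a primitive of the form d^J z can be cut into
    components. *)
Lemma ddJ_trivial : ddJ_property -> forall v, (forall r, d (P r v) = 0) ->
  (exists u, v = d u) -> forall r, exists z, P r v = d z.
Proof.
move=> A v /both_closedP[dv jv] [u E] r.
have [|z Ez] := A u; first by rewrite -E.
by exists (gdJ (P r z)); rewrite -P_ddJ -Ez -E.
Qed.

End GradedDifferential.

(** * The space of smooth forms *)

Section SmoothForms.
Variables (R : realType) (m : nat) (M : smooth_manifold R m).
Local Notation C := R[i].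

Record smform : Type := SmForm { sm_val : rawform M; smP : @Omega R m M sm_val }.

Lemma smform_eq (v w : smform) : sm_val v = sm_val w -> v = w.
Proof.
case: v w => [v pv] [w pw] /= E; case: _ / E in pw *.
by congr SmForm; exact: Prop_irrelevance.
Qed.

HB.instance Definition _ := gen_eqMixin smform.
HB.instance Definition _ := gen_choiceMixin smform.

Definition sm0 := SmForm (Omega0 M).
Definition sm_add v w := SmForm (Omega_add (smP v) (smP w)).
Definition sm_scale c v := SmForm (Omega_scale c (smP v)).
Definition sm_opp v := sm_scale (-1) v.

Fact sm_addA : associative sm_add.
Proof. by move=> u v w; apply: smform_eq; rewrite /= addrA. Qed.
Fact sm_addC : commutative sm_add.
Proof. by move=> v w; apply: smform_eq; rewrite /= addrC. Qed.
Fact sm_add0 : left_id sm0 sm_add.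
Proof. by move=> v; apply: smform_eq; rewrite /= add0r. Qed.
Fact sm_addN : left_inverse sm0 sm_opp sm_add.
Proof.
move=> v; apply: smform_eq; apply/funext => x; apply/funext => s.
by rewrite -[LHS]/(-1 * sm_val v x s + sm_val v x s) mulN1r addNr.
Qed.
HB.instance Definition _ := GRing.isZmodule.Build smform sm_addA sm_addC sm_add0 sm_addN.

Fact sm_scaleA a b v : sm_scale a (sm_scale b v) = sm_scale (a * b) v.
Proof.
by apply: smform_eq; apply/funext => x; apply/funext => s; rewrite /= /rscale mulrA.
Qed.
Fact sm_scale1 : left_id 1 sm_scale.
Proof.
by move=> v; apply: smform_eq; apply/funext => x; apply/funext => s; rewrite /= /rscale mul1r.
Qed.
Fact sm_scaleDr : right_distributive sm_scale +%R.
Proof.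
by move=> c v w; apply: smform_eq; apply/funext => x; apply/funext => s; exact: mulrDr.
Qed.
Fact sm_scaleDl v : {morph sm_scale^~ v : a b / a + b}.
Proof.
by move=> a b; apply: smform_eq; apply/funext => x; apply/funext => s; exact: mulrDl.
Qed.
HB.instance Definition _ :=
  GRing.Zmodule_isLmodule.Build C smform sm_scaleA sm_scale1 sm_scaleDr sm_scaleDl.

Lemma sm_val0 : sm_val 0 = 0. Proof. by []. Qed.
Lemma sm_valD (v w : smform) : sm_val (v + w) = sm_val v + sm_val w.
Proof. by []. Qed.
Lemma sm_valZ c (v : smform) : sm_val (c *: v) = rscale c (sm_val v).
Proof. by []. Qed.
Lemma sm_val_sum (I : Type) (r : seq I) (Q : pred I) (G : I -> smform) :
  sm_val (\sum_(i <- r | Q i) G i) = \sum_(i <- r | Q i) sm_val (G i).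
Proof. by apply: (big_morph _ sm_valD sm_val0). Qed.

Definition sm_d v := SmForm (Omega_d (smP v)).
Fact sm_d_linear : linear sm_d.
Proof.
move=> c v w; apply: smform_eq.
rewrite sm_valD sm_valZ /= d_add; [by rewrite d_scale //; exact: smP| |exact: smP].
exact: Omega_scale (smP v).
Qed.
HB.instance Definition _ := GRing.isLinear.Build C smform smform *:%R sm_d sm_d_linear.

End SmoothForms.

(** * The operators of a generalized complex structure *)

Section Operators.
Variables (R : realType) (n : nat) (M : smooth_manifold R n.*2).
Variable J : gen_complex M.
Local Notation m := n.*2.
Local Notation C := R[i].
Local Notation ii := ('i%C : C).
Local Notation rawform := (rawform M).
Local Notation Omega := (@Omega R m M).
Local Notation d := (@d R m M).
Local Notation smform := (smform M).
Implicit Types (v : smform) (w : rawform) (r : nat) (k : int).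

Definition sm_pr r v : smform := if (r <= m)%N then SmForm (Omega_rpr J r (smP v)) else 0.
Lemma sm_prE r v : sm_val (sm_pr r v) = if (r <= m)%N then rpr J r (sm_val v) else 0.
Proof. by rewrite /sm_pr; case: ifP. Qed.

Fact sm_pr_linear r : linear (sm_pr r).
Proof.
move=> c v w; apply: smform_eq; rewrite sm_valD sm_valZ !sm_prE.
case: ifP => _; last first.
  by apply/funext => x; apply/funext => s; rewrite -[RHS]/(c * 0 + 0 : C) mulr0 addr0.
rewrite rprD; [by rewrite rprZ //; exact: smP| |exact: smP].
exact: Omega_scale (smP v).
Qed.
HB.instance Definition _ r := GRing.isLinear.Build C smform smform *:%R (sm_pr r) (sm_pr_linear r).

Local Notation P := (fun r => sm_pr r : {linear smform -> smform}).
Local Notation D := (@sm_d R m M : {linear smform -> smform}).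

Lemma sm_pr_pr (j r : nat) v : P j (P r v) = if j == r then P r v else 0.
Proof.
apply: smform_eq; rewrite /= sm_prE; case: leqP => [jm|mj].
  rewrite sm_prE; case: leqP => [rm|mr].
    by rewrite (rpr_rpr J _ rm (smP v)); case: eqP => // _; rewrite sm_prE rm.
  rewrite ifN; last by apply/eqP; lia.
  have := linear0 (P j); move=> /(congr1 (@sm_val _ _ _)); rewrite /= sm_prE jm.
  by [].
case: eqP => // e; rewrite sm_prE -e; rewrite ifN //; first by rewrite -ltnNge.
Qed.

Lemma sm_pr_total v : v = \sum_(r < m.+1) P r v.
Proof.
apply: smform_eq; rewrite sm_val_sum [LHS](rpr_total J (smP v)); apply: eq_bigr => r _.
by rewrite /= sm_prE -ltnS ltn_ord.
Qed.

Lemma sm_pr_U r v : (r <= m)%N -> U_sec J (n%:Z - r%:Z) (sm_val (P r v)).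
Proof.
move=> rm; apply/(U_secP _ _ rm); split; first exact: smP.
by rewrite /= sm_prE rm (rpr_rpr J _ rm (smP v)) eqxx.
Qed.

Lemma sm_pr_d (j r : nat) v : j.+1 != r -> j != r.+1 -> P j (D (P r v)) = 0.
Proof.
move=> jr1 jr2; apply: smform_eq; rewrite /= sm_prE; case: leqP => // jm.
have [rm|mr] := leqP r m; first exact: (rpr_d rm jm (sm_pr_U v rm)).
have -> : sm_pr r v = 0 by rewrite /sm_pr leqNgt mr.
have := linear0 (P j); rewrite -[in X in X -> _](linear0 D) => /(congr1 (@sm_val _ _ _)).
by rewrite /= sm_prE jm => ->; apply: (congr1 (@sm_val _ _ _) (linear0 D)).
Qed.

Lemma sm_d_d v : D (D v) = 0.
Proof. by apply: smform_eq; rewrite /= (d_d (smP v)). Qed.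

Lemma in_range r : (r <= m)%N -> (- n%:Z <= n%:Z - r%:Z <= n%:Z) = true.
Proof. by move=> rm; apply/andP; split; lia. Qed.

Definition comp k v : rawform :=
  if - n%:Z <= k <= n%:Z then sm_val (P `|n%:Z - k|%N v) else 0.

Lemma comp_U k v : U_sec J k (comp k v).
Proof.
rewrite /comp; case: ifP => kn; last by apply/(U_sec_out _ _); rewrite ?kn.
have e : k = n%:Z - `|n%:Z - k|%N%:Z by lia.
by rewrite {1}e; apply: sm_pr_U; lia.
Qed.

Lemma comp_sum v : sm_val v = sum_deg (comp^~ v).
Proof.
rewrite {1}[v]sm_pr_total sm_val_sum; apply: eq_bigr => r _.
rewrite /comp in_range; last by rewrite -ltnS.
by rewrite opprB addrC subrK.
Qed.

(** By uniqueness, the choice in the definition of [proj] does not matter. *)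
Lemma comp_unique (f : int -> rawform) v : (forall j, U_sec J j (f j)) ->
  sm_val v = sum_deg f -> f = comp^~ v.
Proof.
move=> fU fE; pose g (j : int) := SmForm (proj1 (fU j)).
have gE : v = \sum_(r < m.+1) g (n%:Z - r%:Z).
  by apply: smform_eq; rewrite sm_val_sum fE.
have gP r : (r <= m)%N -> P r (g (n%:Z - r%:Z)) = g (n%:Z - r%:Z).
  move=> rm; apply: smform_eq; rewrite /= sm_prE rm.
  exact: (proj2 ((U_secP J (f (n%:Z - r%:Z)) rm).1 (fU _))).
apply/funext => k; rewrite /comp; case: ifP => kn; last first.
  by apply/(U_sec_out J _ (negbT kn)); exact: fU.
have e : k = n%:Z - `|n%:Z - k|%N%:Z by lia.
have lm : (`|n%:Z - k| <= m)%N by lia.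
rewrite gE linear_sum (bigD1 (Ordinal (lm : (_ < m.+1)%N))) //= big1 => [|r rl].
  by rewrite addr0 [sm_pr _ _](gP _ lm) -e.
rewrite -(gP r); last by rewrite -ltnS.
by rewrite [LHS]sm_pr_pr ifN // eq_sym.
Qed.

Lemma projE k v : proj J k (sm_val v) = comp k v.
Proof.
rewrite /proj.
have ex0 : [set f : int -> rawform | (forall j, U_sec J j (f j)) /\ sm_val v = sum_deg f] (comp^~ v).
  by split; [move=> j; exact: comp_U|exact: comp_sum].
have [fU fE] := xgetPex (fun=> 0) (ex_intro _ _ ex0).
exact: (f_equal (fun f => f k) (comp_unique fU fE)).
Qed.

Definition sm_dJ v := gdJ ii m P D v.

Lemma del_opE v : del_op J (sm_val v) = sm_val (gdel m P D v).
Proof.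
rewrite /del_op /gdel sm_val_sum; apply: eq_bigr => r _.
have rm : (r <= m)%N by rewrite -ltnS.
rewrite projE /comp in_range // opprB addrC subrK absz_nat.
rewrite -[d (sm_val (P r v))]/(sm_val (D (P r v))) projE /comp.
case: (r : nat) rm => [|r'] rm /=; first by rewrite ifN //; lia.
rewrite ifT; last by apply/andP; split; lia.
by congr (sm_val (sm_pr _ _)); lia.
Qed.

Lemma delbar_opE v : delbar_op J (sm_val v) = sm_val (gdelbar m P D v).
Proof.
rewrite /delbar_op /gdelbar sm_val_sum; apply: eq_bigr => r _.
have rm : (r <= m)%N by rewrite -ltnS.
rewrite projE /comp in_range // opprB addrC subrK absz_nat.
rewrite -[d (sm_val (P r v))]/(sm_val (D (P r v))) projE /comp.
case: ifP => rn; first by congr (sm_val (sm_pr _ _)); lia.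
by rewrite /= sm_prE ifN //; lia.
Qed.

Lemma dJE v : dJ J (sm_val v) = sm_val (sm_dJ v).
Proof.
rewrite /dJ del_opE delbar_opE /sm_dJ /gdJ.
move: (gdel _ _ _ v) (gdelbar _ _ _ v) => a b; apply/funext => x; apply/funext => s.
by rewrite -[RHS]/(- ii * (sm_val a x s + -1 * sm_val b x s)) mulN1r.
Qed.

End Operators.

(** * The two properties and their consequences *)

Section Equivalence.
Variables (R : realType) (n : nat) (M : smooth_manifold R n.*2).
Variable J : gen_complex M.
Local Notation m := n.*2.
Local Notation C := R[i].
Local Notation ii := ('i%C : C).
Local Notation rawform := (rawform M).
Local Notation Omega := (@Omega R m M).
Local Notation d := (@d R m M).
Local Notation smform := (smform M).
Local Notation P := (fun r => sm_pr J r : {linear smform -> smform}).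
Local Notation D := (@sm_d R m M : {linear smform -> smform}).
Implicit Types (v z : smform) (w g : rawform) (k : int).

Lemma two_neq0 : (2 : C) != 0. Proof. by rewrite pnatr_eq0. Qed.

Lemma OmegaP w : Omega w -> exists v, sm_val v = w.
Proof. by move=> Ow; exists (SmForm Ow). Qed.

Lemma d_sm v : d (sm_val v) = sm_val (D v). Proof. by []. Qed.

Lemma sm_val_eq0 v : sm_val v = 0 <-> v = 0.
Proof. by split=> [e|->] //; apply: smform_eq. Qed.

Fact sm_dJ_linear : linear (sm_dJ J).
Proof. by move=> c v z; exact: (gdJP ii D (sm_pr_pr J) (sm_pr_total J) c v z). Qed.
HB.instance Definition _ := GRing.isLinear.Build C smform smform *:%R (sm_dJ J) sm_dJ_linear.

Lemma sm_dJ0 : sm_dJ J 0 = 0. Proof. exact: linear0. Qed.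
Lemma sm_dJD v z : sm_dJ J (v + z) = sm_dJ J v + sm_dJ J z. Proof. exact: linearD. Qed.
Lemma sm_dJN v : sm_dJ J (- v) = - sm_dJ J v. Proof. exact: linearN. Qed.

Lemma sm_dJ_d v : sm_dJ J (D v) = - D (sm_dJ J v).
Proof. exact: gdJ_d (sm_pr_pr J) (sm_pr_total J) (sm_pr_d J) (@sm_d_d _ _ M) v. Qed.

Lemma sm_dJ_dJ v : sm_dJ J (sm_dJ J v) = 0.
Proof. exact: gdJ_gdJ (ii_sqr R) (sm_pr_pr J) (sm_pr_total J) (sm_pr_d J) (@sm_d_d _ _ M) v. Qed.

Lemma ddJ_lemmaP : ddJ_lemma J <-> ddJ_property ii m P D.
Proof.
split=> [[E1 E2] u ju|A].
  have : (d @` Omega `&` [set w | Omega w /\ dJ J w = 0]) (sm_val (D u)).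
    split; first by exists (sm_val u); [exact: smP|].
    by split; [exact: smP|rewrite dJE; apply/sm_val_eq0].
  rewrite E1 E2 => -[w /OmegaP[z <-]]; rewrite dJE => e.
  by exists z; apply: smform_eq; rewrite -e.
have X : d @` Omega `&` [set w | Omega w /\ dJ J w = 0] = (fun w => d (dJ J w)) @` Omega.
  apply/seteqP; split=> [w [[_ /OmegaP[u <-] <-] [_]]|w [_ /OmegaP[u <-] <-]].
    rewrite d_sm dJE => /sm_val_eq0 /A[z ->].
    by exists (sm_val z); [exact: smP|rewrite dJE].
  rewrite dJE d_sm; split; first by exists (sm_val (sm_dJ J u)); [exact: smP|].
  split; first exact: smP.
  by rewrite dJE; apply/sm_val_eq0; rewrite sm_dJ_d sm_dJ_dJ linear0 oppr0.
have Y : dJ J @` Omega `&` [set w | Omega w /\ d w = 0] = (fun w => d (dJ J w)) @` Omega.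
  apply/seteqP; split=> [w [[_ /OmegaP[u <-] <-] [_]]|w [_ /OmegaP[u <-] <-]].
    rewrite dJE d_sm => /sm_val_eq0 du.
    have [z e] := ddJ_conj (ii_sqr R) (sm_pr_pr J) (sm_pr_total J) (sm_pr_d J)
      (@sm_d_d _ _ M) A du.
    by exists (sm_val z); [exact: smP|rewrite dJE d_sm; congr sm_val].
  rewrite dJE d_sm; split.
    by exists (sm_val (- D u)); [exact: smP|rewrite dJE sm_dJN sm_dJ_d opprK].
  by split; [exact: smP|rewrite d_sm; apply/sm_val_eq0; exact: sm_d_d].
by split; [rewrite X Y|].
Qed.

Lemma coh_class_refl (K : set rawform) w : K 0 -> coh_class K w w.
Proof.
move=> K0; exists 0 => //.
have -> : d 0 = 0 by exact: (congr1 (@sm_val _ _ _) (linear0 D)).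
by rewrite addr0.
Qed.

Lemma coh_class_eq (K : set smform) v v' : K 0 ->
  (forall z z', K z -> K z' -> K (z + z')) -> (forall z, K z -> K (- z)) ->
  coh_class (@sm_val _ _ M @` K) (sm_val v) = coh_class (@sm_val _ _ M @` K) (sm_val v') <->
  exists2 z, K z & v = v' + D z.
Proof.
move=> K0 KD KN; split=> [e|[z Kz ->]].
  have : coh_class (@sm_val _ _ M @` K) (sm_val v') (sm_val v).
    by rewrite -e; apply: coh_class_refl; exists 0.
  by move=> [_ [z Kz <-] e']; exists z => //; apply: smform_eq; rewrite -e'.
apply/seteqP; split=> [_ [_ [y Ky <-] <-]|_ [_ [y Ky <-] <-]].
  exists (sm_val (z + y)); first by exists (z + y) => //; exact: KD.
  by rewrite !d_sm -!sm_valD linearD addrA.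
exists (sm_val (- z + y)); first by exists (- z + y) => //; apply: KD => //; exact: KN.
by rewrite !d_sm -!sm_valD linearD linearN addrA addrK.
Qed.

Lemma Omega_image : Omega = @sm_val _ _ M @` setT.
Proof. by apply/seteqP; split=> [w /OmegaP[v <-]|_ [v _ <-]]; [exists v|exact: smP]. Qed.

Lemma Omega_dJ_image : Omega_dJ J = @sm_val _ _ M @` [set v | sm_dJ J v = 0].
Proof.
apply/seteqP; split=> [w [/OmegaP[v <-]]|_ [v /= jv <-]].
  by rewrite dJE => /sm_val_eq0 jv; exists v.
by split; [exact: smP|rewrite dJE; apply/sm_val_eq0].
Qed.

Lemma Omega_class_eq v v' :
  coh_class Omega (sm_val v) = coh_class Omega (sm_val v') <-> exists z, v = v' + D z.
Proof.
rewrite Omega_image; split=> [/coh_class_eq[] // z _ e|[z e]]; first by exists z.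
by apply/coh_class_eq => //; exists z.
Qed.

Lemma Omega_dJ_class_eq v v' :
  coh_class (Omega_dJ J) (sm_val v) = coh_class (Omega_dJ J) (sm_val v') <->
  exists2 z, sm_dJ J z = 0 & v = v' + D z.
Proof.
rewrite Omega_dJ_image; apply: coh_class_eq => /=.
- exact: sm_dJ0.
- move=> z z' jz jz'; by rewrite sm_dJD jz jz' addr0.
- by move=> z jz; rewrite sm_dJN jz oppr0.
Qed.

Lemma incl_coh_class v : incl_coh (coh_class (Omega_dJ J) (sm_val v)) = coh_class Omega (sm_val v).
Proof.
apply/seteqP; split=> [w [_ [g [/OmegaP[z <-] _] <-]]|w vw].
  move=> [_ /OmegaP[y <-] <-]; exists (sm_val (z + y)); first exact: smP.
  by rewrite !d_sm -!sm_valD linearD addrA.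
exists (sm_val v) => //; apply: coh_class_refl; rewrite Omega_dJ_image.
by exists 0 => //=; exact: sm_dJ0.
Qed.

Lemma cohomologyP a : cohomology Omega a <-> exists2 v, D v = 0 & a = coh_class Omega (sm_val v).
Proof.
split=> [[_ [/OmegaP[v <-]]]|[v dv ->]].
  by rewrite d_sm => /sm_val_eq0 dv <-; exists v.
by exists (sm_val v) => //; split; [exact: smP|rewrite d_sm dv].
Qed.

Lemma cohomology_dJP a : cohomology (Omega_dJ J) a <->
  exists v, [/\ D v = 0, sm_dJ J v = 0 & a = coh_class (Omega_dJ J) (sm_val v)].
Proof.
split=> [[_ [[/OmegaP[v <-]]]]|[v [dv jv ->]]].
  by rewrite d_sm dJE => /sm_val_eq0 jv /sm_val_eq0 dv <-; exists v.
exists (sm_val v) => //; split; last by rewrite d_sm dv.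
by split; [exact: smP|rewrite dJE jv].
Qed.

Lemma inclusion_bijP : set_bij (cohomology (Omega_dJ J)) (cohomology Omega) (@incl_coh R n M) <->
  inclusion_surjective ii m P D /\ inclusion_injective ii m P D.
Proof.
split=> [[_ inj surj]|[S I]]; split.
- move=> v dv; have := surj (coh_class Omega (sm_val v)).
  case; first by apply/cohomologyP; exists v.
  move=> a /cohomology_dJP[w [dw jw ->]]; rewrite incl_coh_class => /esym.
  by move=> /Omega_class_eq[z e]; exists w, z.
- move=> z jz; have : coh_class (Omega_dJ J) (sm_val (D z)) = coh_class (Omega_dJ J) (sm_val 0).
    apply: inj; rewrite ?inE.
    + by apply/cohomology_dJP; exists (D z); split=> //; exact: sm_d_d.
    + apply/cohomology_dJP; exists 0; split=> //; first exact: (linear0 D).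
      exact: sm_dJ0.
    + rewrite !incl_coh_class; apply/Omega_class_eq; exists z.
      by rewrite add0r.
  by move=> /Omega_dJ_class_eq[y jy]; rewrite add0r; exists y.
- move=> a /cohomology_dJP[v [dv jv ->]]; rewrite incl_coh_class.
  by apply/cohomologyP; exists v.
- move=> a b; rewrite !inE => /cohomology_dJP[v [dv jv ->]] /cohomology_dJP[w [dw jw ->]].
  rewrite !incl_coh_class => /Omega_class_eq[z e]; apply/Omega_dJ_class_eq.
  have [|y jy Ey] := I z.
    have -> : D z = v - w by rewrite e addrC addKr.
    by rewrite -[LHS]/(sm_dJ J (v - w)) sm_dJD sm_dJN jv jw subr0.
  by exists y; rewrite // -Ey.
- move=> a /cohomologyP[v dv ->]; have [w [z [dw jw e]]] := S v dv.
  exists (coh_class (Omega_dJ J) (sm_val w)); first by apply/cohomology_dJP; exists w.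
  by rewrite incl_coh_class; apply/esym/Omega_class_eq; exists z.
Qed.

Lemma comp_closed v : (forall r, D (P r v) = 0) -> closed_components J ((comp J)^~ v).
Proof.
move=> dP k; split; first exact: comp_U.
rewrite /comp; case: ifP => _; first by rewrite d_sm dP.
exact: (congr1 (@sm_val _ _ _) (linear0 D)).
Qed.

Lemma ddJ_consequences : ddJ_property ii m P D ->
  forall a : set rawform, cohomology Omega a ->
   (exists al : int -> rawform, closed_components J al /\ a (sum_deg al)) /\
   (a = coh_class Omega 0 -> forall al : int -> rawform,
      closed_components J al -> a (sum_deg al) -> forall k, (d @` Omega) (al k)) /\
   (exists w, [/\ a w, d w = 0 & dJ J w = 0]).
Proof.
move=> A a /cohomologyP[v dv ->].
have [w dPw [z e]] := ddJ_components (ii_sqr R) (sm_pr_pr J) (sm_pr_total J) (sm_pr_d J)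
  (@sm_d_d _ _ M) two_neq0 A dv.
have aw : coh_class Omega (sm_val v) (sm_val w).
  exists (sm_val (- z)); first exact: smP.
  by rewrite d_sm -sm_valD linearN e addrK.
split; [|split].
- by exists ((comp J)^~ w); split; [exact: comp_closed|rewrite -comp_sum].
- move=> ->; move=> al cal [_ /OmegaP[g <-]]; rewrite add0r => sal k.
  rewrite d_sm in sal.
  have alE := comp_unique (fun j => proj1 (cal j)) sal.
  have dP r : D (P r (D g)) = 0.
    have [rm|mr] := leqP r m; last first.
      have e0 : sm_pr J r (D g) = 0 by rewrite /sm_pr leqNgt mr.
      exact: etrans (f_equal D e0) (linear0 D).
    have := proj2 (cal (n%:Z - r%:Z)); rewrite alE /comp in_range // opprB addrC subrK absz_nat.
    by move=> e'; apply: smform_eq.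
  have triv := ddJ_trivial (ii_sqr R) (sm_pr_pr J) (sm_pr_total J) (sm_pr_d J)
    (@sm_d_d _ _ M) two_neq0 A dP (ex_intro _ g (erefl _)).
  rewrite alE /comp; case: ifP => _.
    have [y ->] := triv `|n%:Z - k|%N.
    by exists (sm_val y); first exact: smP.
  by exists 0; [exact: Omega0|exact: (congr1 (@sm_val _ _ _) (linear0 D))].
- have [dw jw] := (both_closedP (ii_sqr R) (sm_pr_pr J) (sm_pr_total J) (sm_pr_d J) two_neq0 w).2 dPw.
  exists (sm_val w); split=> //; first by rewrite d_sm dw.
  by rewrite dJE; apply/sm_val_eq0.
Qed.

Lemma ddJ_inclusionP : ddJ_property ii m P D <->
  inclusion_surjective ii m P D /\ inclusion_injective ii m P D.
Proof.
split=> [A|[S I]].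
  split; [apply: ddJ_surjective A|apply: ddJ_injective A] => //;
    by [exact: ii_sqr|exact: two_neq0|exact: sm_pr_pr|exact: sm_pr_total|exact: sm_pr_d|exact: sm_d_d].
exact: inclusion_ddJ (ii_sqr R) (sm_pr_pr J) (sm_pr_total J) (sm_pr_d J) S I.
Qed.

End Equivalence.

Theorem theorem4p2 (R : realType) (n : nat) (M : smooth_manifold R n.*2)
    (J : gen_complex M) :
  let property1 := ddJ_lemma J in
  let property2 :=
    set_bij (cohomology (Omega_dJ J)) (cohomology (@Omega R n.*2 M))
            (@incl_coh R n M) in
  let consequences :=
    (forall a : set (rawform M), cohomology (@Omega R n.*2 M) a ->
       (exists al : int -> rawform M,
          closed_components J al /\ a (sum_deg al)) /\
       (a = coh_class (@Omega R n.*2 M) 0 ->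
        forall al : int -> rawform M,
          closed_components J al -> a (sum_deg al) ->
          forall k : int, (@d R n.*2 M @` @Omega R n.*2 M) (al k)) /\
       (exists w : rawform M, [/\ a w, d w = 0 & dJ J w = 0])) in
  (property1 <-> property2) /\
  (property1 -> consequences) /\ (property2 -> consequences).
Proof.
move=> property1 property2 consequences.
have E : property1 <-> property2.
  by rewrite /property1 /property2 ddJ_lemmaP inclusion_bijP; exact: ddJ_inclusionP.
have imp : property1 -> consequences by move=> /ddJ_lemmaP; exact: ddJ_consequences.
by split=> //; split=> // /E.
Qed.
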